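(* Let $\ell\ge3$, let $\widetilde C$ be an orientation of $C_\ell$ that is not a directed cycle, let $0<\mu\ll3$, let $0<d\ll\mu^2$, $0<\varepsilon\ll d^4,\mu^2,1/\ell$, let $M\ge M_0>3$ be integers ($M$ being the upper bound on the number of clusters given by the diregularity lemma), let $\rho>0$ be sufficiently small in terms of $\ell,\mu,d,\varepsilon,M$, let $\beta>0$ be sufficiently small in terms of $\rho$ and all preceding constants, put $\tau:=\beta/4^{M+2}$, let $\gamma>0$ be sufficiently small in terms of all preceding constants, and let $n_0$ be sufficiently large in terms of all these. There is an integer $T$ depending only on $\ell$ and $M$ such that the following holds. Let $D$ be an oriented graph of order $n\ge n_0$ with $\sigma_{\mathrm{Ore}}^*(D)\ge(\frac34+\mu)n$ and $\alpha(D)\le\gamma n$. Take the regularity partition $V_0,V_1,\dots,V_k$ of $D$ with pure digraph $D'$, a partner map $f$ with bad set $E_{\mathrm{bad}}$, and an exceptional tiling $\mathcal F_E$, and put $D_1:=D-V(\mathcal F_E)$. Then either $V(D_1)$ is $(\widetilde C,\tau n,T)$-closed, or there is a bipartition $V(D_1)=\mathcal A\cup\mathcal B$ such that $\mathcal A$ and $\mathcal B$ are $(\widetilde C,4\tau n,T)$-closed. Moreover, if $V(D_1)=\mathcal A\cup\mathcal B$ such that $\mathcal A$ and $\mathcal B$ are $(\widetilde C,4\tau n,T)$-closed, then there is a $(\widetilde C,\rho)$-robust vector $2\mathbf e_{\mathcal A}+(\ell-2)\mathbf e_{\mathcal B}$ with respect to the partition $(\mathcal A,\mathcal B)$.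
   Context: Notation $a\ll b$: $a$ is chosen sufficiently small in terms of $b$. An oriented graph is a finite loopless digraph with at most one arc between any two vertices; $A(D)$ is the arc set. $\alpha(D)$ is the independence number of the underlying undirected graph. $d_D^*(v):=\max\{d_D^+(v),d_D^-(v)\}$, and $\sigma_{\mathrm{Ore}}^*(D):=\min\{d_D^*(x)+d_D^*(y):x\ne y,\ xy,yx\notin A(D)\}$, with value $\infty$ if the underlying graph is complete. $P^+:=\{v\in V(D):d_D^+(v)\ge d_D^-(v)\}$, $P^-:=V(D)\setminus P^+$ (either may be empty). A $\widetilde C$-tiling is a set of pairwise vertex-disjoint copies of $\widetilde C$; $V(\mathcal F)$ is the set of vertices it covers; a $\widetilde C$-factor is a $\widetilde C$-tiling covering all vertices. Closedness (in $D_1$): distinct $x,y\in V(D_1)$ are $(\widetilde C,q,t)$-reachable if for every $W\subseteq V(D_1)\setminus\{x,y\}$ with $|W|\le q$ there is $Q\subseteq V(D_1)\setminus(W\cup\{x,y\})$ with $|Q|\le t\ell-1$ such that both $D_1[Q\cup\{x\}]$ and $D_1[Q\cup\{y\}]$ have $\widetilde C$-factors. A set $U\subseteq V(D_1)$ is $(\widetilde C,q,t)$-closed if every two distinct vertices of $U$ are $(\widetilde C,q,t)$-reachable. Robustness (in $D_1$): the vector $a\mathbf e_{\mathcal A}+b\mathbf e_{\mathcal B}$ is $(\widetilde C,\rho)$-robust with respect to $(\mathcal A,\mathcal B)$ if for every $W\subseteq V(D_1)$ with $|W|\le\rho n$ there is a copy of $\widetilde C$ in $D_1-W$ with exactly $a$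 vertices in $\mathcal A$ and exactly $b$ vertices in $\mathcal B$. For disjoint vertex sets $X,Y$, $d_{D'}(X,Y)$ is the number of arcs of $D'$ from $X$ to $Y$ divided by $|X||Y|$; $(X,Y)$ is $\varepsilon$-regular if $|d_{D'}(X',Y')-d_{D'}(X,Y)|<\varepsilon$ for all $X'\subseteq X$, $Y'\subseteq Y$ with $|X'|\ge\varepsilon|X|$, $|Y'|\ge\varepsilon|Y|$. The regularity partition is the output of the degree-form diregularity lemma applied to $D$ with parameters $\varepsilon,d,M_0$ and initial partition $(P^+,P^-)$, stated as follows: a partition $V(D)=V_0\cup V_1\cup\dots\cup V_k$ refining $(P^+,P^-)$ and a spanning subdigraph $D'\subseteq D$ (the pure digraph) such that: $M_0\le k\le M$, $|V_0|\le\varepsilon n$, $|V_1|=\dots=|V_k|=:m$; $D'[V_i]$ is empty for every $i\in[k]$, and $V_0$ is isolated in $D'$; $d_{D'}^{\pm}(v)\ge d_D^{\pm}(v)-(d+2\varepsilon)n$ for every $v\in V(D)$; for all distinct $i,j\in[k]$, $(V_i,V_j)$ is $\varepsilon$-regular in $D'$ with density $p_{(i,j)}:=d_{D'}(V_i,V_j)$ either $0$ or at least $d$. A partner map is a map $f:[k]\to[k]$ with $f(i)\ne i$ such that $p_{(i,f(i))}\ge d$ whenever $V_i\subseteq P^+$ and $p_{(f(i),i)}\ge d$ whenever $V_i\subseteq P^-$. Put $B_i:=\{x\in V_i:d_{D'}^+(x,V_{f(i)})<(p_{(i,f(i))}-\varepsilon)m\}$ if $V_i\subseteq P^+$, and $B_i:=\{x\in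 V_i:d_{D'}^-(x,V_{f(i)})<(p_{(f(i),i)}-\varepsilon)m\}$ if $V_i\subseteq P^-$, where $d_{D'}^{\pm}(x,V_j)$ counts out-/in-neighbours of $x$ in $V_j$. The bad set is $E_{\mathrm{bad}}:=V_0\cup\bigcup_iB_i$. An exceptional tiling is a $\widetilde C$-tiling $\mathcal F_E$ of $D$ such that every copy in it contains exactly one vertex of $E_{\mathrm{bad}}$, $E_{\mathrm{bad}}\subseteq V(\mathcal F_E)$, $|V(\mathcal F_E)|=\ell|E_{\mathrm{bad}}|\le2\ell\varepsilon n\le\sqrt\varepsilon n$, and $|V(\mathcal F_E)\cap V_i|\le3\sqrt\varepsilon m$ for every $i\in[k]$.
   Formalization: The ''Moreover'' fails for tiny parts (e.g. 𝒜 a single vertex is trivially closed, but no copy has two vertices in it); for arbitrary partitions into closed parts it is stated only when |𝒜|,|ℬ| ≥ 2ρn, and robustness is also included for the bipartition in the second alternative. *)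

(* Defs.v *)
From HB Require Import structures.
From mathcomp Require Import all_boot all_order all_algebra.
From mathcomp Require Import constructive_ereal reals.

Set Implicit Arguments.
Unset Strict Implicit.
Unset Printing Implicit Defensive.

Import Order.TTheory GRing.Theory Num.Theory.
Local Open Scope ring_scope.

(* A digraph is an arc relation on a finite vertex type; its induced
   subdigraphs are represented by their vertex sets. *)

Definition oriented (V : finType) (e : rel V) : Prop :=
  irreflexive e /\ forall x y, e x y -> ~~ e y x.

Definition independent (V : finType) (e : rel V) (S : {set V}) : bool :=
  [forall x in S, forall y in S, ~~ e x y].

Definition alpha (V : finType) (e : rel V) : nat :=
  (\max_(S : {set V} | independent e S) #|S|)%N.

Definition outdeg_in (V : finType) (e : rel V) (x : V) (Y : {set V}) : nat :=
  #|[set y in Y | e x y]|.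

Definition indeg_in (V : finType) (e : rel V) (x : V) (Y : {set V}) : nat :=
  #|[set y in Y | e y x]|.

Definition outdeg (V : finType) (e : rel V) (x : V) : nat :=
  outdeg_in e x setT.

Definition indeg (V : finType) (e : rel V) (x : V) : nat :=
  indeg_in e x setT.

Definition deg_star (V : finType) (e : rel V) (x : V) : nat :=
  maxn (outdeg e x) (indeg e x).

Definition sigma_ore (R : realType) (V : finType) (e : rel V) : \bar R :=
  \big[Order.min/+oo%E]_(p : V * V |
      [&& p.1 != p.2, ~~ e p.1 p.2 & ~~ e p.2 p.1])
    ((deg_star e p.1 + deg_star e p.2)%:R)%:E.

Definition Pplus (V : finType) (e : rel V) : {set V} :=
  [set v | (indeg e v <= outdeg e v)%N].

Definition Pminus (V : finType) (e : rel V) : {set V} := ~: Pplus e.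

(* The vertices of C_ell are the elements of 'I_ell in cyclic order;
   ordS is the cyclic successor. *)
Definition cycle_orientation (ell : nat) (c : rel 'I_ell) : Prop :=
  oriented c /\
  forall i j, (c i j || c j i) = (j == ordS i) || (i == ordS j).

Definition directed_cycle (ell : nat) (c : rel 'I_ell) : Prop :=
  (forall i, c i (ordS i)) \/ (forall i, c (ordS i) i).

(* S is the vertex set of a (not necessarily induced) copy of c in e. *)
Definition is_copy (ell : nat) (c : rel 'I_ell) (V : finType) (e : rel V)
    (S : {set V}) : Prop :=
  exists g : 'I_ell -> V,
    [/\ injective g, forall i j, c i j -> e (g i) (g j) & S = [set g i | i in 'I_ell]].

(* Vertex-disjoint copies have distinct vertex sets, so a tiling is given by
   the family of the vertex sets of its copies, and V(F) is cover F. *)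
Definition is_tiling (ell : nat) (c : rel 'I_ell) (V : finType) (e : rel V)
    (F : {set {set V}}) : Prop :=
  trivIset F /\ forall S, S \in F -> is_copy c e S.

Definition has_factor (ell : nat) (c : rel 'I_ell) (V : finType) (e : rel V)
    (U : {set V}) : Prop :=
  exists F : {set {set V}}, is_tiling c e F /\ cover F = U.

(* In the next three definitions V1 is the vertex set of the induced
   subdigraph D_1 of D. The bound #|Q| < t * ell is |Q| <= t ell - 1 without
   truncated subtraction. *)
Definition reachable (R : realType) (ell : nat) (c : rel 'I_ell) (V : finType)
    (e : rel V) (V1 : {set V}) (q : R) (t : nat) (x y : V) : Prop :=
  forall W : {set V}, W \subset V1 :\: [set x; y] -> #|W|%:R <= q ->
    exists Q : {set V},
      [/\ Q \subset V1 :\: (W :|: [set x; y]), (#|Q| < t * ell)%N,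
          has_factor c e (x |: Q) & has_factor c e (y |: Q)].

Definition is_closed (R : realType) (ell : nat) (c : rel 'I_ell) (V : finType)
    (e : rel V) (V1 : {set V}) (q : R) (t : nat) (U : {set V}) : Prop :=
  U \subset V1 /\
  forall x y, x \in U -> y \in U -> x != y -> reachable c e V1 q t x y.

(* The vector a e_A + b e_B; the number n is the order #|V| of D, not of D_1. *)
Definition robust (R : realType) (ell : nat) (c : rel 'I_ell) (V : finType)
    (e : rel V) (V1 : {set V}) (rho : R) (a b : nat) (A B : {set V}) : Prop :=
  forall W : {set V}, W \subset V1 -> #|W|%:R <= rho * #|V|%:R ->
    exists S : {set V},
      [/\ is_copy c e S, S \subset V1 :\: W,
          #|S :&: A| = a & #|S :&: B| = b].

Definition bipartition (V : finType) (U A B : {set V}) : Prop :=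
  A :|: B = U /\ [disjoint A & B].

(* A set of at most rho n vertices can be deleted entirely in the definition of
   robustness, so no vector with a positive coefficient at such a part is
   rho-robust, although a part with one vertex, say, is trivially closed. *)
Definition non_negligible (R : realType) (V : finType) (rho : R)
    (A : {set V}) : Prop :=
  2 * rho * #|V|%:R <= #|A|%:R.

Definition density (R : realType) (V : finType) (e : rel V)
    (X Y : {set V}) : R :=
  #|[set p in setX X Y | e p.1 p.2]|%:R / (#|X|%:R * #|Y|%:R).

Definition regular_pair (R : realType) (V : finType) (e : rel V) (eps : R)
    (X Y : {set V}) : Prop :=
  forall X' Y' : {set V}, X' \subset X -> Y' \subset Y ->
    eps * #|X|%:R <= #|X'|%:R -> eps * #|Y|%:R <= #|Y'|%:R ->
    `|density R e X' Y' - density R e X Y| < eps.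

(* e' is the pure digraph, V0 the exceptional set, Vc the clusters and m their
   common size. As usual for the diregularity lemma, only the clusters, and not
   the exceptional set, are required to lie in one part of (P^+, P^-). *)
Record regularity_partition (R : realType) (V : finType) (e : rel V)
    (eps d : R) (M0 M : nat) (e' : rel V) (V0 : {set V}) (k : nat)
    (Vc : 'I_k -> {set V}) (m : nat) : Prop := RegularityPartition {
  rp_pure : subrel e' e;
  rp_cover : V0 :|: \bigcup_(i < k) Vc i = [set: V];
  rp_disjoint0 : forall i, [disjoint V0 & Vc i];
  rp_disjoint : forall i j, i != j -> [disjoint Vc i & Vc j];
  rp_refine : forall i, Vc i \subset Pplus e \/ Vc i \subset Pminus e;
  rp_number : (M0 <= k <= M)%N;
  rp_exceptional : #|V0|%:R <= eps * #|V|%:R;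
  rp_size : forall i, #|Vc i| = m;
  rp_empty : forall i x y, x \in Vc i -> y \in Vc i -> ~~ e' x y;
  rp_isolated : forall x y, x \in V0 -> ~~ e' x y /\ ~~ e' y x;
  rp_outdeg : forall v,
    (outdeg e v)%:R - (d + 2 * eps) * #|V|%:R <= (outdeg e' v)%:R;
  rp_indeg : forall v,
    (indeg e v)%:R - (d + 2 * eps) * #|V|%:R <= (indeg e' v)%:R;
  rp_regular : forall i j, i != j -> regular_pair e' eps (Vc i) (Vc j);
  rp_density : forall i j, i != j ->
    density R e' (Vc i) (Vc j) = 0 \/ d <= density R e' (Vc i) (Vc j)
}.

Definition partner_map (R : realType) (V : finType) (e e' : rel V) (d : R)
    (k : nat) (Vc : 'I_k -> {set V}) (f : 'I_k -> 'I_k) : Prop :=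
  forall i,
    [/\ f i != i,
        Vc i \subset Pplus e -> d <= density R e' (Vc i) (Vc (f i)) &
        Vc i \subset Pminus e -> d <= density R e' (Vc (f i)) (Vc i)].

Definition bad_in_cluster (R : realType) (V : finType) (e e' : rel V) (eps : R)
    (k : nat) (Vc : 'I_k -> {set V}) (m : nat) (f : 'I_k -> 'I_k)
    (i : 'I_k) : {set V} :=
  [set x in Vc i |
     ((Vc i \subset Pplus e) &&
      ((outdeg_in e' x (Vc (f i)))%:R <
         (density R e' (Vc i) (Vc (f i)) - eps) * m%:R)) ||
     ((Vc i \subset Pminus e) &&
      ((indeg_in e' x (Vc (f i)))%:R <
         (density R e' (Vc (f i)) (Vc i) - eps) * m%:R))].

Definition bad_set (R : realType) (V : finType) (e e' : rel V) (eps : R)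
    (V0 : {set V}) (k : nat) (Vc : 'I_k -> {set V}) (m : nat)
    (f : 'I_k -> 'I_k) : {set V} :=
  V0 :|: \bigcup_(i < k) bad_in_cluster e e' eps Vc m f i.

Record exceptional_tiling (R : realType) (ell : nat) (c : rel 'I_ell)
    (V : finType) (e : rel V) (eps : R) (k : nat) (Vc : 'I_k -> {set V})
    (m : nat) (Ebad : {set V}) (F : {set {set V}}) : Prop :=
  ExceptionalTiling {
  et_tiling : is_tiling c e F;
  et_one : forall S, S \in F -> #|S :&: Ebad| = 1%N;
  et_cover : Ebad \subset cover F;
  et_card : #|cover F| = (ell * #|Ebad|)%N;
  et_small : (ell * #|Ebad|)%:R <= 2 * ell%:R * eps * #|V|%:R;
  et_sqrt : 2 * ell%:R * eps * #|V|%:R <= Num.sqrt eps * #|V|%:R;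
  et_cluster : forall i, #|cover F :&: Vc i|%:R <= 3 * Num.sqrt eps * m%:R
}.

(* Main.v *)
(** The first alternative always holds: the remainder [D_1] is itself closed.
    This and the robust vectors rest on one degree argument for a bipartition
    of almost all vertices into non-negligible parts [A] and [B]. As the
    independence number is small, every linear-sized set contains all oriented
    paths on [ell] vertices. So if there is no copy with two vertices in [A] and the
    others in [B], then adjacent vertices of [A] have few common neighbours in
    [B], and few triangles have one vertex in [A] and two in [B] (or else there
    are few edges between [A] and [B] at all). For most edges [sw] between
    [A] and [B] it follows that [s] has at most half as many neighbours in [B]
    as [w] has non-neighbours in [B], and similarly with [A] and [B] exchanged.
    A weighted count of these edges, with a weight chosen by AM-GM, is then
    incompatible with the Ore condition at [3/4 + mu].

    For closedness, regularity and the partner map show that the good vertices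
    of each cluster form a closed class. Two classes merge as soon as there are
    robustly two copies whose index vectors differ by moving one vertex from one
    class to the other. If no two of several classes merge, deleting the small sets that
    witness this leaves a class and its complement which contradict the degree
    argument. After at most [M] mergers a single class is left. *)

Require Import Defs.
From HB Require Import structures.
From mathcomp Require Import all_boot all_order all_algebra.
From mathcomp Require Import constructive_ereal reals zify lra ring.
From mathcomp Require boolp.

Set Implicit Arguments.
Unset Strict Implicit.
Unset Printing Implicit Defensive.

Import Order.TTheory GRing.Theory Num.Theory.

(** * Closed oriented walks as words *)

(** The word of the cycle decides the case. With two sources, two vertices of [A] with a large
    common out-neighbourhood in [B] already give a copy, so few edges cross; the delicate case is
    one source and one sink. There the Ore condition enters through the gain of a vertex: twice its
    degree into the other part minus its number of non-neighbours in its own part. Inside a part of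
    relative size [a], the star degrees plus half the codegrees sum to at most [3/4 a ^ 2] (relative
    to the squared order), so the average gain is at least about [3/4 + mu - 3/2 a], and the two
    averages have a positive sum. Typical cross edges, however, turn a gain in one part into a
    larger loss in the other.

    The obstacle is that the Ore condition bounds no single degree. Vertices below half the Ore
    bound are pairwise adjacent and meet few cross edges. If one part has many of them, they are
    non-adjacent to nearly all of the other part, whose average degree then rises by their average
    deficit [lam]. *)

Definition dir (V : finType) (e : rel V) (b : bool) (x y : V) : bool :=
  if b then e x y else e y x.

Fixpoint opath (V : finType) (e : rel V) (w : seq bool) (x : V) (p : seq V) : bool :=
  match w, p with
  | [::], [::] => true
  | b :: w', y :: p' => dir e b x y && opath e w' y p'
  | _, _ => false
  end.

(* [w] spells an orientation of a cycle, [true] for an arc traversed forwards;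
   every cycle of [e] so oriented is a copy of [c]. *)
Definition spells (ell : nat) (c : rel 'I_ell) (V : finType) (e : rel V)
    (w : seq bool) : Prop :=
  size w = ell /\ forall x p, uniq (x :: p) -> opath e w x (rcons p x) ->
    is_copy c e [set y in x :: p].

Section Words.
Variables (V : finType) (e : rel V).

Lemma opath_size w x p : opath e w x p -> size w = size p.
Proof. by elim: w x p => [|b w IH] x [|y p] //= /andP[_ /IH ->]. Qed.

Lemma opath_cat u v x p q : size u = size p ->
  opath e (u ++ v) x (p ++ q) = opath e u x p && opath e v (last x p) q.
Proof. by elim: u x p => [|b u IH] x [|y p] //= [/IH->]; rewrite andbA. Qed.

Lemma opath_nth w x p x0 b0 i : opath e w x p -> i < size w ->
  dir e (nth b0 w i) (nth x0 (x :: p) i) (nth x0 p i).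
Proof.
elim: w x p i => [|b w IH] x [|y p] [|i] //= /andP[xy wp]; first by [].
exact: IH.
Qed.

Lemma dirN b x y : dir e (~~ b) x y = dir e b y x.
Proof. by case: b. Qed.

Lemma opath_rev w x p : opath e w x p ->
  opath e (rev (map negb w)) (last x p) (rev (belast x p)).
Proof.
elim: w x p => [|b w IH] x [|y p] //= /andP[xy wp].
rewrite !rev_cons -!cats1 opath_cat; last first.
  by rewrite !size_rev size_map size_belast (opath_size wp).
rewrite IH //= andbT dirN.
suff -> : last (last y p) (rev (belast y p)) = y by [].
case: p wp {IH} => [|z p] //= _; by rewrite rev_cons last_rcons.
Qed.
End Words.

Section Spell.
Variables (ell : nat) (c : rel 'I_ell) (V : finType) (e : rel V).

Lemma spells_rot u v : spells c e (u ++ v) -> spells c e (v ++ u).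
Proof.
case=> sz H; split=> [|x p ux]; first by rewrite size_cat addnC -size_cat.
case: v sz H => [|b v] sz H; first by rewrite cat0s => wp; apply: H; rewrite ?cats0.
case: u sz H => [|b' u] sz H; first by rewrite cats0 => wp; apply: H.
move=> wp; have szp := opath_size wp.
set k := size (b :: v).
have kp : k <= size p by move: szp; rewrite size_cat size_rcons /k /=; lia.
have k0 : 0 < k by [].
have [p1 [y E]] : exists p1 y, take k p = rcons p1 y.
  have szt : size (take k p) = k by rewrite size_takel.
  by case: (lastP (take k p)) szt => [|p1 y] szt; [by [] | exists p1, y].
have pE : p = rcons p1 y ++ drop k p by rewrite -E cat_take_drop.
have szk : size (b :: v) = size (rcons p1 y).
  by rewrite -E size_takel.
have /andP[w1 w2] : opath e (b :: v) x (rcons p1 y) && opath e (b' :: u) y (rcons (drop k p) x).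
  by move: wp; rewrite {1}pE rcons_cat opath_cat // last_rcons.
have perm : perm_eq (y :: (drop k p ++ x :: p1)) (x :: p).
  rewrite [X in perm_eq _ (x :: X)]pE -cats1; apply/permP => P.
  by rewrite /= !count_cat /=; lia.
have -> : [set z in x :: p] = [set z in y :: (drop k p ++ x :: p1)].
  by apply/setP => z; rewrite !in_set (perm_mem perm).
apply: H; first by rewrite (perm_uniq perm).
rewrite rcons_cat rcons_cons -(cat_rcons x) opath_cat ?(opath_size w2) //.
by rewrite w2 last_rcons w1.
Qed.

(** The same cycle traversed backwards: the letters come in reverse order and every arc is met from
    its other end. *)
Lemma spells_flip w : spells c e w -> spells c e (rev (map negb w)).
Proof.
case=> sz H; split=> [|x p ux wp]; first by rewrite size_rev size_map.
have := opath_rev wp; rewrite -map_rev revK -map_comp map_id_in; last by move=> b _ /=; rewrite negbK.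
rewrite last_rcons belast_rcons rev_cons => wr.
have -> : [set y in x :: p] = [set y in x :: rev p].
  by apply/setP => y; rewrite !inE mem_rev.
by apply: H => //=; rewrite mem_rev rev_uniq.
Qed.
End Spell.

(** * Sources of a cycle orientation *)

Section Shape.
Variables (ell : nat) (c : rel 'I_ell) (V : finType) (e : rel V).
Hypotheses (cyc : cycle_orientation c) (ndir : ~ directed_cycle c).

Lemma spells_word : 0 < ell -> spells c e [seq c i (ordS i) | i <- enum 'I_ell].
Proof.
move=> l0; have i0 : 'I_ell := Ordinal l0.
split=> [|x p ux wp]; first by rewrite size_map size_enum_ord.
have szp : (size p).+1 = ell.
  by have := opath_size wp; rewrite size_map size_enum_ord size_rcons.
have Hi i : dir e (c i (ordS i)) (nth x (x :: p) i) (nth x (x :: p) (ordS i)).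
  have := @opath_nth _ _ _ _ _ x true i wp; rewrite size_map size_enum_ord => /(_ (ltn_ord i)).
  rewrite (nth_map i) ?size_enum_ord // nth_ord_enum -rcons_cons nth_rcons /= szp ltn_ord.
  rewrite nth_rcons /=; case: ltnP => h.
    by rewrite modn_small //; move: h; rewrite -ltnS szp.
  have -> : nat_of_ord i = size p by apply/eqP; rewrite eqn_leq h andbT -ltnS szp.
  by rewrite szp modnn eqxx.
exists (fun i : 'I_ell => nth x (x :: p) i); split.
- move=> i j /eqP; rewrite nth_uniq ?szp //; first by move/eqP/val_inj.
  + by rewrite /= szp.
  + by rewrite /= szp.
- case: cyc => -[_ asym] adj i j cij.
  have := adj i j; rewrite cij /= => /esym/orP[/eqP jE | /eqP iE].
    by have := Hi i; rewrite -jE cij.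
  by have := Hi j; rewrite -iE (negbTE (asym _ _ cij)).
apply/setP => z; rewrite in_set; apply/idP/imsetP => [/(nthP x)[k kl <-]|[k _ ->]].
  have kl' : k < ell by rewrite -szp.
  by exists (Ordinal kl').
by rewrite mem_nth //= szp.
Qed.

Lemma word_dichotomy (w : seq bool) :
  (exists a b, w = nseq a true ++ nseq b false) \/
  (exists u v, w = u ++ false :: true :: v).
Proof.
elim: w => [|x w [[a [b ->]]|[u [v ->]]]]; first by left; exists 0, 0.
- case: x; first by left; exists a.+1, b.
  case: a => [|a]; first by left; exists 0, b.+1.
  by right; exists [::], (nseq a true ++ nseq b false).
- by right; exists (x :: u), v.
Qed.

(** A word that begins with [true] and ends with [false] starts at a source, since both arcs at the
    base vertex leave it. As the orientation is not a directed cycle, both letters occur, so some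
    rotation has this form. The inner path [u] can then be sought inside a single
    out-neighbourhood. *)
Lemma word_source : exists2 u, size u = ell.-2 & spells c e (true :: u ++ [:: false]).
Proof.
case: (posnP ell) => [l0|l0].
  case: ndir; left => i; by move: (ltn_ord i); rewrite {2}l0.
have S := spells_word l0; set w := map _ _ in S.
have inw (b : bool) : (forall i, c i (ordS i) = b) \/ ~~ b \in w.
  case: (boolP [forall i, c i (ordS i) == b]) => [/forallP H|].
    by left=> i; apply/eqP.
  case/forallPn => i ib; right; apply/mapP; exists i; first by rewrite mem_enum.
  by case: (c i _) ib; case: b.
have fw : false \in w by case: (inw true) => // H; case: ndir; left => i; rewrite H.
have tw : true \in w.
  case: (inw false) => // H; case: ndir; right => i; case: cyc => _ /(_ i (ordS i)).
  by rewrite H eqxx.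
have fin w' : spells c e w' -> (exists v1, w' = true :: rcons v1 false) ->
   exists2 u, size u = ell.-2 & spells c e (true :: u ++ [:: false]).
  move=> Sw [v1 E]; exists v1; last by rewrite cats1 -E.
  by move: (proj1 Sw); rewrite E /= size_rcons => <-.
case: (word_dichotomy w) => [[a [b wE]]|[u [v wE]]].
  apply: (fin _ S).
  case: a wE => [|a] wE; first by move: tw; rewrite wE mem_nseq andbF.
  case: b wE => [|b] wE; first by move: fw; rewrite wE mem_cat !mem_nseq andbF.
  exists (nseq a true ++ nseq b false); rewrite wE -cats1 -catA /=.
  by congr (_ :: _ ++ _); elim: b {wE} => //= b ->.
apply: (@fin (true :: v ++ u ++ [:: false])).
  have -> : true :: v ++ u ++ [:: false] = (true :: v) ++ (u ++ [:: false]) by [].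
  by apply: spells_rot; rewrite -catA /= -wE.
by exists (v ++ u); rewrite -cats1 -catA.
Qed.

(** Once the word starts at a source, a factor [false :: true] marks a second source. Without such a
    factor there are only two runs, and reading backwards exchanges their lengths, which gives
    [b <= a]. *)
Lemma word_shape :
  (exists a b, [/\ 0 < b <= a, a + b = ell & spells c e (nseq a true ++ nseq b false)]) \/
  (exists u v, spells c e (true :: u ++ false :: true :: v ++ [:: false])).
Proof.
have [u0 szu S] := word_source.
case: (word_dichotomy (true :: u0 ++ [:: false])) => [[a [b wE]]|[u [v wE]]]; last first.
  right; case: u wE => [//|x u] [xE wE].
  case: (lastP v) wE => [|v' y] wE.
    by have := congr1 (last true) wE; rewrite !last_cat.
  have := congr1 (last true) wE; rewrite !last_cat /= last_rcons => yE.
  by exists u, v'; move: wE; rewrite -yE -cats1 => <-.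
left; have sz : a + b = ell.
  by rewrite -(proj1 S) wE size_cat !size_nseq.
have a0 : 0 < a by case: a wE {sz} => // wE; case: b wE.
have b0 : 0 < b.
  case: b wE {sz} => // wE; have := congr1 (last true) wE.
  by rewrite /= last_cat /= cats0; case: a {a0 wE} => //= a; elim: a.
rewrite wE in S; case: (leqP b a) => ba; first by exists a, b; rewrite b0 ba.
exists b, a; rewrite a0 ltnW // addnC; split=> //.
have := spells_flip S; rewrite map_cat !map_nseq rev_cat.
suff revn n (x : bool) : rev (nseq n x) = nseq n x by rewrite !revn.
elim: n => //= n IH; rewrite rev_cons IH; by elim: n {IH} => //= n ->.
Qed.
End Shape.

(** * Reversal of all arcs, which exchanges sources and sinks *)

Section Dual.
Variables (ell : nat) (c : rel 'I_ell) (V : finType) (e : rel V).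
Definition conv (T : finType) (r : rel T) : rel T := fun x y => r y x.

Lemma opath_conv w x p : opath (conv e) w x p = opath e (map negb w) x p.
Proof. by elim: w x p => [|b w IH] x [|y p] //=; rewrite IH; case: b. Qed.

Lemma is_copy_conv S : is_copy (conv c) (conv e) S <-> is_copy c e S.
Proof. by split=> -[g [gi ga gS]]; exists g; split=> // i j; apply: ga. Qed.

Lemma spells_conv w : spells (conv c) (conv e) w <-> spells c e (map negb w).
Proof.
split=> -[sz H]; split=> [|x p ux wp]; rewrite ?size_map // in sz *.
  by apply/is_copy_conv/H; rewrite // opath_conv.
by apply/is_copy_conv/H; rewrite // -opath_conv.
Qed.

Lemma cycle_orientation_conv : cycle_orientation c -> cycle_orientation (conv c).
Proof.
case=> -[irr asym] adj; split; first by split=> [i|x y]; [apply: irr | apply: asym].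
by move=> i j; rewrite /conv orbC adj.
Qed.

Lemma directed_cycle_conv : directed_cycle (conv c) -> directed_cycle c.
Proof. by case=> H; [right|left]. Qed.
End Dual.

(** * Long paths in digraphs with small independence number *)

Definition adj (V : finType) (e : rel V) (x y : V) : bool := e x y || e y x.

Definition nbh (V : finType) (e : rel V) (b : bool) (x : V) (Y : {set V}) : {set V} :=
  [set y in Y | dir e b x y].

Section Embedding.
Variables (V : finType) (e : rel V).
Hypothesis (ori : oriented e).

Lemma dir_irr b x : dir e b x x = false.
Proof. by case: ori => irr _; case: b => /=; rewrite irr. Qed.

Lemma leq_alpha (S : {set V}) : independent e S -> #|S| <= alpha e.
Proof. exact: (@leq_bigmax_cond _ (independent e) (fun S : {set V} => #|S|)). Qed.

Lemma arc_in (S : {set V}) : alpha e < #|S| -> exists x y, [/\ x \in S, y \in S & e x y].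
Proof.
move=> aS; case: (boolP (independent e S)) => [iS|].
  by move: aS; rewrite ltnNge leq_alpha.
case/forallPn => x; rewrite negb_imply => /andP[xS /forallPn[y]].
by rewrite negb_imply negbK => /andP[yS xy]; exists x, y.
Qed.

Lemma sum_nbh (b : bool) (S Y : {set V}) :
  \sum_(x in S) #|nbh e b x Y| = \sum_(y in Y) #|nbh e (~~ b) y S|.
Proof.
rewrite (eq_bigr (fun x => \sum_(y in Y) dir e b x y)); last first.
  by move=> x _; rewrite -sum1_card [RHS]big_mkcond [LHS]big_mkcond; apply: eq_bigr => y _ /=;
     rewrite inE; case: (y \in Y); case: (dir e b x y).
rewrite exchange_big; apply: eq_bigr => y _ /=.
by rewrite -sum1_card [RHS]big_mkcond [LHS]big_mkcond; apply: eq_bigr => x _ /=;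
   rewrite inE dirN; case: (x \in S); case: (dir e b x y).
Qed.

(* Some vertex of [S] has at most [2 k] neighbours in [S], so an independent set
   can be chosen greedily. *)
Lemma small_degree_card b k (S : {set V}) :
  (forall x, x \in S -> #|nbh e b x S| <= k) -> #|S| <= k.*2.+1 * alpha e.
Proof.
move=> deg.
suff [I [IS Iind SI]] : exists I : {set V}, [/\ I \subset S, independent e I & #|S| <= k.*2.+1 * #|I|].
  by apply: leq_trans SI _; rewrite leq_mul2l leq_alpha ?orbT.
move: {2}#|S| (leqnn #|S|) => n; elim: n S deg => [|n IH] S deg Sn.
  exists set0; rewrite sub0set; split=> //; last by move: Sn; rewrite leqn0 => /eqP->.
  by apply/forallP => x; rewrite inE.
have [->|[x0 x0S]] := set_0Vmem S.
  exists set0; rewrite sub0set cards0; split=> //.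
  by apply/forallP => x; rewrite inE.
(* The degrees in direction [b] and in direction [~~ b] have the same sum, so some vertex has at
   most [k] neighbours in the other direction too. *)
have [x xS xk] : exists2 x, x \in S & #|nbh e (~~ b) x S| <= k.
  case: (boolP [exists x in S, #|nbh e (~~ b) x S| <= k]).
    by case/existsP => x /andP[xS xk]; exists x.
  rewrite negb_exists => /forallP H.
  have : \sum_(x in S) k.+1 <= \sum_(x in S) #|nbh e (~~ b) x S|.
    by apply: leq_sum => x xS; have := H x; rewrite xS /= -ltnNge.
  have le : \sum_(x in S) #|nbh e b x S| <= \sum_(x in S) k by apply: leq_sum.
  rewrite sum_nbh negbK => /leq_trans/(_ le).
  rewrite !sum_nat_const leq_mul2l ltnn orbF => /eqP S0.
  by move: x0S; rewrite (cards0_eq S0) inE.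
pose D := x |: (nbh e b x S :|: nbh e (~~ b) x S).
have DS : #|S| <= #|S :\: D| + k.*2.+1.
  rewrite -(cardsID D S) addnC leq_add2l; apply: leq_trans (subset_leq_card (subsetIr _ _)) _.
  rewrite cardsU1; have := cardsU (nbh e b x S) (nbh e (~~ b) x S).
  by have := deg _ xS; have := leq_b1 (x \notin nbh e b x S :|: nbh e (~~ b) x S); lia.
have [||I [IS Iind SI]] := IH (S :\: D).
- move=> y; rewrite inE => /andP[_ yS]; apply: leq_trans (deg _ yS).
  by apply/subset_leq_card/subsetP => z; rewrite !inE -andbA => /and3P[_ -> ->].
- have : #|S :\: D| < #|S|.
    rewrite -(cardsID D S) -[X in X < _]add0n ltn_add2r card_gt0.
    by apply/set0Pn; exists x; rewrite !inE xS eqxx.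
  by lia.
have xI y : y \in I -> [/\ y \in S, ~~ e x y & ~~ e y x].
  move=> /(subsetP IS); rewrite !inE !negb_or !negb_and => /andP[/and3P[_ h1 h2] yS].
  by move: h1 h2; rewrite yS /=; case: (b) => /= -> ->.
have nx : x \notin I by apply/negP => /(subsetP IS); rewrite !inE eqxx.
exists (x |: I); split.
- by apply/subsetP => y; rewrite in_setU1 => /orP[/eqP->|/xI[]].
- apply/forallP => y; apply/implyP; rewrite in_setU1 => yI.
  apply/forallP => z; apply/implyP; rewrite in_setU1.
  case/orP: yI => [/eqP->|yI]; case/orP => [/eqP->|zI].
  + by case: ori => irr _; rewrite irr.
  + by case: (xI _ zI).
  + by case: (xI _ yI).
  by move/forallP: Iind => /(_ y); rewrite yI => /forallP/(_ z); rewrite zI.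
by rewrite cardsU1 nx mulnDr muln1; lia.
Qed.

(** The letters are processed from the last to the first, each time discarding the vertices with too
    few continuations. These have small degree in one direction among themselves, so
    [small_degree_card] bounds the loss per letter. A vertex that survives all letters starts a
    path: more than [size w] choices at each step leave one off the vertices already used. *)
Lemma opath_embed (w : seq bool) (Z : {set V}) :
  size w * ((size w).*2.+1 * alpha e) < #|Z| ->
  exists x p, [/\ uniq (x :: p), {subset x :: p <= Z} & opath e w x p].
Proof.
set L := size w => hZ.
(* [F w] is the set of vertices from which [w] can be followed greedily. *)
pose fix F (u : seq bool) : {set V} := match u with
  | [::] => Z | b :: u' => [set x in F u' | L < #|nbh e b x (F u')|] end.
have Fsub u : F u \subset Z.
  elim: u => //= b u IH; apply: subset_trans IH; apply/subsetP => x; by rewrite inE => /andP[].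
have Fcard u : #|Z| <= #|F u| + size u * (L.*2.+1 * alpha e).
  elim: u => [|b u IH] /=; first by rewrite mul0n addn0.
  apply: leq_trans IH _; rewrite mulSn addnA leq_add2r.
  rewrite -(cardsID [set x in F u | L < #|nbh e b x (F u)|] (F u)).
  apply: leq_add; first by apply: subset_leq_card; apply: subsetIr.
  apply: (@small_degree_card b) => x; rewrite !inE => /andP[h xF].
  move: h; rewrite xF /= -leqNgt => h; apply: leq_trans h.
  by apply/subset_leq_card/subsetP => y; rewrite !inE -andbA => /and3P[_ -> ->].
have walk u (X : {set V}) x : x \in F u -> #|X| + size u <= L.+1 -> x \notin X ->
    exists p, [/\ uniq (x :: p), {subset x :: p <= Z}, opath e u x p & forall y, y \in p -> y \notin X].
  elim: u X x => [|b u IH] X x.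
    move=> xF _ _; exists [::]; split=> // y; rewrite inE => /eqP->; exact: (subsetP (Fsub [::])).
  rewrite /= inE => /andP[xF deg] XL xX.
  have [y] : exists y, y \in nbh e b x (F u) :\: (x |: X).
    apply/set0Pn; rewrite -card_gt0; have := cardsID (x |: X) (nbh e b x (F u)).
    suff : #|nbh e b x (F u) :&: (x |: X)| <= #|X| by lia.
    apply/subset_leq_card/subsetP => y; rewrite !inE => /andP[/andP[_ xy]] /orP[/eqP yx|//].
    by move: xy; rewrite yx dir_irr.
  case/setDP; rewrite inE => /andP[yF xy] yX.
  have [|p [up pZ wp pX]] := IH (x |: X) y yF _ yX; first by rewrite cardsU1 xX; move: XL => /=; lia.
  exists (y :: p); split.
  - apply/andP; split; last exact: up.
    rewrite inE negb_or; apply/andP; split.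
      by move: yX; rewrite in_setU1 negb_or eq_sym => /andP[].
    by apply/negP => /pX; rewrite setU11.
  - move=> z; rewrite inE => /orP[/eqP->|/pZ//]; exact: (subsetP (Fsub u)).
  - by rewrite xy wp.
  move=> z; rewrite inE => /orP[/eqP->|/pX].
    by apply: contra yX; apply/subsetP; apply: subsetUr.
  by apply: contra; apply/subsetP; apply: subsetUr.
have [x xF] : exists x, x \in F w.
  by apply/set0Pn; rewrite -card_gt0; have := Fcard w; move: hZ; rewrite -/L; lia.
have [||p [? ? ? _]] := walk w set0 x xF; rewrite ?cards0 ?inE //.
by exists x, p.
Qed.
End Embedding.

(** * Copies with one or two vertices in a given set *)

Section Copies.
Variables (ell : nat) (c : rel 'I_ell) (V : finType) (e : rel V).
Hypothesis (ori : oriented e).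

(* More than [thr] vertices contain every oriented path on at most [ell]
   vertices, even after the deletion of [ell] of them. *)
Definition thr : nat := (ell * (ell.*2.+1 * alpha e) + ell)%N.

(** Copies are kept as duplicate-free lists, so that two of them can later be matched vertex by
    vertex. *)
Definition copy1 (X Y : {set V}) : Prop := exists a l,
  [/\ a \in X, {subset l <= Y}, uniq (a :: l) & is_copy c e [set z in a :: l]].

Definition copy2 (X Y : {set V}) : Prop := exists s t l,
  [/\ s \in X /\ t \in X, {subset l <= Y}, uniq [:: s, t & l] &
      is_copy c e [set z in [:: s, t & l]]].

Lemma path_avoiding (w : seq bool) (Z X : {set V}) : size w <= ell -> #|X| <= ell ->
  thr < #|Z| ->
  exists x p, [/\ uniq (x :: p), {subset x :: p <= Z}, {in x :: p, forall y, y \notin X} &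
                  opath e w x p].
Proof.
move=> wl Xl hZ; have [|x [p [up pZ wp]]] := @opath_embed _ _ ori w (Z :\: X).
  have := cardsID X Z; have : #|Z :&: X| <= #|X| by apply/subset_leq_card/subsetIr.
  have : size w * ((size w).*2.+1 * alpha e) <= ell * (ell.*2.+1 * alpha e).
    by rewrite leq_mul // leq_mul2r ltnS leq_double wl orbT.
  by move: hZ; rewrite /thr; lia.
by exists x, p; split=> // y /pZ /setDP[].
Qed.

Lemma card_set_seq (s : seq V) : #|[set z in s]| <= size s.
Proof. by rewrite cardsE; apply: card_size. Qed.

Lemma big_arc (Z : {set V}) : 0 < ell -> thr < #|Z| -> exists x y, [/\ x \in Z, y \in Z & e x y].
Proof.
move=> l0 hZ; apply: arc_in; apply: leq_ltn_trans hZ; rewrite /thr.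
by rewrite mulnA -[X in X <= _]mul1n; apply: leq_trans (leq_addr _ _); rewrite leq_mul2r muln_gt0 l0 orbT.
Qed.

Lemma big_not_in b x y (Y : {set V}) : y \in nbh e b x Y -> y != x.
Proof. by rewrite inE => /andP[_]; apply: contraTneq => ->; rewrite dir_irr. Qed.

(** The vertex [s] becomes a source ([b = true]) or a sink of the cycle, so the rest may be any path
    [u] inside one neighbourhood of [s]. *)
Lemma copy1_of_word b u (X Y : {set V}) s : spells c e (b :: u ++ [:: ~~ b]) ->
  s \in X -> thr < #|nbh e b s Y| -> copy1 X Y.
Proof.
move=> [szw S] sX hZ; have ul : size u <= ell by rewrite -szw /= size_cat; lia.
have [|x [p [up pZ _ wp]]] := @path_avoiding u _ set0 ul _ hZ; first by rewrite cards0.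
have us : uniq [:: s, x & p].
  by rewrite cons_uniq up andbT; apply/negP => /pZ /big_not_in; rewrite eqxx.
exists s, (x :: p); split=> //; first by move=> y /pZ; rewrite inE => /andP[].
apply: S => //=; have xZ := pZ _ (mem_head _ _); move: xZ; rewrite inE => /andP[_ ->].
rewrite -cats1 opath_cat ?(opath_size wp) // wp /= dirN andbT.
by have := pZ _ (mem_last x p); rewrite inE => /andP[].
Qed.

Section Disjoint.
Variables (X Y : {set V}).
Hypothesis (dXY : [disjoint X & Y]).

Lemma notin_disj x (l : seq V) : x \in X -> {subset l <= Y} -> x \notin l.
Proof. by move=> xX lY; apply/negP => /lY; apply/negP; rewrite (disjointFr dXY). Qed.

(** Here [s] and [t] are consecutive on the cycle. The path [u] is found anywhere in [Z]; only its
    two ends use the arcs to [s] and [t]. *)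
Lemma copy2_adjacent d d1 d2 u s t (Z : {set V}) : spells c e (d :: d2 :: u ++ [:: d1]) ->
  s \in X -> t \in X -> dir e d s t -> Z \subset Y ->
  (forall z, z \in Z -> dir e d1 z s && dir e d2 t z) -> thr < #|Z| -> copy2 X Y.
Proof.
move=> [szw S] sX tX st ZY HZ hZ; have ul : size u <= ell by rewrite -szw /= size_cat; lia.
have [|x [p [up pZ _ wp]]] := @path_avoiding u _ set0 ul _ hZ; first by rewrite cards0.
have pY : {subset x :: p <= Y} by move=> y /pZ; apply/subsetP.
have us : uniq [:: s, t, x & p].
  apply/andP; split; last by apply/andP; split; [exact: notin_disj|].
  rewrite in_cons negb_or notin_disj // andbT.
  by apply: contraTneq st => ->; rewrite dir_irr.
exists s, t, (x :: p); split=> //; apply: S => //=; rewrite st.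
have /andP[_ ->] := HZ _ (pZ _ (mem_head _ _)).
rewrite -cats1 opath_cat ?(opath_size wp) // wp /= andbT.
by have /andP[] := HZ _ (pZ _ (mem_last x p)).
Qed.

(** Here the two vertices of [X] are not consecutive and cut the cycle into two paths; one is given,
    the other is found in [Z] off the first. *)
Lemma copy2_split d0 d1 d2 d3 u v x y z q (Z : {set V}) :
  spells c e (d0 :: u ++ d1 :: d2 :: v ++ [:: d3]) ->
  x \in X -> y \in X -> x != y ->
  uniq (z :: q) -> {subset z :: q <= Y} -> opath e v z q ->
  dir e d2 y z -> dir e d3 (last z q) x ->
  Z \subset Y -> (forall z, z \in Z -> dir e d0 x z && dir e d1 z y) -> thr < #|Z| ->
  copy2 X Y.
Proof.
move=> [szw S] xX yX xy uq qY vq yz qx ZY HZ hZ.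
have szq := opath_size vq.
have szl : (size u + size v).+3.+1 = ell by rewrite -szw /= size_cat /= size_cat /=; lia.
have ul : size u <= ell by lia.
have [|x1 [p [up pZ pq wp]]] := @path_avoiding u Z [set w in z :: q] ul _ hZ.
  by apply: leq_trans (card_set_seq _) _; rewrite /=; lia.
have pY : {subset x1 :: p <= Y} by move=> w /pZ; apply/subsetP.
have pqY : {subset (x1 :: p) ++ z :: q <= Y} by move=> w; rewrite mem_cat => /orP[/pY|/qY].
have upq : uniq ((x1 :: p) ++ z :: q).
  rewrite cat_uniq up uq andbT; apply/hasPn => w wq; apply/negP => /pq.
  by rewrite inE wq.
have perm : perm_eq [:: x & (x1 :: p) ++ y :: z :: q] [:: x, y & (x1 :: p) ++ z :: q].
  by rewrite perm_cons; apply/permEl/(perm_catCA (x1 :: p) [:: y]).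
have us : uniq [:: x, y & (x1 :: p) ++ z :: q].
  apply/andP; split; last by apply/andP; split; [exact: notin_disj|].
  by rewrite in_cons negb_or xy notin_disj.
exists x, y, ((x1 :: p) ++ z :: q); split=> //.
have -> : [set z0 in [:: x, y & (x1 :: p) ++ z :: q]] = [set z0 in [:: x & (x1 :: p) ++ y :: z :: q]].
  by apply/setP => w; rewrite !in_set (perm_mem perm).
apply: S; first by rewrite (perm_uniq perm).
rewrite rcons_cat /= opath_cat ?(opath_size wp) //.
have /andP[-> _] := HZ _ (pZ _ (mem_head _ _)).
have /andP[_ py] := HZ _ (pZ _ (mem_last x1 p)).
by rewrite /= wp py yz /= -cats1 opath_cat ?(opath_size vq) // vq /= qx.
Qed.

(* Two vertices of [X], each joined in the same way to all of [Z]. *)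
Lemma copy2_common d1 d2 u v x y (Z : {set V}) :
  spells c e (d1 :: u ++ ~~ d2 :: d2 :: v ++ [:: ~~ d1]) ->
  x \in X -> y \in X -> x != y -> Z \subset nbh e d1 x Y :&: nbh e d2 y Y -> thr + ell < #|Z| ->
  copy2 X Y.
Proof.
move=> Sw xX yX xy ZY hZ; have szw := proj1 Sw.
have szl : (size u + size v).+3.+1 = ell by rewrite -szw /= size_cat /= size_cat /=; lia.
have Zi z : z \in Z -> [/\ z \in Y, dir e d1 x z & dir e d2 y z].
  by move=> /(subsetP ZY); rewrite !inE => /andP[/andP[-> ->] /andP[_ ->]].
have ZY' : Z \subset Y by apply/subsetP => z /Zi[].
have [| | |z [q [uq qZ _ vq]]] := @path_avoiding v Z set0; rewrite ?cards0 //; try lia.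
have szq := opath_size vq.
apply: (@copy2_split d1 (~~ d2) d2 (~~ d1) u v x y z q (Z :\: [set w in z :: q])) => //.
- by move=> w /qZ; apply/subsetP.
- by have [] := Zi _ (qZ _ (mem_head _ _)).
- by rewrite dirN; have [] := Zi _ (qZ _ (mem_last _ _)).
- by apply: subset_trans ZY'; apply: subsetDl.
- by move=> w /setDP[/Zi[_ h1 h2] _]; rewrite h1 dirN.
rewrite cardsD; suff : #|Z :&: [set w in z :: q]| <= ell by lia.
apply: leq_trans (subset_leq_card (subsetIr _ _)) _.
by apply: leq_trans (card_set_seq _) _; rewrite /=; lia.
Qed.

(** The two vertices of [X] are consecutive but not prescribed. The path [u] ends in a vertex of
    [Z], which together with [z0] sees more than [thr] vertices of [X] in the right directions; any
    arc among these closes the cycle. *)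
Lemma copy2_center d0 d1 d d2 u z0 : 0 < ell -> spells c e (d0 :: u ++ [:: d1; d; d2]) ->
  z0 \in Y ->
  thr < #|[set z in nbh e d0 z0 Y | thr < #|[set s in X | dir e d1 z s && dir e d2 s z0]| ]| ->
  copy2 X Y.
Proof.
move=> l0 [szw S] z0Y; set Z := [set z in nbh _ _ _ _ | _] => hZ.
have ul : size u <= ell by rewrite -szw /= size_cat; lia.
have Zi z : z \in Z -> [/\ z \in Y, dir e d0 z0 z & z != z0].
  move=> zZ; have zn : z \in nbh e d0 z0 Y by move: zZ; rewrite inE => /andP[].
  by split; [move: zn; rewrite inE => /andP[] | move: zn; rewrite inE => /andP[] | exact: big_not_in zn].
have [|x [p [up pZ _ wp]]] := @path_avoiding u _ set0 ul _ hZ; first by rewrite cards0.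
have pY : {subset x :: p <= Y} by move=> y /pZ /Zi[].
have /setIdP[_ /(big_arc l0)[a [b [aS bS ab]]]] : last x p \in Z by apply/pZ/mem_last.
(* The letter [d] decides which end of the arc found is visited first. *)
pose t := if d then a else b; pose s := if d then b else a.
have [tS sS ts] : [/\ t \in [set s in X | dir e d1 (last x p) s && dir e d2 s z0],
     s \in [set s in X | dir e d1 (last x p) s && dir e d2 s z0] & dir e d t s].
  by rewrite /t /s; case: (d); split.
move: tS sS; rewrite !in_set => /and3P[tX lt _] /and3P[sX _ sz].
have us : uniq [:: s, t, z0, x & p].
  have u1 : {subset [:: z0, x & p] <= Y} by move=> y; rewrite in_cons => /orP[/eqP->|/pY].
  apply/and3P; split.
  - rewrite in_cons negb_or notin_disj // andbT eq_sym.
    by apply: contraTneq ts => ->; rewrite dir_irr.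
  - exact: notin_disj.
  by apply/andP; split=> //; apply/negP => /pZ /Zi[_ _]; rewrite eqxx.
exists s, t, [:: z0, x & p]; split=> //.
  by move=> y; rewrite in_cons => /orP[/eqP->|/pY].
have perm : perm_eq (z0 :: (x :: p) ++ [:: t; s]) [:: s, t, z0, x & p].
  apply: perm_trans (permEl (perm_catC (z0 :: x :: p) [:: t; s])) _.
  by apply/permEl/(perm_catCA [:: t] [:: s]).
have -> : [set z in [:: s, t, z0, x & p]] = [set z in z0 :: (x :: p) ++ [:: t; s]].
  by apply/setP => w; rewrite !in_set (perm_mem perm).
apply: S; first by rewrite (perm_uniq perm).
rewrite rcons_cat /= opath_cat ?(opath_size wp) // wp /= lt ts sz !andbT.
by have [] := Zi _ (pZ _ (mem_head _ _)).
Qed.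
End Disjoint.
End Copies.

(** * Triangles across two sets *)

Lemma card_set_sum (V : finType) (A : {set V}) (P : pred V) :
  #|[set s in A | P s]| = \sum_(s in A) P s.
Proof.
rewrite -sum1_card [LHS]big_mkcond [RHS]big_mkcond; apply: eq_bigr => s _.
by rewrite inE; case: (s \in A); case: (P s).
Qed.

Definition triangles (V : finType) (r1 r2 r3 : rel V) (A B : {set V}) : nat :=
  \sum_(w in B) \sum_(z in B) \sum_(s in A) (r1 w z && r2 z s && r3 s w).

Lemma nseq_rcons (T : Type) n (x : T) : nseq n x ++ [:: x] = x :: nseq n x.
Proof. by elim: n => //= n ->. Qed.

Lemma nseq_cons_cat (T : Type) n (x : T) s : nseq n x ++ x :: s = x :: nseq n x ++ s.
Proof. by elim: n => //= n ->. Qed.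

Section OneSource.
Variables (ell : nat) (c : rel 'I_ell) (V : finType) (e : rel V).
Hypothesis (ori : oriented e).
Variables (a b : nat).
Hypothesis (ba : 0 < b <= a) (ab : a + b = ell) (l4 : 4 <= ell).
Hypothesis (S : spells c e (nseq a true ++ nseq b false)).
Variables (X Y : {set V}).
Hypothesis (dXY : [disjoint X & Y]).

Lemma spells_swap : spells c e (nseq b true ++ nseq a false).
Proof.
have revn n (x : bool) : rev (nseq n x) = nseq n x.
  by elim: n => //= n IH; rewrite rev_cons IH -cats1 nseq_rcons.
by have := spells_flip S; rewrite map_cat !map_nseq rev_cat !revn.
Qed.

(** A common neighbour has one of four types, by the directions of its arcs to [s] and [t], and one
    type occurs more than [thr + ell] times. If both arcs point to it, [s] can be the source; if
    both leave it, [t] can be the sink. For the mixed types and [b > 1] the two vertices become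
    source and sink, which are not consecutive as both runs have length at least 2; for [b = 1] they
    can be placed consecutively. *)
Lemma common_nbh_copy2 s t : s \in X -> t \in X -> adj e s t ->
  4 * (thr ell e + ell) < #|[set z in Y | adj e s z && adj e t z]| -> copy2 c e X Y.
Proof.
wlog st : s t / e s t => [H sX tX st hZ|sX tX _].
  case/orP: (st) => st'; first exact: (H s t).
  apply: (H t s) => //; first by rewrite /adj orbC.
  by apply: leq_trans hZ _; apply/subset_leq_card/subsetP => z; rewrite !inE [adj e s z && _]andbC.
set Z := [set z in Y | _] => hZ.
have cov : Z \subset [set z in nbh e true s Y :&: nbh e true t Y] :|: [set z in nbh e true s Y :&: nbh e false t Y]
   :|: ([set z in nbh e false s Y :&: nbh e true t Y] :|: [set z in nbh e false s Y :&: nbh e false t Y]).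
  apply/subsetP => z; rewrite !inE /adj /dir => /and3P[-> /orP[-> | ->] /orP[->|->]]; rewrite ?orbT //.
have := subset_leq_card cov; rewrite !cardsU.
set N1 := [set z in _ :&: _]; set N2 := [set z in _ :&: _]; set N3 := [set z in _ :&: _]; set N4 := [set z in _ :&: _] => hc.
have sub b1 b2 z : z \in [set z in nbh e b1 s Y :&: nbh e b2 t Y] ->
    [/\ z \in Y, dir e b1 s z & dir e b2 t z].
  by rewrite !inE => /andP[/andP[-> ->] /andP[_ ->]].
have {hc} : [|| thr ell e + ell < #|N1|, thr ell e + ell < #|N2|, thr ell e + ell < #|N3| | thr ell e + ell < #|N4|].
  by move: hZ hc; lia.
have Ysub b1 b2 : [set z in nbh e b1 s Y :&: nbh e b2 t Y] \subset Y.
  by apply/subsetP => z /sub[].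
have [a' aE] : exists a', a = a'.+2 by exists (a - 2); lia.
have [b' bE] : exists b', b = b'.+1 by exists (b - 1); lia.
case/or4P => hN.
- apply: (@copy2_adjacent _ _ _ _ ori _ _ dXY true false true (nseq a' true ++ nseq b' false) s t N1); rewrite ?Ysub //.
  + by move: S; rewrite aE bE /= -!catA nseq_rcons.
  + by move=> z /sub[_ h1 h2]; rewrite h2 andbT.
  + by lia.
- have [b1|b2] := leqP b 1.
    apply: (@copy2_adjacent _ _ _ _ ori _ _ dXY true false false (nseq a' false) s t N2); rewrite ?Ysub //.
    + have b1e : b = 1 by lia.
      by have := spells_swap; rewrite aE b1e /= nseq_rcons.
    + by move=> z /sub[_ h1 h2]; rewrite h2 andbT.
    + by lia.
  have [b'' bE'] : exists b'', b = b''.+2 by exists (b - 2); lia.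
  apply: (@copy2_common _ _ _ _ ori _ _ dXY true false (nseq a' true) (nseq b'' false) s t N2); rewrite ?Ysub //.
  + by move: S; rewrite aE bE' /= nseq_rcons nseq_cons_cat.
  + by apply: contraTneq st => ->; case: ori => irr _; rewrite irr.
  + by apply/subsetP => z; rewrite inE.
- have [b1|b2] := leqP b 1.
    have [a'' aE'] : exists a'', a = a''.+3 by exists (a - 3); lia.
    apply: (@copy2_adjacent _ _ _ _ ori _ _ dXY true true true (nseq a'' true ++ [:: false]) s t N3); rewrite ?Ysub //.
    + have -> : [:: true, true & (nseq a'' true ++ [:: false]) ++ [:: true]] =
               (nseq a''.+2 true ++ [:: false]) ++ [:: true] by [].
      have b1e : b = 1 by lia.
      by apply: spells_rot; move: S; rewrite aE' b1e.
    + by move=> z /sub[_ h1 h2]; rewrite h2 andbT.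
    + by lia.
  have [b'' bE'] : exists b'', b = b''.+2 by exists (b - 2); lia.
  apply: (@copy2_common _ _ _ _ ori _ _ dXY true false (nseq a' true) (nseq b'' false) t s N3); rewrite ?Ysub //.
  + by move: S; rewrite aE bE' /= nseq_rcons nseq_cons_cat.
  + by apply: contraTneq st => ->; case: ori => irr _; rewrite irr.
  + by apply/subsetP => z; rewrite inE setIC.
apply: (@copy2_adjacent _ _ _ _ ori _ _ dXY true true false (nseq b' false ++ nseq a' true) s t N4); rewrite ?Ysub //.
+ have -> : [:: true, false & (nseq b' false ++ nseq a' true) ++ [:: true]] =
           (true :: nseq b'.+1 false) ++ nseq a'.+1 true by rewrite /= -catA nseq_rcons.
  by apply: spells_rot; move: S; rewrite aE bE nseq_cons_cat.
+ by move=> z /sub[_ h1 h2]; rewrite h2 andbT.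
by lia.
Qed.

Hypothesis no_copy2 : ~ copy2 c e X Y.

(** For fixed [w], [copy2_center] leaves at most [thr] vertices [z] with more than [thr] completions
    in [X]. Those are counted trivially, the others by [thr] each. The letter [d] of the arc inside
    [X] does not occur in the triangle; this freedom helps to find the pattern in the cyclic
    word. *)
Lemma triangles_center d0 d1 d d2 u : spells c e (d0 :: u ++ [:: d1; d; d2]) ->
  triangles (dir e d0) (dir e d1) (dir e d2) X Y <= 2 * thr ell e * (#|V| * #|V|).
Proof.
move=> Sw.
have YV : #|Y| <= #|V| by apply: max_card.
have XV : #|X| <= #|V| by apply: max_card.
suff H w : w \in Y -> \sum_(z in Y) \sum_(s in X) (dir e d0 w z && dir e d1 z s && dir e d2 s w)
      <= 2 * thr ell e * #|V|.
  rewrite /triangles; apply: leq_trans (leq_sum _ H) _; rewrite sum_nat_const mulnC -mulnA.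
  by rewrite leq_mul2l leq_mul2l YV !orbT.
move=> wY; set Z := [set z in nbh e d0 w Y | thr ell e < #|[set s in X | dir e d1 z s && dir e d2 s w]| ].
have Zs : #|Z| <= thr ell e.
  rewrite leqNgt; apply/negP => h; apply: no_copy2.
  by apply: (copy2_center ori dXY _ Sw wY h); lia.
rewrite (bigID (mem Z)) /= mulnC mulnA [in leqRHS]muln2 -addnn [in leqRHS]mulnDl.
apply: leq_add.
  apply: (@leq_trans (\sum_(z in Z) #|V|)); last first.
    by rewrite sum_nat_const [leqRHS]mulnC leq_mul2r Zs orbT.
  rewrite [leqRHS](eq_bigl (fun z => (z \in Y) && (z \in Z))); last first.
    move=> z; case: (boolP (z \in Z)); last by rewrite andbF.
    by rewrite !inE => /andP[/andP[->]].
  apply: leq_sum => z _; rewrite -card_set_sum; exact: max_card.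
apply: (@leq_trans (\sum_(z in Y | z \notin Z) thr ell e)).
  apply: leq_sum => z /andP[zY]; rewrite inE [z \in nbh _ _ _ _]inE zY /=.
  case: (dir e d0 w z) => /=; last by move=> _; rewrite big1.
  by rewrite -leqNgt card_set_sum.
rewrite sum_nat_cond_const mulnC mulnC leq_mul2r; apply/orP; right.
exact: max_card.
Qed.

Lemma triangles_source :
  triangles (dir e true) (dir e false) (dir e true) X Y <= 2 * thr ell e * (#|V| * #|V|).
Proof.
have [b' bE] : exists b', b = b'.+1 by exists (b - 1); lia.
(* For [a <= 2], the bounds [b <= a] and [4 <= ell] leave only two letters of each kind. *)
have [a2|a3] := leqP a 2.
  apply: (@triangles_center true false false true [::]).
  apply: (@spells_rot _ _ _ _ [:: true] [:: true; false; false]).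
  have [a2e b2e] : a = 2 /\ b = 2 by lia.
  move: S; rewrite a2e b2e => S1; exact: S1.
have [a'' aE] : exists a'', a = a''.+3 by exists (a - 3); lia.
apply: (@triangles_center true false true true (nseq a'' true ++ nseq b' false)).
have -> : true :: (nseq a'' true ++ nseq b' false) ++ [:: false; true; true] =
   (nseq a''.+1 true ++ nseq b'.+1 false) ++ [:: true; true].
  by rewrite /= -!catA nseq_cons_cat.
by apply: spells_rot; move: S; rewrite aE bE.
Qed.

Lemma triangles_sink :
  triangles (dir e false) (dir e true) (dir e false) X Y <= 2 * thr ell e * (#|V| * #|V|).
Proof.
have [b' bE] : exists b', b = b'.+1 by exists (b - 1); lia.
have [a2|a3] := leqP a 2.
  apply: (@triangles_center false true true false [::]).
  apply: (@spells_rot _ _ _ _ [:: true; true; false] [:: false]).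
  have [a2e b2e] : a = 2 /\ b = 2 by lia.
  move: S; rewrite a2e b2e => S1; exact: S1.
have [a'' aE] : exists a'', a = a''.+3 by exists (a - 3); lia.
apply: (@triangles_center false true false false (nseq a'' false ++ nseq b' true)).
have -> : false :: (nseq a'' false ++ nseq b' true) ++ [:: true; false; false] =
   nseq a''.+1 false ++ (nseq b'.+1 true ++ [:: false; false]).
  by rewrite /= -!catA nseq_cons_cat.
by apply: spells_rot; move: spells_swap; rewrite aE bE -catA.
Qed.

Lemma triangles_middle : b = 1 ->
  triangles (dir e true) (dir e false) (dir e false) X Y <= 2 * thr ell e * (#|V| * #|V|).
Proof.
move=> b1; have [a'' aE] : exists a'', a = a''.+3 by exists (a - 3); lia.
apply: (@triangles_center true false false false (nseq a'' false)).
by move: spells_swap; rewrite aE b1 /= !nseq_cons_cat cats0.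
Qed.

Lemma triangles_cyclic : b = 1 ->
  triangles (dir e true) (dir e true) (dir e true) X Y <= 2 * thr ell e * (#|V| * #|V|).
Proof.
move=> b1; have [a3|a4] := leqP a 3.
  apply: (@triangles_center true true false true [::]).
  apply: (@spells_rot _ _ _ _ [:: true] [:: true; true; false]).
  have a3e : a = 3 by lia.
  by move: S; rewrite a3e b1; apply.
have [a' aE] : exists a', a = a'.+4 by exists (a - 4); lia.
apply: (@triangles_center true true true true (false :: nseq a' true)).
have -> : true :: (false :: nseq a' true) ++ [:: true; true; true] =
   [:: true; false] ++ nseq a'.+3 true.
  by rewrite /= !nseq_cons_cat cats0.
by apply: spells_rot; move: S; rewrite aE b1 nseq_cons_cat.
Qed.

(** The source is [w], with [x] and [y] next to it on either side. As both runs have length at least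
    2, the arcs at [x] and [y] leading away from [w] are both outgoing, so the rest of the cycle may
    lie in their common out-neighbourhood. *)
Lemma through_paths w x y : 1 < b -> w \in Y -> x \in X -> y \in X -> x != y ->
  e w x -> e w y -> #|nbh e true x Y :&: nbh e true y Y| <= thr ell e.
Proof.
move=> b2 wY xX yX xy wx wy; rewrite leqNgt; apply/negP => h; apply: no_copy2.
have [a' aE] : exists a', a = a'.+2 by exists (a - 2); lia.
have [b' bE] : exists b', b = b'.+2 by exists (b - 2); lia.
apply: (@copy2_split _ _ _ _ ori _ _ dXY true false false true (nseq a' true ++ nseq b' false) [::]
   x y w [::] (nbh e true x Y :&: nbh e true y Y)) => //.
- have -> : true :: (nseq a' true ++ nseq b' false) ++ false :: false :: [::] ++ [:: true] =
     (nseq a'.+1 true ++ nseq b'.+2 false) ++ [:: true].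
    by rewrite /= -!catA !nseq_cons_cat /=.
  by apply: spells_rot; move: S; rewrite aE bE.
- by move=> z; rewrite inE => /eqP->.
- by apply/subsetP => z; rewrite !inE => /andP[/andP[]].
by move=> z; rewrite !inE => /andP[/andP[_ h1] /andP[_ h2]]; apply/andP.
Qed.
End OneSource.

(** Interchanging [w] and [z] traverses the triangle in the opposite sense. *)
Lemma triangles_flip (V : finType) (e : rel V) d0 d1 d2 (A B : {set V}) :
  triangles (dir e (~~ d0)) (dir e (~~ d2)) (dir e (~~ d1)) A B =
  triangles (dir e d0) (dir e d1) (dir e d2) A B.
Proof.
rewrite /triangles exchange_big; apply: eq_bigr => w _; apply: eq_bigr => z _.
by apply: eq_bigr => s _; rewrite !dirN -andbA [dir e d2 _ _ && _]andbC andbA.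
Qed.

(** The eight orientations of a triangle are the four listed ones and their images under
    [triangles_flip]. *)
Lemma triangles_adj (V : finType) (e : rel V) (A B : {set V}) :
  triangles (adj e) (adj e) (adj e) A B <=
  2 * (triangles (dir e true) (dir e false) (dir e true) A B +
       triangles (dir e false) (dir e true) (dir e false) A B +
       triangles (dir e true) (dir e false) (dir e false) A B +
       triangles (dir e true) (dir e true) (dir e true) A B).
Proof.
have -> : forall t1 t2 t3 t4, 2 * (t1 + t2 + t3 + t4) =
   t1 + t2 + (t3 + t4) + (t1 + t2 + (t3 + t4)) by move=> *; lia.
rewrite -{2}(triangles_flip _ true false true) -{2}(triangles_flip _ false true false).
rewrite -{2}(triangles_flip _ true false false) -{2}(triangles_flip _ true true true) /=.
rewrite /triangles -!big_split; apply: leq_sum => w _ /=.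
rewrite -!big_split; apply: leq_sum => z _ /=.
rewrite -!big_split; apply: leq_sum => s _ /=; rewrite /adj.
by case: (e w z); case: (e z w); case: (e z s); case: (e s z); case: (e s w); case: (e w s).
Qed.

(** * Degrees inside and across the two parts *)

Section Degrees.
Variables (V : finType) (e : rel V).
Hypothesis (ori : oriented e).

Definition nbrs (x : V) : {set V} := [set y | adj e x y].
Definition adjdeg (x : V) (Y : {set V}) : nat := #|nbrs x :&: Y|.
Definition codeg (x : V) (Y : {set V}) : nat := #|Y :\: nbrs x|.

(* The degree that attains [deg_star e x], counted inside [Y]. *)
Definition star_in (x : V) (Y : {set V}) : nat :=
  if x \in Pplus e then outdeg_in e x Y else indeg_in e x Y.

Lemma adj_sym x y : adj e x y = adj e y x. Proof. exact: orbC. Qed.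

Lemma adjdeg_codeg x Y : adjdeg x Y + codeg x Y = #|Y|.
Proof. by rewrite /adjdeg setIC cardsID. Qed.

Lemma deg_star_in x : deg_star e x = star_in x setT.
Proof.
rewrite /deg_star /star_in inE /outdeg /indeg; by case: leqP.
Qed.

Lemma star_in_le x Y : star_in x Y <= adjdeg x Y.
Proof.
rewrite /star_in /adjdeg; case: ifP => _; apply/subset_leq_card/subsetP => y;
by rewrite !inE /adj => /andP[-> ->]; rewrite ?orbT.
Qed.

Lemma star_in_setU x Y Z : star_in x (Y :|: Z) <= star_in x Y + star_in x Z.
Proof.
rewrite /star_in; case: ifP => _; (apply: leq_trans (leq_card_setU _ _));
by apply/subset_leq_card/subsetP => y; rewrite !inE => /andP[/orP[->|->] ->]; rewrite ?orbT.
Qed.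

Lemma deg_star_split x A B : deg_star e x <= star_in x A + adjdeg x B + #|~: (A :|: B)|.
Proof.
rewrite deg_star_in -(setUCr (A :|: B)).
apply: leq_trans (star_in_setU _ _ _) _; apply: leq_add.
  apply: leq_trans (star_in_setU _ _ _) _; rewrite leq_add2l; exact: star_in_le.
apply: leq_trans (star_in_le _ _) _; apply/subset_leq_card; exact: subsetIr.
Qed.

Lemma adjdeg_sum x Y : adjdeg x Y = \sum_(y in Y) adj e x y.
Proof. by rewrite -card_set_sum; apply: eq_card => y; rewrite !inE andbC. Qed.

Lemma codeg_sum x Y : codeg x Y = \sum_(y in Y) ~~ adj e x y.
Proof. by rewrite -card_set_sum; apply: eq_card => y; rewrite !inE andbC. Qed.

(* A pair of vertices of [A] contributes at most 1 to the sum, or 2 if the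
   vertices are of different types. *)
Lemma internal_bound (A : {set V}) :
  4 * (\sum_(s in A) star_in s A) + 2 * (\sum_(s in A) codeg s A) <= 3 * #|A| ^ 2.
Proof.
pose O x : bool := x \in Pplus e.
pose d x y : bool := if O x then e x y else e y x.
have sE s : star_in s A = \sum_(t in A) d s t.
  by rewrite /star_in /d -/(O s); case: ifP => _; rewrite -card_set_sum.
have asym x y : e x y -> e y x = false by case: ori => _ h /h /negbTE.
have pt x y : d x y + d y x + ~~ adj e x y <= 1 + (O x && ~~ O y) + (~~ O x && O y).
  rewrite /d /adj; case: (O x); case: (O y);
  by case: (boolP (e x y)) => [/asym->|_] //; case: (e y x).
set n1 := #|[set x in A | O x]|; set n2 := #|[set x in A | ~~ O x]|.
have n12 : n1 + n2 = #|A|.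
  rewrite /n1 /n2 !card_set_sum -big_split /= -sum1_card.
  by apply: eq_bigr => x _; case: (O x).
have tot : 2 * (\sum_(s in A) star_in s A) + \sum_(s in A) codeg s A <= #|A| * #|A| + 2 * (n1 * n2).
  have -> : 2 * (\sum_(s in A) star_in s A) + \sum_(s in A) codeg s A =
    \sum_(s in A) \sum_(t in A) (d s t + d t s + ~~ adj e s t).
    rewrite mul2n -addnn (eq_bigr _ (fun s _ => sE s)).
    rewrite {2}exchange_big -!big_split; apply: eq_bigr => s _ /=.
    by rewrite codeg_sum -!big_split.
  have -> : #|A| * #|A| + 2 * (n1 * n2) =
    \sum_(x in A) \sum_(y in A) (1 + (O x && ~~ O y) + (~~ O x && O y)).
    rewrite mul2n -addnn addnA.
    under eq_bigr => x _ do rewrite !big_split /= sum1_card.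
    rewrite !big_split /= sum_nat_const; congr (_ + _ + _).
      rewrite /n1 /n2 !card_set_sum big_distrl; apply: eq_bigr => x _ /=.
      by rewrite big_distrr; apply: eq_bigr => y _ /=; rewrite mulnb.
    rewrite mulnC /n1 /n2 !card_set_sum big_distrl; apply: eq_bigr => x _ /=.
    by rewrite big_distrr; apply: eq_bigr => y _ /=; rewrite mulnb.
  by apply: leq_sum => x _; apply: leq_sum => y _.
have sq : 4 * (n1 * n2) <= #|A| * #|A|.
  rewrite -n12; have [h|h] := leqP n1 n2.
    by rewrite -(subnKC h); nia.
  by rewrite -(subnKC (ltnW h)); nia.
rewrite expnS expn1; lia.
Qed.

(* Pair off adjacent vertices of [U] until an independent set is left. *)
Lemma matching_bound (U T : {set V}) K :
  (forall s t, s \in U -> t \in U -> adj e s t -> #|nbrs s :&: nbrs t :&: T| <= K) ->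
  2 * (\sum_(s in U) adjdeg s T) <= #|U| * (#|T| + K) + 2 * (alpha e * #|T|).
Proof.
have [n] := ubnP #|U|; elim: n U => // n IH U Un HK.
have [Ua|Ua] := leqP #|U| (alpha e).
  apply: leq_trans (leq_addl _ _); rewrite leq_mul2l /=.
  apply: (@leq_trans (\sum_(s in U) #|T|)).
    by apply: leq_sum => s _; apply/subset_leq_card/subsetIr.
  by rewrite sum_nat_const leq_mul2r Ua orbT.
have [s [t [sU tU st]]] := arc_in Ua.
have nst : t != s by apply: contraTneq st => ->; case: ori => irr _; rewrite irr.
have tU' : t \in U :\ s by rewrite !inE nst.
rewrite (big_setD1 s) //= (big_setD1 t) //=.
have cU : #|U| = (#|U :\ s :\ t|).+2 by rewrite (cardsD1 s) sU (cardsD1 t) tU'.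
have pair : adjdeg s T + adjdeg t T <= #|T| + K.
  have := HK _ _ sU tU; rewrite /adj st => /(_ isT) h.
  have -> : adjdeg s T + adjdeg t T = #|(nbrs s :&: T) :|: (nbrs t :&: T)| + #|nbrs s :&: nbrs t :&: T|.
    rewrite cardsU (_ : (nbrs s :&: T) :&: (nbrs t :&: T) = nbrs s :&: nbrs t :&: T).
      have : #|nbrs s :&: nbrs t :&: T| <= adjdeg s T.
        by apply/subset_leq_card/subsetP => y; rewrite !inE => /andP[/andP[-> _] ->].
      by rewrite /adjdeg; lia.
    by rewrite setIACA setIid.
  apply: leq_add h; apply/subset_leq_card; by rewrite subUset !subsetIr.
have IHU : 2 * (\sum_(x in U :\ s :\ t) adjdeg x T) <=
    #|U :\ s :\ t| * (#|T| + K) + 2 * (alpha e * #|T|).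
  apply: IH; first by move: Un; rewrite cU; lia.
  by move=> x y /setD1P[_ /setD1P[_ xU]] /setD1P[_ /setD1P[_ yU]]; apply: HK.
rewrite cU 2!mulnDr; move: IHU pair; move: (#|U :\ s :\ t|) (\sum_(x in _) _) (_ * #|T|)%N.
by move=> m S al; rewrite -[m.+2]addn2 mulnDl; lia.
Qed.
End Degrees.

Local Open Scope ring_scope.

(** * Averaging *)

Section Pigeonhole.
Variables (R : realFieldType) (V : finType).
Local Notation n := (#|V|%:R : R).

Lemma card_le_n (A : {set V}) : #|A|%:R <= n.
Proof. by rewrite ler_nat max_card. Qed.

(* [t <= th + t ^ 2 / (4 th)]. *)
Lemma sum_le_squares (A : {set V}) (a : V -> nat) (th : R) : 0 < th ->
  (\sum_(i in A) a i)%:R <= th * #|A|%:R + (\sum_(i in A) a i ^ 2)%:R / (4 * th).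
Proof.
move=> th0; have -> : th * #|A|%:R = \sum_(i in A) th by rewrite sumr_const mulr_natr.
rewrite !natr_sum mulr_suml -big_split /=.
apply: ler_sum => i _; rewrite natrX.
set t : R := (a i)%:R; rewrite -subr_ge0.
have -> : th + t ^+ 2 / (4 * th) - t = (2 * th - t) ^+ 2 / (4 * th).
  by field; rewrite gt_eqF.
by rewrite divr_ge0 ?sqr_ge0 // mulr_ge0 // ltW.
Qed.

Lemma sum_le_squares_eps (A : {set V}) (a : V -> nat) (eps : R) : 0 < eps ->
  (\sum_(i in A) a i ^ 2)%:R <= eps ^+ 2 * n ^+ 3 -> (\sum_(i in A) a i)%:R <= 2 * eps * n ^+ 2.
Proof.
move=> e0 h; have [V0|V0] := posnP #|V|.
  rewrite big1 ?V0 ?expr0n /= ?mulr0 // => i _.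
  by have := fintype0 i V0.
have n0 : 0 < n by rewrite ltr0n.
apply: (le_trans (sum_le_squares A a (mulr_gt0 e0 n0))).
have h1 : eps * n * #|A|%:R <= eps * n ^+ 2.
  by rewrite expr2 mulrA ler_wpM2l ?card_le_n // mulr_ge0 ?ler0n // ltW.
have h2 : (\sum_(i in A) a i ^ 2)%:R / (4 * (eps * n)) <= eps * n ^+ 2.
  rewrite ler_pdivrMr; last by rewrite !mulr_gt0.
  apply: le_trans h _; rewrite -subr_ge0.
  have -> : eps * n ^+ 2 * (4 * (eps * n)) - eps ^+ 2 * n ^+ 3 = 3 * (eps ^+ 2 * n ^+ 3) by ring.
  by rewrite !mulr_ge0 // ?exprn_ge0 // ltW.
by lra.
Qed.

Lemma sum_card_sym (S Y : {set V}) (N : V -> {set V}) :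
  (\sum_(x in S) #|N x :&: Y| = \sum_(y in Y) #|[set x in S | y \in N x]|)%N.
Proof.
rewrite (eq_bigr (fun x => \sum_(y in Y) (y \in N x))%N); last first.
  by move=> x _; rewrite -card_set_sum; congr #|pred_of_set _|; apply/setP => y; rewrite !inE andbC.
by rewrite exchange_big; apply: eq_bigr => y _; rewrite card_set_sum.
Qed.

(** Second moment: the squared degrees of the vertices of [Y] into [S] count pairs in [S] with a
    common neighbour. A pair of distinct vertices contributes at most [K], a diagonal pair at most
    the order. *)
Lemma pigeonhole (S Y : {set V}) (N : V -> {set V}) K (eps : R) : 0 < eps ->
  (forall x y, x \in S -> y \in S -> x != y -> #|N x :&: N y :&: Y| <= K)%N ->
  (K + 1)%:R <= eps ^+ 2 * n -> (\sum_(x in S) #|N x :&: Y|)%:R <= 2 * eps * n ^+ 2.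
Proof.
move=> e0 HK hK; rewrite sum_card_sym.
apply: sum_le_squares_eps => //.
have sq : (\sum_(y in Y) #|[set x in S | y \in N x]| ^ 2 <= #|V| * #|V| * (K + 1))%N.
  rewrite (eq_bigr (fun y => \sum_(x in S) \sum_(x' in S) ((y \in N x) && (y \in N x')))%N); last first.
    move=> y _; rewrite card_set_sum expnS expn1 big_distrl; apply: eq_bigr => x _ /=.
    rewrite big_distrr; apply: eq_bigr => x1 _ /=; by rewrite mulnb.
  rewrite exchange_big /=.
  apply: (@leq_trans (\sum_(x in S) #|V| * (K + 1)))%N; last first.
    by rewrite sum_nat_const mulnA !leq_mul2r max_card !orbT.
  apply: leq_sum => x xS; rewrite exchange_big /= (bigD1 x) //= mulnDr addnC muln1.
  apply: leq_add.
    apply: (@leq_trans (\sum_(x' in S | x' != x) K)%N).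
      apply: leq_sum => x' /andP[x'S xx']; apply: leq_trans (HK x x' xS x'S _).
        rewrite -card_set_sum; apply/subset_leq_card/subsetP => y.
        by rewrite !inE => /and3P[-> -> ->].
      by rewrite eq_sym.
    rewrite sum_nat_cond_const leq_mul2r; apply/orP; right; exact: max_card.
  by rewrite -card_set_sum max_card.
apply: (@le_trans _ _ (#|V| * #|V| * (K + 1))%:R); first by rewrite ler_nat.
rewrite !natrM exprS mulrA [_ * _ * n ^+ 2]mulrC ler_wpM2l //.
by rewrite mulr_ge0.
Qed.
End Pigeonhole.

(** * Sparse cross edges for several sources and for the transitive triangle *)

Section Sparse.
Variables (R : realFieldType) (ell : nat) (c : rel 'I_ell) (V : finType) (e : rel V).
Hypotheses (cyc : cycle_orientation c) (ndir : ~ directed_cycle c) (ori : oriented e).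
Local Notation n := (#|V|%:R : R).

(* One source and one sink; [4 <= ell] excludes the transitive triangle. *)
Definition one_source : Prop := exists a b,
  [/\ (0 < b <= a)%N, (a + b = ell)%N, (4 <= ell)%N & spells c e (nseq a true ++ nseq b false)].

Lemma word_source_dir b : exists2 u, size u = ell.-2 & spells c e (b :: u ++ [:: ~~ b]).
Proof.
case: b; first exact: word_source.
have [u szu /spells_conv] := @word_source _ _ _ (conv e) (cycle_orientation_conv cyc)
  (fun h => ndir (directed_cycle_conv h)).
by rewrite /= map_cat => Su; exists (map negb u); rewrite ?size_map.
Qed.

Lemma copy1_of_nbh b (X Y : {set V}) s : s \in X -> (thr ell e < #|nbh e b s Y|)%N -> copy1 c e X Y.
Proof. by have [u _ Su] := word_source_dir b; apply: (copy1_of_word ori Su). Qed.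

Lemma two_source_words b : (4 <= ell)%N -> ~ one_source ->
  exists u v, spells c e (b :: u ++ ~~ b :: b :: v ++ [:: ~~ b]).
Proof.
move=> l4 no; case: b.
  case: (word_shape e cyc ndir) => // -[a [b [ba ab S]]].
  by case: no; exists a, b.
have [[a [b [ba ab /spells_conv S]]]|[u [v /spells_conv S]]] := word_shape (conv e)
    (cycle_orientation_conv cyc) (fun h => ndir (directed_cycle_conv h)).
  case: no; exists a, b; split=> //; move: S; rewrite map_cat !map_nseq /= => S.
  have revn m (x : bool) : rev (nseq m x) = nseq m x.
    by elim: m => //= m IH; rewrite rev_cons IH -cats1 nseq_rcons.
  have := spells_flip S; rewrite map_cat !map_nseq rev_cat !revn => S2.
  exact: spells_rot.
by move: S; rewrite /= map_cat /= map_cat /= => S; exists (map negb u), (map negb v).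
Qed.

Variables (X Y : {set V}).
Hypotheses (dXY : [disjoint X & Y]) (no_copy : ~ (copy1 c e X Y /\ copy2 c e X Y)).

Lemma copy2_triangle d s t w : ell = 3%N -> s \in X -> t \in X -> w \in Y -> e s t ->
  dir e d s w -> dir e d t w -> copy2 c e X Y.
Proof.
move=> l3 sX tX wY st sw tw.
have S : spells c e [:: true; true; false].
  case: (word_shape e cyc ndir) => [[a [b [ba ab S]]]|[u [v S]]].
    have [aE bE] : a = 2%N /\ b = 1%N by lia.
    by move: S; rewrite aE bE.
  by have := proj1 S; rewrite /= size_cat /= size_cat /=; lia.
have us : uniq [:: s; t; w].
  rewrite /= !inE negb_or andbT -andbA; apply/and3P; split.
  - by apply: contraTneq st => ->; case: ori => irr _; rewrite irr.
  - by apply: contraTneq sX => ->; rewrite (disjointFl dXY).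
  by apply: contraTneq tX => ->; rewrite (disjointFl dXY).
exists s, t, [:: w]; split=> //; first by move=> z; rewrite inE => /eqP->.
case: d sw tw => /= sw tw; first by apply: (proj2 S) => //=; rewrite st tw sw.
have S' : spells c e [:: true; false; true] by apply: (@spells_rot _ _ _ _ [:: true] [:: true; false]).
by apply: (proj2 S') => //=; rewrite st tw sw.
Qed.

(** For [ell = 3] a missing [copy1] bounds the degrees from [X], and a missing [copy2] the degrees
    into [X]: a large neighbourhood in [X] of a vertex of [Y] contains an arc, which completes a
    transitive triangle. For [ell >= 4], two vertices of [X] with more than [thr + ell] common
    neighbours give both kinds of copies, so [pigeonhole] applies. *)
Lemma sparse_pair d (eps : R) : (3 <= ell)%N -> ~ one_source -> 0 < eps ->
  (thr ell e + ell + 1)%:R <= eps ^+ 2 * n -> eps <= 1 ->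
  (\sum_(s in X) #|nbh e d s Y|)%:R <= 2 * eps * n ^+ 2.
Proof.
move=> l3 no e0 hthr e1.
have nbhY s : nbh e d s Y = [set y | dir e d s y] :&: Y by apply/setP => y; rewrite !inE andbC.
have [l4|l4] := leqP 4 ell; last first.
  have le3 : ell = 3%N by lia.
  have small : (\sum_(s in X) #|nbh e d s Y| <= #|V| * thr ell e)%N.
    have [|c1] := boolp.pselect (copy1 c e X Y); last first.
      apply: (@leq_trans (\sum_(s in X) thr ell e)%N).
        by apply: leq_sum => s sX; rewrite leqNgt; apply/negP => /(copy1_of_nbh sX).
      by rewrite sum_nat_const leq_mul2r max_card orbT.
    move=> c1; rewrite sum_nbh; apply: (@leq_trans (\sum_(y in Y) thr ell e)%N).
      apply: leq_sum => y yY; rewrite leqNgt; apply/negP => h.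
      have [|s [t [sN tN st]]] := big_arc _ h; first by lia.
      apply: no_copy; split=> //; move: sN tN; rewrite !inE !dirN => /andP[sX sy] /andP[tX ty].
      exact: (@copy2_triangle d s t y).
    by rewrite sum_nat_const leq_mul2r max_card orbT.
  apply: (@le_trans _ _ (#|V| * thr ell e)%:R); first by rewrite ler_nat.
  rewrite natrM [_ * n ^+ 2]mulrC expr2 -mulrA ler_wpM2l ?ler0n //.
  have : (thr ell e)%:R <= (thr ell e + ell + 1)%:R :> R by rewrite ler_nat; lia.
  have : eps ^+ 2 * n <= eps * n by rewrite ler_wpM2r // expr2 ger_pMr.
  have : 0 <= eps * n by rewrite mulr_ge0 // ltW.
  by move: hthr; rewrite [n * _]mulrC; lra.
have [u [v S]] := @two_source_words d l4 no.
rewrite (eq_bigr (fun s => #|[set y | dir e d s y] :&: Y|)); last by move=> s _; rewrite nbhY.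
apply: (pigeonhole (K := thr ell e + ell)) => // x y xX yX xy.
rewrite leqNgt; apply/negP => h; apply: no_copy; split.
  apply: (@copy1_of_nbh d X Y x xX); rewrite nbhY.
  apply: (@leq_trans #|[set y | dir e d x y] :&: [set y0 | dir e d y y0] :&: Y|).
    by apply: leq_trans h; rewrite ltnS leq_addr.
  by apply/subset_leq_card/subsetP => z; rewrite !inE => /andP[/andP[-> _] ->].
apply: (@copy2_common _ _ _ _ ori _ _ dXY d d u v x y _ S xX yX xy _ h).
by apply/subsetP => z; rewrite !inE => /andP[/andP[-> ->] ->].
Qed.
End Sparse.

(** * The quadratic inequality *)

Section Analytic.
Variable R : realFieldType.

(* The optimal slope [k] for [edge_inequality] when the average gain is [D]. *)
Lemma optimal_slope (D : R) : 0 <= D < 1/2 -> exists k, [/\ 1 <= k, D <= k * D,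
  (k ^+ 2 + 2 * k - 1) / 2 * D - (k - 1) ^+ 2 / 4 = k * D & k * (1/2 - D) = 1/2 + D].
Proof.
move=> /andP[D0 D1]; have pos : 0 < 1/2 - D by lra.
(* For [D < 1/2] the left-hand side of the third clause is a concave quadratic in [k]; this is its
   maximiser. *)
exists ((1/2 + D) / (1/2 - D)).
have k1 : 1 <= (1/2 + D) / (1/2 - D) by rewrite ler_pdivlMr //; lra.
split=> //; first by nra.
  by field; apply/eqP => h; lra.
by rewrite divfK // gt_eqF.
Qed.

Lemma slope_ge (k : R) : 1 <= k -> k <= (k ^+ 2 + 2 * k - 1) / 2.
Proof.
move=> k1; have : 0 <= (k - 1) * (k + 1) by rewrite mulr_ge0 //; lra.
by rewrite ler_pdivlMr //; lra.
Qed.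

(** For [a < 1/2], the inequality [a * k <= b <= 1 - a] forces [D <= 1/2 - a], which is less than
    [3/4 - 3/2 * a]. For [a >= 1/2] it fails because [k > 1]. *)
Lemma no_slope (a b D k eta : R) : 0 < a -> 0 <= eta <= 1/4 -> a + b <= 1 -> 1 - eta <= a + b ->
  3/4 - 3/2 * a < D -> 0 < D -> k * (1/2 - D) = 1/2 + D -> D < 1/2 -> a * k <= b -> False.
Proof.
move=> a0 e1 ab1 ab2 hD D0 hk D1 akb.
have h : a * (1/2 + D) <= b * (1/2 - D) by rewrite -hk mulrA ler_wpM2r //; lra.
have [ah|ah] := lerP (1/2) a; nra.
Qed.

(** All quantities are relative to the order or its square: [a], [b] are the sizes of the parts,
    [a1], [b1] of the sets that meet good edges, [b0] and [lam] the size and average deficit of a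
    low set, [P] and [Q] the total gains. The lower bounds [DA] and [DB] for the average gains have
    a positive sum, so one of them is positive, and the last two hypotheses keep it below [1/2]. At
    its optimal slope [k] the gain costs the other part [k] times as much, whence [a * k <= b] or
    [b * k <= a], against [no_slope]. *)
Lemma analytic_contradiction (a b lam b0 a1 b1 P Q mu eta : R) :
  0 < a -> 0 < b -> a + b <= 1 -> 1 - eta <= a + b -> 0 <= eta <= 1/4 -> 0 < mu ->
  0 <= lam -> 0 <= b0 <= b -> 0 <= a1 <= a -> 0 <= b1 <= b - b0 ->
  a * (3/4 + mu/2 + 2 * lam - 3/2 * a) <= P ->
  b * (3/4 + mu/2 - 3/2 * b) - 2 * lam * b0 <= Q ->
  (forall k, 1 <= k -> (k ^+ 2 + 2 * k - 1) / 2 * P - (k - 1) ^+ 2 / 4 * a1 <= - Q) ->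
  (forall k, 1 <= k -> (k ^+ 2 + 2 * k - 1) / 2 * Q - (k - 1) ^+ 2 / 4 * b1 <= - P) ->
  P <= (1/2 - mu/16) * a1 -> Q <= (1/2 - mu/16) * b1 -> False.
Proof.
move=> a_gt0 b_gt0 ab1 ab2 he mu0 lam0 hb0 has hbs hP hQ hA hB hPs hQs.
set DA := 3/4 + mu/2 + 2 * lam - 3/2 * a in hP.
set DB := 3/4 + mu/2 - 3/2 * b in hQ.
have DAB : mu + 2 * lam <= DA + DB by rewrite /DA /DB; lra.
have [DA0|DA0] := lerP 0 DA.
  have [DA1|DA1] := lerP (1/2) DA.
    have p1 : 0 <= a * (DA - 1/2) by rewrite mulr_ge0 //; lra.
    have p2 : 0 <= mu * a1 by rewrite mulr_ge0 //; lra.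
    have a1p : 0 < a1 by lra.
    by have := mulr_gt0 mu0 a1p; lra.
  have [|k [k1 kD kE ks]] := @optimal_slope DA; first by rewrite DA0.
  have h1 : (k ^+ 2 + 2 * k - 1) / 2 * (a * DA) <= (k ^+ 2 + 2 * k - 1) / 2 * P.
    by rewrite ler_wpM2l //; have := slope_ge k1; lra.
  have h2 : (k - 1) ^+ 2 / 4 * a1 <= (k - 1) ^+ 2 / 4 * a.
    by rewrite ler_wpM2l ?divr_ge0 ?sqr_ge0 //; lra.
  have h3 : a * (k * DA) <= - Q by rewrite -kE; have := hA _ k1; lra.
  have h4 : - Q <= b * (DA - mu).
    have p1 : 0 <= b * (DA + DB - (mu + 2 * lam)) by rewrite mulr_ge0 //; lra.
    have p2 : 0 <= lam * (b - b0) by rewrite mulr_ge0 //; lra.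
    by lra.
  have bmu : 0 < b * mu by rewrite mulr_gt0.
  have DAp : 0 < DA.
    rewrite lt_neqAle DA0 andbT; apply/eqP => h.
    by move: h3 h4; rewrite -h; lra.
  have akb : a * k <= b.
    have : a * k * DA <= b * DA by lra.
    by rewrite ler_pM2r.
  by apply: (@no_slope a b DA k eta); rewrite // /DA; lra.
have DB0 : 0 < DB by lra.
set D := - DA in DA0 *; have D0 : 0 < D by rewrite /D; lra.
have DBD : D + mu + 2 * lam <= DB by rewrite /D; lra.
have PD : - P <= a * D by rewrite /D; lra.
(* On the low set the deficit is deducted, but [DB - 2 * lam] is still at least [D]. *)
have hQ' : (b - b0) * DB + b0 * D <= Q.
  have : 0 <= b0 * (DB - 2 * lam - D) by rewrite mulr_ge0 //; lra.
  by lra.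
have [DB1|DB1] := lerP (1/2) DB.
  have h1 : (b - b0) * (1/2) <= (b - b0) * DB by rewrite ler_wpM2l //; lra.
  have h3 : 0 <= b0 * D by rewrite mulr_ge0 //; lra.
  have p2 : 0 <= mu * b1 by rewrite mulr_ge0 //; lra.
  have b0p : b0 = 0.
    apply/eqP; rewrite eq_le; apply/andP; split; last by lra.
    rewrite leNgt; apply/negP => b0p; have := mulr_gt0 b0p D0; lra.
  have b1p : 0 < b1 by lra.
  by have := mulr_gt0 mu0 b1p; lra.
have [|k [k1 kD kE ks]] := @optimal_slope DB; first by rewrite ltW.
have hk := hB _ k1.
set S := (k ^+ 2 + 2 * k - 1) / 2 in kE hk.
have Sk : k <= S by apply: slope_ge.
have h1 : S * ((b - b0) * DB + b0 * D) <= S * Q by rewrite ler_wpM2l //; lra.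
have h2 : (k - 1) ^+ 2 / 4 * b1 <= (k - 1) ^+ 2 / 4 * (b - b0).
  by rewrite ler_wpM2l ?divr_ge0 ?sqr_ge0 //; lra.
have h3 : (b - b0) * (k * DB) + b0 * (S * D) <= a * D.
  rewrite -kE; apply: le_trans PD; apply: le_trans hk.
  have -> : (b - b0) * (S * DB - (k - 1) ^+ 2 / 4) + b0 * (S * D) =
    S * ((b - b0) * DB + b0 * D) - (k - 1) ^+ 2 / 4 * (b - b0) by ring.
  by lra.
have h4 : b0 * (k * D) <= b0 * (S * D) by rewrite ler_wpM2l ?ler_wpM2r //; lra.
have h5 : (b - b0) * (k * D) <= (b - b0) * (k * DB).
  by rewrite ler_wpM2l ?ler_wpM2l //; lra.
have akb : b * k <= a.
  have : b * k * D <= a * D by lra.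
  by rewrite ler_pM2r.
by apply: (@no_slope b a DB k eta); rewrite // /DB; lra.
Qed.
End Analytic.

(** * Edge-weighted degree sums *)

Lemma sumr_const_set (R : nmodType) (V : finType) (B : {set V}) (P : pred V) (c : R) :
  \sum_(w in B | P w) c = c *+ #|[set w in B | P w]|.
Proof. by rewrite -sumr_const; apply: eq_bigl => w; rewrite inE. Qed.

Section EdgeInequality.
Variables (R : realFieldType) (V : finType) (A B : {set V}) (H : rel V).
Variables (MA MB : V -> R) (C : R).

Definition rdeg (s : V) : nat := #|[set w in B | H s w]|.
Definition ldeg (w : V) : nat := #|[set s in A | H s w]|.
Local Notation x s := ((rdeg s)%:R : R).
Local Notation u w := ((ldeg w)%:R : R).

Hypothesis MB0 : forall w, w \in B -> 0 <= MB w.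
Hypothesis Hu : forall s w, s \in A -> w \in B -> H s w -> 2 * u w <= MA s.
Hypothesis Hx : forall s w, s \in A -> w \in B -> H s w -> 2 * x s <= MB w.
Hypothesis Hxu : forall s w, s \in A -> w \in B -> H s w -> 2 * x s + 2 * u w <= C.

Lemma sum_rdeg_ldeg : \sum_(s in A) x s = \sum_(w in B) u w.
Proof.
rewrite -!natr_sum; congr _%:R.
rewrite (eq_bigr (fun s => \sum_(w in B) H s w)%N); last by move=> s _; rewrite /rdeg card_set_sum.
by rewrite exchange_big; apply: eq_bigr => w _; rewrite /ldeg card_set_sum.
Qed.

Lemma rdeg_gt0 s w : w \in B -> H s w -> 0 < x s.
Proof. by move=> wB h; rewrite ltr0n card_gt0; apply/set0Pn; exists w; rewrite inE wB. Qed.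

Lemma ldeg_gt0 s w : s \in A -> H s w -> 0 < u w.
Proof. by move=> sA h; rewrite ltr0n card_gt0; apply/set0Pn; exists s; rewrite inE sA. Qed.

Lemma rdeg_sum s (F : V -> R) (c : R) : (forall w, w \in B -> H s w -> F w <= c) ->
  \sum_(w in B | H s w) F w <= x s * c.
Proof.
move=> h; apply: (@le_trans _ _ (\sum_(w in B | H s w) c)).
  by apply: ler_sum => w /andP[]; apply: h.
by rewrite sumr_const_set mulr_natl.
Qed.

(* The AM-GM inequality [x / u + k ^ 2 * (u / x) >= 2 * k], averaged over [H]. *)
Lemma edge_inequality k : 1 <= k ->
  (k ^+ 2 + 2 * k - 1) / 2 * (\sum_(s in A | (0 < rdeg s)%N) (2 * x s - MA s))
    - (k - 1) ^+ 2 / 2 * C * #|[set s in A | (0 < rdeg s)%N]|%:R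
  <= \sum_(w in B) (MB w - 2 * u w).
Proof.
move=> k1.
have -> : \sum_(w in B) (MB w - 2 * u w) =
    \sum_(w in B) MB w - 2 * \sum_(s in A | (0 < rdeg s)%N) x s.
  rewrite sumrB -mulr_sumr -sum_rdeg_ldeg [\sum_(s in A) _](bigID (fun s => 0 < rdeg s)%N) /=.
  rewrite [X in _ * (_ + X)]big1 ?addr0 // => s.
  by rewrite -eqn0Ngt => /andP[_ /eqP->].
have step1 : \sum_(s in A) \sum_(w in B | H s w) (4 * k - 2 * k ^+ 2 * (u w / x s))
     <= \sum_(w in B) MB w.
  rewrite (exchange_big_dep (mem B)) /=; last by move=> s w _ /andP[].
  apply: ler_sum => w wB.
  apply: (@le_trans _ _ (\sum_(s in A | (w \in B) && H s w) (MB w / u w))).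
    apply: ler_sum => s /andP[sA /andP[_ sw]].
    have x0 := rdeg_gt0 wB sw; have u0 := ldeg_gt0 sA sw.
    apply: (@le_trans _ _ (2 * x s / u w)); last by rewrite ler_pM2r ?invr_gt0 // Hx.
    rewrite -subr_ge0; move: (x s) (u w) x0 u0 => xs uw x0 u0.
    have -> : 2 * xs / uw - (4 * k - 2 * k ^+ 2 * (uw / xs)) =
       2 * (xs - k * uw) ^+ 2 / (xs * uw).
      by field; rewrite !gt_eqF.
    by apply: divr_ge0; apply: mulr_ge0; rewrite ?sqr_ge0 // ltW.
  have -> : \sum_(s in A | (w \in B) && H s w) MB w / u w = \sum_(s in A | H s w) MB w / u w.
    by apply: eq_bigl => s; rewrite wB.
  rewrite sumr_const_set -/(ldeg w).
  have [->|u0] := posnP (ldeg w); first by rewrite mulr0n MB0.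
  by rewrite -[leLHS]mulr_natr divfK // pnatr_eq0 -lt0n.
have {}step1 : \sum_(s in A | (0 < rdeg s)%N) \sum_(w in B | H s w) (4 * k - 2 * k ^+ 2 * (u w / x s))
     <= \sum_(w in B) MB w.
  apply: le_trans step1; rewrite [leRHS](bigID (fun s => 0 < rdeg s)%N) /= lerDl.
  rewrite big1 // => s /andP[_]; rewrite -eqn0Ngt => /eqP h; rewrite big1 // => w /andP[wB sw].
  by have := rdeg_gt0 wB sw; rewrite h ltxx.
apply: le_trans (lerB step1 (lexx _)).
rewrite -[_ / 2 * C * _]mulrA [C * _]mulr_natr -sumr_const_set !mulr_sumr -!sumrB; apply: ler_sum => s /andP[sA s0].
have x0 : 0 < x s by rewrite ltr0n.
set ub := (\sum_(w in B | H s w) u w) / x s.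
have -> : \sum_(w in B | H s w) (4 * k - 2 * k ^+ 2 * (u w / x s)) = 4 * k * x s - 2 * k ^+ 2 * ub.
  by rewrite sumrB sumr_const_set -mulr_sumr -mulr_suml mulr_natr.
have ub1 : 2 * ub <= MA s.
  rewrite /ub mulrA ler_pdivrMr // mulr_sumr [leRHS]mulrC.
  apply: rdeg_sum => w wB sw; exact: Hu.
have ub2 : 2 * ub + 2 * x s <= C.
  rewrite -lerBrDr /ub mulrA ler_pdivrMr // mulr_sumr [leRHS]mulrC.
  apply: rdeg_sum => w wB sw; have := Hxu sA wB sw; lra.
rewrite -subr_ge0.
(* The slacks of [ub1] and [ub2] must together account for the terms in [ub] and [x s]; this
   determines the two coefficients in [k]. *)
have -> : 4 * k * x s - 2 * k ^+ 2 * ub - 2 * x s -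
  ((k ^+ 2 + 2 * k - 1) / 2 * (2 * x s - MA s) - (k - 1) ^+ 2 / 2 * C) =
  (k ^+ 2 + 2 * k - 1) / 2 * (MA s - 2 * ub) + (k - 1) ^+ 2 / 2 * (C - (2 * ub + 2 * x s)) by field.
apply: addr_ge0; apply: mulr_ge0; rewrite ?subr_ge0 //; last by rewrite divr_ge0 ?sqr_ge0.
by have := slope_ge k1; lra.
Qed.
End EdgeInequality.

(** * The two-part degree argument *)

Section Core.
Variables (R : realFieldType) (V : finType) (e : rel V) (A B : {set V}) (H : rel V).
Variables (mu rho kappa err : R).
Local Notation n := (#|V|%:R : R).
Local Notation Gr := (mu / 16 * n).
Hypotheses (ori : oriented e) (dAB : [disjoint A & B]).
Hypotheses (mu0 : 0 < mu <= 1) (rho0 : 0 < rho).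
Hypotheses (hA : rho * n <= #|A|%:R) (hB : rho * n <= #|B|%:R) (n0 : 0 < n).
Hypothesis (hrest : #|~: (A :|: B)|%:R <= mu / 16 * n).
Hypothesis (Hu : forall s w, s \in A -> w \in B -> H s w -> 2 * (ldeg A H w)%:R <= (codeg e s A)%:R + Gr).
Hypothesis (Hx : forall s w, s \in A -> w \in B -> H s w -> 2 * (rdeg B H s)%:R <= (codeg e w B)%:R + Gr).
Hypothesis (Hxu : forall s w, s \in A -> w \in B -> H s w ->
  2 * (rdeg B H s)%:R + 2 * (ldeg A H w)%:R <= n / 2).
Hypothesis (lostA : \sum_(s in A) (adjdeg e s B)%:R <= \sum_(s in A) (rdeg B H s)%:R + kappa * n ^+ 2).
Hypothesis (budget : err + kappa <= mu * rho / 16).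

(** The star degree of [s] is at most its share inside [A], its degree into [B] and the rest, while
    [internal_bound] trades the first against the codegree. Of the corrections, [3 * mu / 16] is
    twice the rest and once [Gr]; [mu / 8] absorbs [err] and [kappa], by [budget] and the lower
    bound on the size of [A]. *)
Lemma gain_lower (g : R) : #|A|%:R * n * g - err * n ^+ 2 <= \sum_(s in A) (deg_star e s)%:R ->
  n ^+ 2 * (#|A|%:R / n * (2 * g - 3 * mu / 16 - mu / 8 - 3/2 * (#|A|%:R / n))) <=
  \sum_(s in A) (2 * (rdeg B H s)%:R - ((codeg e s A)%:R + Gr)).
Proof.
move=> hg.
have := internal_bound ori A; rewrite -(ler_nat R) natrD !natrM => hI.
have hsplit : \sum_(s in A) (deg_star e s)%:R <=
   (\sum_(s in A) star_in e s A)%:R + \sum_(s in A) (adjdeg e s B)%:R + #|A|%:R * (mu / 16 * n) :> R.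
  have -> : #|A|%:R * (mu / 16 * n) = \sum_(s in A) (mu / 16 * n) by rewrite sumr_const mulr_natl.
  rewrite natr_sum -!big_split; apply: ler_sum => s _ /=.
  apply: le_trans (lerD (lexx _) hrest).
  by rewrite -!natrD ler_nat deg_star_split.
have SE : \sum_(s in A) (2 * (rdeg B H s)%:R - ((codeg e s A)%:R + Gr)) =
  2 * \sum_(s in A) (rdeg B H s)%:R - (\sum_(s in A) codeg e s A)%:R - #|A|%:R * Gr.
  rewrite sumrB -mulr_sumr big_split /= sumr_const natr_sum -mulr_natl; lra.
rewrite SE; set a := #|A|%:R / n.
have aE : #|A|%:R = a * n by rewrite /a divfK // gt_eqF.
have ar : rho <= a by rewrite /a ler_pdivlMr.
rewrite aE in hI hsplit hg *.
have lA := lostA.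
set X := \sum_(s in A) (rdeg B H s)%:R in lA *.
set Y := \sum_(s in A) (adjdeg e s B)%:R in lA hsplit.
set Z := \sum_(s in A) (deg_star e s)%:R in hg hsplit.
set S1 := (\sum_(s in A) star_in e s A)%:R in hI hsplit.
set S2 := (\sum_(s in A) codeg e s A)%:R in hI *.
have n2 : 0 < n ^+ 2 by rewrite exprn_gt0.
have hb : (err + kappa) * n ^+ 2 <= mu * a / 16 * n ^+ 2.
  rewrite ler_pM2r //; apply: le_trans budget _.
  have m0 : 0 <= mu by case/andP: mu0 => /ltW.
  by have := ler_wpM2l m0 ar; lra.
have -> : n ^+ 2 * (a * (2 * g - 3 * mu / 16 - mu / 8 - 3 / 2 * a)) =
   2 * (a * n * n * g) - 3 / 2 * (a * n) ^+ 2 - 3 * (a * n * (mu / 16 * n)) - 2 * (mu * a / 16 * n ^+ 2) by field.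
have -> : a * n * (mu / 16 * n) = a * (mu / 16 * n) * n by ring.
lra.
Qed.

Lemma gain_upper :
  \sum_(s in A) (2 * (rdeg B H s)%:R - ((codeg e s A)%:R + Gr)) <=
  \sum_(s in A | (0 < rdeg B H s)%N) (2 * (rdeg B H s)%:R - ((codeg e s A)%:R + Gr)).
Proof.
rewrite (bigID (fun s => 0 < rdeg B H s)%N) /= gerDl; apply: sumr_le0 => s.
rewrite -eqn0Ngt => /andP[_ /eqP->]; rewrite mulr0 sub0r oppr_le0.
by case/andP: mu0 => m0 _; rewrite addr_ge0 // !mulr_ge0 ?invr_ge0 // ltW.
Qed.

Lemma gain_cap :
  \sum_(s in A) (2 * (rdeg B H s)%:R - ((codeg e s A)%:R + Gr)) <=
  (1/2 - mu / 16) * n * #|[set s in A | (0 < rdeg B H s)%N]|%:R.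
Proof.
apply: le_trans gain_upper _; rewrite [leRHS]mulr_natr -sumr_const_set.
apply: ler_sum => s /andP[sA]; rewrite card_gt0 => /set0Pn[w]; rewrite inE => /andP[wB sw].
have := Hxu sA wB sw; have : 0 <= (ldeg A H w)%:R :> R by rewrite ler0n.
have : 0 <= (codeg e s A)%:R :> R by rewrite ler0n.
lra.
Qed.

Lemma gain_edge k : 1 <= k ->
  (k ^+ 2 + 2 * k - 1) / 2 * (\sum_(s in A) (2 * (rdeg B H s)%:R - ((codeg e s A)%:R + Gr)))
   - (k - 1) ^+ 2 / 4 * n * #|[set s in A | (0 < rdeg B H s)%N]|%:R <=
  - \sum_(w in B) (2 * (ldeg A H w)%:R - ((codeg e w B)%:R + Gr)).
Proof.
move=> k1; case/andP: mu0 => m0 _.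
have := @edge_inequality R V A B H (fun s => (codeg e s A)%:R + Gr)
   (fun w => (codeg e w B)%:R + Gr) (n / 2) _ Hu Hx Hxu k k1.
move=> h.
have -> : - \sum_(w in B) (2 * (ldeg A H w)%:R - ((codeg e w B)%:R + Gr)) =
   \sum_(w in B) ((codeg e w B)%:R + Gr - 2 * (ldeg A H w)%:R).
  by rewrite -sumrN; apply: eq_bigr => w _; rewrite opprB.
apply: le_trans (h _).
  rewrite lerB //; last by rewrite le_eqVlt; apply/orP; left; apply/eqP; field.
  by rewrite ler_wpM2l ?gain_upper //; have := slope_ge k1; lra.
by move=> w _; rewrite addr_ge0 // !mulr_ge0 ?invr_ge0 // ltW.
Qed.
End Core.

Section CoreContra.
Variables (R : realFieldType) (V : finType) (e : rel V) (A B : {set V}) (H : rel V).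
Variables (mu rho kappa err lam h : R) (B0 : {set V}).
Local Notation n := (#|V|%:R : R).
Local Notation Gr := (mu / 16 * n).
Hypotheses (ori : oriented e) (dAB : [disjoint A & B]).
Hypotheses (mu0 : 0 < mu <= 1) (rho0 : 0 < rho).
Hypotheses (hA : rho * n <= #|A|%:R) (hB : rho * n <= #|B|%:R) (n0 : 0 < n).
Hypothesis (hrest : #|~: (A :|: B)|%:R <= mu / 16 * n).
Hypothesis (Hu : forall s w, s \in A -> w \in B -> H s w -> 2 * (ldeg A H w)%:R <= (codeg e s A)%:R + Gr).
Hypothesis (Hx : forall s w, s \in A -> w \in B -> H s w -> 2 * (rdeg B H s)%:R <= (codeg e w B)%:R + Gr).
Hypothesis (Hxu : forall s w, s \in A -> w \in B -> H s w ->
  2 * (rdeg B H s)%:R + 2 * (ldeg A H w)%:R <= n / 2).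
Hypothesis (lostA : \sum_(s in A) (adjdeg e s B)%:R <= \sum_(s in A) (rdeg B H s)%:R + kappa * n ^+ 2).
Hypothesis (lostB : \sum_(w in B) (adjdeg e w A)%:R <= \sum_(w in B) (ldeg A H w)%:R + kappa * n ^+ 2).
Hypothesis (budget : err + kappa <= mu * rho / 16).
Hypothesis (hh : 2 * h = 3/4 + mu) (lam0 : 0 <= lam).
Hypothesis (B0B : B0 \subset B) (HB0 : forall s w, s \in A -> w \in B0 -> ~~ H s w).
Hypothesis (sumA : #|A|%:R * n * (h + lam) - err * n ^+ 2 <= \sum_(s in A) (deg_star e s)%:R).
Hypothesis (sumB : #|B|%:R * n * h - lam * n * #|B0|%:R - err * n ^+ 2 <=
  \sum_(w in B) (deg_star e w)%:R).

Lemma core_contradiction : False.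
Proof.
case/andP: (mu0) => m0 m1; have hh' := hh.
have Hxu' w s : w \in B -> s \in A -> H s w ->
    2 * (ldeg A H w)%:R + 2 * (rdeg B H s)%:R <= n / 2.
  by move=> wB sA sw; rewrite addrC; exact: Hxu.
have n2 : 0 < n ^+ 2 by rewrite exprn_gt0.
have hrest' : #|~: (B :|: A)|%:R <= mu / 16 * n by rewrite setUC.
have Bn0 : 0 < #|B|%:R :> R by apply: lt_le_trans hB; rewrite mulr_gt0.
have An0 : 0 < #|A|%:R :> R by apply: lt_le_trans hA; rewrite mulr_gt0.
pose SP := \sum_(s in A) (2 * (rdeg B H s)%:R - ((codeg e s A)%:R + Gr)).
pose SQ := \sum_(w in B) (2 * (ldeg A H w)%:R - ((codeg e w B)%:R + Gr)).
pose As := [set s in A | (0 < rdeg B H s)%N]; pose Bs := [set w in B | (0 < ldeg A H w)%N].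
have cardAB : #|A|%:R + #|B|%:R + #|~: (A :|: B)|%:R = n.
  rewrite -!natrD; congr _%:R; rewrite -(cardsC (A :|: B)) cardsU.
  by have := dAB; rewrite -setI_eq0 => /eqP->; rewrite cards0 subn0.
have rest0 : 0 <= #|~: (A :|: B)|%:R :> R by rewrite ler0n.
apply: (@analytic_contradiction R (#|A|%:R / n) (#|B|%:R / n) lam (#|B0|%:R / n) (#|As|%:R / n)
   (#|Bs|%:R / n) (SP / n ^+ 2) (SQ / n ^+ 2) mu (mu / 16)) => //.
- by rewrite divr_gt0.
- by rewrite divr_gt0.
- by rewrite -mulrDl ler_pdivrMr //; lra.
- rewrite -mulrDl ler_pdivlMr // mulrBl mul1r lerBlDr.
  by rewrite -{1}cardAB lerD2l.
- by apply/andP; split; lra.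
- by rewrite divr_ge0 //= ler_pM2r ?invr_gt0 // ler_nat subset_leq_card.
- by rewrite divr_ge0 //= ler_pM2r ?invr_gt0 // ler_nat subset_leq_card // /As setIdE subsetIl.
- rewrite divr_ge0 //= -mulrBl ler_pM2r ?invr_gt0 // lerBrDr -natrD ler_nat.
  (* No edge of [H] meets [B0], which yields [b1 <= b - b0]. *)
  have dis : [disjoint Bs & B0].
    rewrite -setI_eq0; apply/eqP/setP => w; rewrite !inE; apply/negP => /andP[/andP[_ h1] wB0].
    move: h1; rewrite card_gt0 => /set0Pn[s]; rewrite inE => /andP[sA].
    by apply/negP; exact: HB0.
  have -> : (#|Bs| + #|B0|)%N = #|Bs :|: B0|.
    by rewrite cardsU (eqP (_ : Bs :&: B0 == set0)) ?setI_eq0 // cards0 subn0.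
  by apply: subset_leq_card; rewrite subUset B0B andbT; apply/subsetP => w; rewrite inE => /andP[].
- rewrite ler_pdivlMr //.
  have := gain_lower ori mu0 hA n0 hrest lostA budget sumA; rewrite -/SP.
  apply: le_trans; rewrite mulrC ler_pM2l // ler_wpM2l ?divr_ge0 //.
  by lra.
- rewrite ler_pdivlMr //.
  have sumB' : #|B|%:R * n * (h - lam * (#|B0|%:R / #|B|%:R)) - err * n ^+ 2 <=
     \sum_(w in B) (deg_star e w)%:R.
    apply: le_trans sumB; rewrite le_eqVlt; apply/orP; left; apply/eqP.
    by field; rewrite gt_eqF.
  have := @gain_lower R V e B A (fun w s => H s w) mu rho kappa err ori mu0 hB n0 hrest' lostB budget _ sumB'.
  rewrite -/SQ; apply: le_trans.
  rewrite -[leRHS](_ : (#|B|%:R / n * (2 * h - 3 * mu / 16 - mu / 8 - 3 / 2 * (#|B|%:R / n))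
      - 2 * lam * (#|B0|%:R / n)) * n ^+ 2 = _); last by field; rewrite !gt_eqF.
  rewrite ler_pM2r // lerB // ler_wpM2l ?divr_ge0 //; lra.
- move=> k k1; have := @gain_edge R V e A B H mu mu0 Hu Hx Hxu k k1; rewrite -/SP -/SQ -/As => hk.
  rewrite -(ler_pM2r n2) mulNr divfK ?gt_eqF //; apply: le_trans hk.
  rewrite le_eqVlt; apply/orP; left; apply/eqP; field; rewrite gt_eqF //.
- move=> k k1; have := @gain_edge R V e B A (fun w s => H s w) mu mu0
     (fun s w h1 h2 h3 => Hx h2 h1 h3) (fun s w h1 h2 h3 => Hu h2 h1 h3) Hxu' k k1.
  rewrite -/SP -/SQ -/Bs => hk.
  rewrite -(ler_pM2r n2) mulNr divfK ?gt_eqF //; apply: le_trans hk.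
  rewrite le_eqVlt; apply/orP; left; apply/eqP; field; rewrite gt_eqF //.
- rewrite ler_pdivrMr //; have := @gain_cap R V e A B H mu mu0 Hxu; rewrite -/SP -/As => /le_trans; apply.
  by rewrite le_eqVlt; apply/orP; left; apply/eqP; field; rewrite gt_eqF.
rewrite ler_pdivrMr //; have := @gain_cap R V e B A (fun w s => H s w) mu mu0 Hxu'.
rewrite -/SQ -/Bs => /le_trans; apply.
by rewrite le_eqVlt; apply/orP; left; apply/eqP; field; rewrite gt_eqF.
Qed.
End CoreContra.

(** * Vertices of low degree *)

Definition low (R : realFieldType) (V : finType) (e : rel V) (mu : R) : {set V} :=
  [set x | 2 * (deg_star e x)%:R < (3/4 + mu) * #|V|%:R].

Definition ore_condition (R : realFieldType) (V : finType) (e : rel V) (mu : R) : Prop :=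
  forall x y, x != y -> ~~ adj e x y ->
    (3/4 + mu) * #|V|%:R <= (deg_star e x)%:R + (deg_star e y)%:R.

Lemma low_adj (R : realFieldType) (V : finType) (e : rel V) (mu : R) x y :
  ore_condition e mu -> x \in low e mu -> y \in low e mu -> x != y -> adj e x y.
Proof.
move=> ore; rewrite !inE => xl yl xy; case: (boolP (adj e x y)) => // nxy.
by have := ore _ _ xy nxy; lra.
Qed.

Record good_edges (R : realFieldType) (V : finType) (e : rel V) (mu kappa : R)
    (A B : {set V}) (H : rel V) : Prop := GoodEdges {
  ge_ldeg : forall s w, s \in A -> w \in B -> H s w ->
    2 * (ldeg A H w)%:R <= (codeg e s A)%:R + mu / 16 * #|V|%:R;
  ge_rdeg : forall s w, s \in A -> w \in B -> H s w ->
    2 * (rdeg B H s)%:R <= (codeg e w B)%:R + mu / 16 * #|V|%:R;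
  ge_sum : forall s w, s \in A -> w \in B -> H s w ->
    2 * (rdeg B H s)%:R + 2 * (ldeg A H w)%:R <= #|V|%:R / 2 :> R;
  ge_adj : forall s w, s \in A -> w \in B -> H s w ->
    [/\ adj e s w, s \notin low e mu & w \notin low e mu];
  ge_lost : \sum_(s in A) (adjdeg e s B)%:R <=
    \sum_(s in A) (rdeg B H s)%:R + kappa * #|V|%:R ^+ 2 }.

Record dense_setting (R : realFieldType) (V : finType) (e : rel V) (mu rho : R)
    (A B : {set V}) : Prop := DenseSetting {
  ds_ori : oriented e; ds_disj : [disjoint A & B];
  ds_mu : 0 < mu <= 1; ds_rho : 0 < rho <= 1;
  ds_A : rho * #|V|%:R <= #|A|%:R; ds_B : rho * #|V|%:R <= #|B|%:R;
  ds_n : 0 < #|V|%:R :> R;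
  ds_rest : #|~: (A :|: B)|%:R <= mu / 16 * #|V|%:R;
  ds_ore : ore_condition e mu }.

Section Sym.
Variables (R : realFieldType) (V : finType) (e : rel V) (mu rho kappa : R).
Variables (A B : {set V}) (H : rel V).

Lemma sum_adjdeg_sym : \sum_(s in A) (adjdeg e s B)%:R = \sum_(w in B) (adjdeg e w A)%:R :> R.
Proof.
rewrite -!natr_sum; congr _%:R; rewrite (eq_bigr (fun s => \sum_(w in B) adj e s w)%N).
  by rewrite exchange_big; apply: eq_bigr => w _; rewrite adjdeg_sum; apply: eq_bigr => s _; rewrite adj_sym.
by move=> s _; rewrite adjdeg_sum.
Qed.

Lemma dense_setting_sym : dense_setting e mu rho A B -> dense_setting e mu rho B A.
Proof. by case=> *; split=> //; rewrite ?(disjoint_sym B) // setUC. Qed.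

Lemma good_edges_sym : good_edges e mu kappa A B H -> good_edges e mu kappa B A (conv H).
Proof.
case=> h1 h2 h3 h4 h5; split=> [s w sB wA sw|s w sB wA sw|s w sB wA sw|s w sB wA sw|].
- exact: h2 wA sB sw.
- exact: h1 wA sB sw.
- by rewrite addrC; exact: h3 wA sB sw.
- by rewrite adj_sym; have [] := h4 _ _ wA sB sw.
by rewrite -sum_adjdeg_sym -[X in _ <= X + _](@sum_rdeg_ldeg R V A B H).
Qed.
End Sym.

Section Low.
Variables (R : realFieldType) (V : finType) (e : rel V) (mu rho kappa : R).
Variables (A B : {set V}) (H : rel V).
Local Notation n := (#|V|%:R : R).
Local Notation h := ((3/4 + mu) / 2).
Hypotheses (ds : dense_setting e mu rho A B) (ge : good_edges e mu kappa A B H).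
Hypothesis (hk : 0 <= kappa <= (mu * rho) ^+ 2 / 4096).

Lemma mu_rho_bounds : 0 < mu * rho <= 1.
Proof.
have := ds_mu ds => /andP[m0 m1]; have := ds_rho ds => /andP[r0 r1].
by rewrite mulr_gt0 //= mulr_ile1 // ltW.
Qed.

Lemma kappa_small : 128 * kappa <= mu * rho / 32 * (mu * rho) /\ kappa <= mu * rho / 4096.
Proof.
case/andP: mu_rho_bounds => p0 p1; case/andP: hk => k0 k1.
have : (mu * rho) ^+ 2 <= mu * rho by rewrite expr2 ger_pMr.
by rewrite expr2 in k1 *; split; lra.
Qed.

Lemma low_sum_lt : \sum_(w in B :&: low e mu) (deg_star e w)%:R <= h * n * #|B :&: low e mu|%:R.
Proof.
rewrite mulr_natr -sumr_const; apply: ler_sum => w; rewrite !inE => /andP[_ lw]; lra.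
Qed.

Lemma high_sum_ge (C : {set V}) : h * n * #|C :\: low e mu|%:R <=
  \sum_(w in C :\: low e mu) (deg_star e w)%:R.
Proof.
rewrite mulr_natr -sumr_const; apply: ler_sum => w; rewrite !inE -leNgt => /andP[lw _]; lra.
Qed.

(** Good edges avoid low vertices, so all cross edges at low vertices of [B] are among the lost
    ones. *)
Lemma low_cross : \sum_(w in B :&: low e mu) (adjdeg e w A)%:R <= kappa * n ^+ 2.
Proof.
have := ge_lost (good_edges_sym ge).
rewrite (bigID (mem (low e mu))) /= [X in _ <= X + _](bigID (mem (low e mu))) /=.
have -> : \sum_(i in B | i \in low e mu) (rdeg A (conv H) i)%:R = 0 :> R.
  rewrite big1 // => w /andP[wB wl]; apply/eqP; rewrite pnatr_eq0 cards_eq0; apply/eqP/setP => s.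
  rewrite !inE; apply/negP => /andP[sA sw].
  by have [_ _] := ge_adj ge sA wB sw; rewrite wl.
have -> : \sum_(i in B | i \in low e mu) (adjdeg e i A)%:R = \sum_(i in B :&: low e mu) (adjdeg e i A)%:R :> R.
  by apply: eq_bigl => i; rewrite in_setI.
have : \sum_(i in B | i \notin low e mu) (rdeg A (conv H) i)%:R <=
       \sum_(i in B | i \notin low e mu) (adjdeg e i A)%:R :> R.
  apply: ler_sum => w /andP[wB _]; rewrite ler_nat; apply/subset_leq_card/subsetP => s.
  rewrite !inE => /andP[sA sw]; rewrite sA andbT adj_sym.
  by have [] := ge_adj ge sA wB sw.
lra.
Qed.

(** By [low_cross] almost every pair of a low vertex of [B] and a vertex of [A] is non-adjacent, so
    the Ore condition applies to it. Averaged over these pairs, it puts the mean degree in [A] above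
    half the Ore bound by the amount [lam] by which the low vertices fall short on average, up to an
    error. *)
Lemma many_low_contradiction : mu * rho / 64 * n <= #|B :&: low e mu|%:R -> False.
Proof.
move=> hL; set L := B :&: low e mu in hL *.
have /andP[p0 p1] := mu_rho_bounds; have [k1 k2] := kappa_small.
have n0 := ds_n ds; have /andP[m0 m1] := ds_mu ds; have /andP[r0 r1] := ds_rho ds.
have L0 : 0 < #|L|%:R :> R.
  by apply: lt_le_trans hL; rewrite mulr_gt0 // divr_gt0.
set SL := \sum_(w in L) (deg_star e w)%:R : R.
have SLh : SL <= h * n * #|L|%:R by exact: low_sum_lt.
pose lam := h - SL / (n * #|L|%:R).
have SLE : SL = (h - lam) * n * #|L|%:R.
  by rewrite /lam; field; rewrite !gt_eqF.
have lam0 : 0 <= lam by rewrite subr_ge0 ler_pdivrMr ?mulr_gt0 // mulrA.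
have cross := low_cross; rewrite -/L in cross.
have hk0 : 0 <= kappa by case/andP: hk.
have err0 : 0 <= 128 * kappa / (mu * rho) by rewrite divr_ge0 ?mulr_ge0 // ltW.
(* The adjacent pairs cost at most [2 n] times [kappa n ^ 2], shared by at least [mu * rho / 64 * n]
   low vertices; this gives [err]. *)
apply: (@core_contradiction R V e A B H mu rho kappa (128 * kappa / (mu * rho)) lam h L
  (ds_ori ds) (ds_disj ds) (ds_mu ds) r0 (ds_A ds) (ds_B ds) n0 (ds_rest ds)
  (ge_ldeg ge) (ge_rdeg ge) (ge_sum ge) (ge_lost ge) (ge_lost (good_edges_sym ge))) => //.
- have : 128 * kappa / (mu * rho) <= mu * rho / 32 by rewrite ler_pdivrMr.
  lra.
- by field.
- exact: subsetIl.
- move=> s w sA; rewrite in_setI => /andP[wB wl]; apply/negP => sw.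
  by have [_ _] := ge_adj ge sA wB sw; rewrite wl.
- have pairs : \sum_(w in L) \sum_(s in A) ((3/4 + mu) * n * (~~ adj e w s)%:R) <=
      \sum_(w in L) \sum_(s in A) ((deg_star e s)%:R + (deg_star e w)%:R).
    apply: ler_sum => w wL; apply: ler_sum => s sA.
    case: (boolP (adj e w s)) => [_|nws]; first by rewrite mulr0 addr_ge0.
    rewrite mulr1 [leRHS]addrC; apply: (ds_ore ds) => //.
    apply: contraTneq sA => <-; rewrite (disjointFl (ds_disj ds)) //.
    by move: wL; rewrite inE => /andP[].
  have lhsE : \sum_(w in L) \sum_(s in A) ((3/4 + mu) * n * (~~ adj e w s)%:R) =
     (3/4 + mu) * n * (#|L|%:R * #|A|%:R - \sum_(w in L) (adjdeg e w A)%:R).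
    rewrite (eq_bigr (fun w => (3/4 + mu) * n * (#|A|%:R - (adjdeg e w A)%:R))).
      by rewrite -mulr_sumr sumrB sumr_const [#|L|%:R * _]mulr_natl.
    move=> w _; rewrite -mulr_sumr -natr_sum -codeg_sum; congr (_ * _).
    by rewrite -(adjdeg_codeg e w A) natrD addrC addKr.
  have rhsE : \sum_(w in L) \sum_(s in A) ((deg_star e s)%:R + (deg_star e w)%:R) =
     #|L|%:R * \sum_(s in A) (deg_star e s)%:R + #|A|%:R * SL.
    rewrite [#|L|%:R * _]mulr_natl -sumr_const /SL mulr_sumr -big_split; apply: eq_bigr => w _ /=.
    by rewrite big_split /= sumr_const mulr_natl.
  rewrite lhsE rhsE SLE in pairs.
  set SA := \sum_(s in A) (deg_star e s)%:R in pairs *.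
  set X := \sum_(w in L) (adjdeg e w A)%:R in pairs cross.
  have c1 : (3/4 + mu) * n * X <= 2 * n * (kappa * n ^+ 2).
    apply: ler_pM => //; rewrite ?mulr_ge0 ?addr_ge0 ?sumr_ge0 //; try lra.
    by rewrite ler_pM2r //; lra.
  have c2 : 2 * n * (kappa * n ^+ 2) <= 128 * kappa / (mu * rho) * n ^+ 2 * #|L|%:R.
    apply: (@le_trans _ _ (128 * kappa / (mu * rho) * n ^+ 2 * (mu * rho / 64 * n))); last first.
      by rewrite ler_wpM2l // mulr_ge0 // exprn_ge0 // ltW.
    rewrite le_eqVlt; apply/orP; left; apply/eqP; field; rewrite !gt_eqF //.
  rewrite -(ler_pM2l L0); move: pairs c1 c2.
  set E := 128 * kappa / (mu * rho) * n ^+ 2.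
  clearbody E SA X; lra.
have BE : B = (B :\: low e mu) :|: L by rewrite /L setUC setID.
have -> : \sum_(w in B) (deg_star e w)%:R = \sum_(w in B :\: low e mu) (deg_star e w)%:R + SL.
  rewrite (bigID (mem (low e mu))) /= addrC /SL; congr (_ + _); apply: eq_bigl => w.
    by rewrite in_setD andbC.
  by rewrite in_setI.
have cB : #|B|%:R = #|L|%:R + #|B :\: low e mu|%:R :> R by rewrite -natrD cardsID.
have := high_sum_ge B; rewrite SLE cB.
have : 0 <= 128 * kappa / (mu * rho) * n ^+ 2 by rewrite mulr_ge0 // exprn_ge0 // ltW.
lra.
Qed.
End Low.

Section GoodEdges.
Variables (R : realFieldType) (V : finType) (e : rel V) (mu rho kappa : R).
Variables (A B : {set V}) (H : rel V).
Local Notation n := (#|V|%:R : R).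
Local Notation h := ((3/4 + mu) / 2).
Hypotheses (ds : dense_setting e mu rho A B).
Hypothesis (hk : 0 <= kappa <= (mu * rho) ^+ 2 / 4096).

Lemma few_low_sum (C : {set V}) : #|C :&: low e mu|%:R < mu * rho / 64 * n ->
  #|C|%:R * n * h - mu * rho / 64 * n ^+ 2 <= \sum_(s in C) (deg_star e s)%:R.
Proof.
move=> hl; apply: (@le_trans _ _ (\sum_(w in C :\: low e mu) (deg_star e w)%:R)); last first.
  rewrite [leRHS](bigID (mem (low e mu))) /= addrC.
  rewrite (eq_bigl (fun i => (i \in C) && (i \notin low e mu))) ?lerDl ?sumr_ge0 //.
  by move=> i; rewrite in_setD andbC.
apply: le_trans (high_sum_ge e mu C).
have -> : #|C|%:R = #|C :&: low e mu|%:R + #|C :\: low e mu|%:R :> R by rewrite -natrD cardsID.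
have n0 := ds_n ds; have /andP[m0 m1] := ds_mu ds.
have : #|C :&: low e mu|%:R * n * h <= mu * rho / 64 * n * n.
  apply: (@le_trans _ _ (#|C :&: low e mu|%:R * n)); last by rewrite ler_pM2r // ltW.
  by rewrite ler_piMr ?mulr_ge0 //; lra.
lra.
Qed.

Lemma good_edges_contradiction : good_edges e mu kappa A B H -> False.
Proof.
move=> ge; have ge' := good_edges_sym ge; have ds' := dense_setting_sym ds.
have [hB|hB] := lerP (mu * rho / 64 * n) #|B :&: low e mu|%:R; first exact: many_low_contradiction ds ge hk hB.
have [hA|hA] := lerP (mu * rho / 64 * n) #|A :&: low e mu|%:R; first exact: many_low_contradiction ds' ge' hk hA.
have /andP[p0 p1] := mu_rho_bounds ds; have [k1 k2] := kappa_small ds hk.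
have /andP[r0 r1] := ds_rho ds.
(* With few low vertices on both sides they are a mere error term, so the deficit is 0 and the low
   set is taken empty. *)
apply: (@core_contradiction R V e A B H mu rho kappa (mu * rho / 64) 0 h set0
  (ds_ori ds) (ds_disj ds) (ds_mu ds) r0 (ds_A ds) (ds_B ds) (ds_n ds) (ds_rest ds)
  (ge_ldeg ge) (ge_rdeg ge) (ge_sum ge) (ge_lost ge) (ge_lost ge')) => //.
- by lra.
- by field.
- exact: sub0set.
- by move=> s w _; rewrite inE.
- by rewrite addr0; exact: few_low_sum.
by rewrite mul0r mul0r subr0; exact: few_low_sum.
Qed.
End GoodEdges.

Section Sparse.
Variables (R : realFieldType) (V : finType) (e : rel V) (mu rho : R) (A B : {set V}).
Local Notation n := (#|V|%:R : R).
Hypotheses (ds : dense_setting e mu rho A B).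

(** The empty relation serves as the set of good edges: all cross edges then count as lost. *)
Lemma sparse_contradiction :
  \sum_(s in A) (adjdeg e s B)%:R <= (mu * rho) ^+ 2 / 4096 * n ^+ 2 -> False.
Proof.
move=> h; apply: (@good_edges_contradiction R V e mu rho ((mu * rho) ^+ 2 / 4096) A B (fun _ _ => false)) => //.
  by rewrite lexx andbT divr_ge0 ?sqr_ge0.
split=> //; apply: le_trans h _; rewrite lerDr sumr_ge0 //.
Qed.
End Sparse.

(** * Typical cross edges when adjacent vertices of one part have few common neighbours in the
    other *)

Section Typical.
Variables (R : realFieldType) (V : finType) (e : rel V) (mu rho eps : R) (A B : {set V}) (K : nat).
Local Notation n := (#|V|%:R : R).
Local Notation Gr := (mu / 16 * n).
Local Notation tri := (triangles (adj e) (adj e) (adj e) A B).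
Hypotheses (ds : dense_setting e mu rho A B) (eps0 : 0 < eps).
Hypothesis HK : forall s t, s \in A -> t \in A -> adj e s t -> (#|nbrs e s :&: nbrs e t :&: B| <= K)%N.
Hypothesis K_small : (K + 1)%:R <= eps ^+ 2 / 2 * n.
Hypothesis alpha_small : (alpha e)%:R <= eps ^+ 2 / 2 * n.
Hypothesis tri_small : tri%:R <= eps ^+ 2 / 2 * n ^+ 3.
Hypothesis n_large : 1 <= eps ^+ 2 / 2 * n.

Definition bad_left (w : V) : {set V} :=
  [set s in A | adj e s w && ((codeg e w B)%:R + Gr < 2 * (adjdeg e s B)%:R)].
Definition bad_right (s : V) : {set V} :=
  [set w in B | adj e s w && ((codeg e s A)%:R + Gr < 2 * (adjdeg e w A)%:R)].

(** By [matching_bound] the vertices of [U = bad_left w] have on average hardly more than half of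
    the non-neighbours of [w] in [B] as neighbours. Their other neighbours in [B] are adjacent to
    [w] and close triangles. Since each vertex of [U] exceeds that half by more than [Gr / 2], there
    are few of them. *)
Lemma bad_left_card w : w \in B ->
  #|bad_left w|%:R * Gr <= #|bad_left w|%:R * K%:R +
    2 * (\sum_(z in B) \sum_(s in A) (adj e w z && adj e z s && adj e s w))%:R + 2 * (alpha e)%:R * n.
Proof.
move=> wB; set U := bad_left w; set tw := (\sum_(z in B) _)%N.
have UA s : s \in U -> s \in A by rewrite inE => /andP[].
have := @matching_bound _ _ (ds_ori ds) U (B :\: nbrs e w) K.
have HK' s t : s \in U -> t \in U -> adj e s t -> (#|nbrs e s :&: nbrs e t :&: (B :\: nbrs e w)| <= K)%N.
  move=> /UA sA /UA tA st; apply: leq_trans (HK sA tA st).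
  by apply/subset_leq_card/setIS/subsetDl.
move=> /(_ HK') M.
have split : (\sum_(s in U) adjdeg e s B <= \sum_(s in U) adjdeg e s (B :\: nbrs e w) + tw)%N.
  have t1 : (\sum_(s in U) adjdeg e s (B :&: nbrs e w) <= tw)%N.
    rewrite /tw exchange_big /= [leqRHS](bigID (mem U)) /=; apply: leq_trans (leq_addr _ _).
    rewrite [leqRHS](eq_bigl (mem U)); last first.
      by move=> s /=; case: (boolP (s \in U)) => [/UA->|]; rewrite ?andbF.
    apply: leq_sum => s sU; have sw : adj e s w by move: sU; rewrite inE => /and3P[].
    rewrite -card_set_sum; apply/subset_leq_card/subsetP => z; rewrite !inE sw andbT.
    by move=> /and3P[sz -> wz]; rewrite wz adj_sym.
  apply: (@leq_trans (\sum_(s in U) (adjdeg e s (B :\: nbrs e w) + adjdeg e s (B :&: nbrs e w)))).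
    apply: leq_sum => s _; rewrite /adjdeg -(cardsID (nbrs e w) (nbrs e s :&: B)) addnC.
    apply: leq_add; apply/subset_leq_card/subsetP => z; rewrite !inE.
      by move=> /and3P[-> -> ->].
    by move=> /andP[/andP[-> ->] ->].
  by rewrite big_split leq_add2l.
have low : #|U|%:R * ((codeg e w B)%:R + Gr) <= 2 * (\sum_(s in U) adjdeg e s B)%:R.
  rewrite natr_sum mulr_sumr mulr_natl -sumr_const; apply: ler_sum => s.
  by rewrite inE => /and3P[_ _ /ltW].
move: split; rewrite -(ler_nat R) natrD => split.
move: M; rewrite -(ler_nat R) !(natrD, natrM) -/(codeg e w B) => M.
have cn : (alpha e)%:R * (codeg e w B)%:R <= (alpha e)%:R * n.
  by rewrite ler_wpM2l // ler_nat max_card.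
lra.
Qed.

(** Now the pairing takes place among the non-neighbours of [s] in [A], with edges counted into
    [U = bad_right s]. A neighbour of [s] in [A] has at most [K] neighbours in [U], as [s] is
    adjacent to all of [U]. *)
Lemma bad_right_card s : s \in A ->
  #|bad_right s|%:R * Gr <= 3 * K%:R * n + 2 * (alpha e)%:R * n.
Proof.
move=> sA; set U := bad_right s.
have UB w : w \in U -> w \in B by rewrite inE => /andP[].
have := @matching_bound _ _ (ds_ori ds) (A :\: nbrs e s) U K.
have HK' t t' : t \in A :\: nbrs e s -> t' \in A :\: nbrs e s -> adj e t t' ->
    (#|nbrs e t :&: nbrs e t' :&: U| <= K)%N.
  move=> /setDP[tA _] /setDP[t'A _] tt'; apply: leq_trans (HK tA t'A tt').
  by apply/subset_leq_card/setIS/subsetP.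
move=> /(_ HK') M.
have symU : (\sum_(w in U) adjdeg e w A = \sum_(t in A) adjdeg e t U)%N.
  rewrite (eq_bigr (fun w => \sum_(t in A) adj e w t)%N).
    rewrite exchange_big; apply: eq_bigr => w _; rewrite adjdeg_sum; apply: eq_bigr => t _.
    by rewrite adj_sym.
  by move=> w _; rewrite adjdeg_sum.
have split : (\sum_(w in U) adjdeg e w A <= \sum_(t in A :\: nbrs e s) adjdeg e t U + #|A| * K)%N.
  rewrite symU (bigID (mem (nbrs e s))) /= addnC; apply: leq_add.
    by rewrite [leqRHS](eq_bigl (fun t => (t \in A) && (t \notin nbrs e s))) // => t; rewrite in_setD andbC.
  apply: (@leq_trans (\sum_(t in A | t \in nbrs e s) K)); last first.
    rewrite sum_nat_cond_const leq_mul2r; apply/orP; right.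
    by apply/subset_leq_card/subsetP => t; rewrite inE => /andP[].
  apply: leq_sum => t /andP[tA]; rewrite inE => st; apply: leq_trans (HK sA tA st).
  apply/subset_leq_card/subsetP => w; rewrite !inE => /and3P[-> -> /andP[-> _]]; by [].
have low : #|U|%:R * ((codeg e s A)%:R + Gr) <= 2 * (\sum_(w in U) adjdeg e w A)%:R.
  rewrite natr_sum mulr_sumr mulr_natl -sumr_const; apply: ler_sum => w.
  by rewrite inE => /and3P[_ _ /ltW].
move: split; rewrite -(ler_nat R) natrD natrM => split.
move: M; rewrite -(ler_nat R) !(natrD, natrM) -/(codeg e s A) => M.
have K0 : 0 <= K%:R :> R by [].
have c1 : (alpha e)%:R * #|U|%:R <= (alpha e)%:R * n by rewrite ler_wpM2l // card_le_n.
have c2 : #|A|%:R * K%:R <= n * K%:R :> R by rewrite ler_wpM2r // card_le_n.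
have c3 : (codeg e s A)%:R * K%:R <= n * K%:R :> R by rewrite ler_wpM2r // card_le_n.
lra.
Qed.

Lemma bad_total :
  (\sum_(w in B) #|bad_left w|)%:R + (\sum_(s in A) #|bad_right s|)%:R <= 80 * eps ^+ 2 / mu * n ^+ 2.
Proof.
have n0 := ds_n ds; have /andP[m0 m1] := ds_mu ds.
have Kn : K%:R <= eps ^+ 2 / 2 * n by apply: le_trans K_small; rewrite ler_nat leq_addr.
have ha := alpha_small.
have l1 : (\sum_(w in B) #|bad_left w|)%:R * Gr <= 5 * (eps ^+ 2 / 2) * n ^+ 3.
  rewrite natr_sum mulr_suml.
  apply: (@le_trans _ _ (\sum_(w in B) (eps ^+ 2 / 2 * n * n + 2 * (\sum_(z in B) \sum_(s in A) (adj e w z && adj e z s && adj e s w))%:R +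
     2 * (eps ^+ 2 / 2 * n) * n))).
    apply: ler_sum => w wB; apply: le_trans (bad_left_card wB) _.
    apply: lerD; last by rewrite ler_pM2r // ler_wpM2l.
    rewrite lerD2r.
    apply: (@le_trans _ _ (n * K%:R)); first by apply: ler_wpM2r => //; apply: card_le_n.
    by rewrite -[leRHS]mulrC; apply: ler_wpM2l => //; apply: ltW.
  have sumc (c : R) : \sum_(w in B) c = #|B|%:R * c by rewrite sumr_const mulr_natl.
  rewrite !big_split /= !sumc.
  have -> : \sum_(w in B) 2 * (\sum_(z in B) \sum_(s in A) (adj e w z && adj e z s && adj e s w))%:R
     = 2 * tri%:R :> R by rewrite /triangles natr_sum mulr_sumr.
  have e2 : 0 <= eps ^+ 2 / 2 * n * n.
    by apply: mulr_ge0 => //; apply: mulr_ge0 => //; apply: divr_ge0 => //; apply: sqr_ge0.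
  have Bn : eps ^+ 2 / 2 * n * n * #|B|%:R <= eps ^+ 2 / 2 * n * n * n.
    by apply: ler_wpM2l => //; apply: card_le_n.
  have ht := tri_small.
  lra.
have l2 : (\sum_(s in A) #|bad_right s|)%:R * Gr <= 5 * (eps ^+ 2 / 2) * n ^+ 3.
  rewrite natr_sum mulr_suml.
  apply: (@le_trans _ _ (\sum_(s in A) (5 * (eps ^+ 2 / 2 * n) * n))).
    apply: ler_sum => s sA; apply: le_trans (bad_right_card sA) _.
    have : K%:R * n <= eps ^+ 2 / 2 * n * n by rewrite ler_pM2r.
    have : (alpha e)%:R * n <= eps ^+ 2 / 2 * n * n by rewrite ler_pM2r.
    lra.
  rewrite sumr_const -[leLHS]mulr_natr.
  have e2 : 0 <= 5 * (eps ^+ 2 / 2 * n) * n.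
    by do 3! [apply: mulr_ge0 => //]; apply: divr_ge0 => //; apply: sqr_ge0.
  have := ler_wpM2l e2 (card_le_n R A).
  lra.
have Gr0 : 0 < Gr by apply: mulr_gt0 => //; apply: divr_gt0.
rewrite -(ler_pM2r Gr0) mulrDl.
have -> : 80 * eps ^+ 2 / mu * n ^+ 2 * Gr = 5 * eps ^+ 2 * n ^+ 3 by field; rewrite gt_eqF.
lra.
Qed.

Lemma low_left_total : (\sum_(s in A :&: low e mu) adjdeg e s B)%:R <= 2 * eps * n ^+ 2.
Proof.
apply: (@pigeonhole R V (A :&: low e mu) B (nbrs e) K eps eps0).
  move=> x y /setIP[xA xl] /setIP[yA yl] xy; apply: HK => //.
  exact: low_adj (ds_ore ds) xl yl xy.
apply: le_trans K_small _; rewrite ler_pM2r ?(ds_n ds) //.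
by rewrite ler_pdivrMr // ler_peMr ?sqr_ge0 // ler1n.
Qed.

(** [HK] concerns pairs in [A] only, so triangles replace it: two low vertices of [B] are adjacent,
    and a common neighbour in [A] makes them a triangle. The squared degrees thus sum to at most
    [tri] plus the diagonal. *)
Lemma low_right_total : (\sum_(w in B :&: low e mu) adjdeg e w A)%:R <= 2 * eps * n ^+ 2.
Proof.
set L := B :&: low e mu.
have -> : (\sum_(w in L) adjdeg e w A = \sum_(s in A) adjdeg e s L)%N.
  rewrite (eq_bigr (fun w => \sum_(t in A) adj e w t)%N).
    rewrite exchange_big; apply: eq_bigr => w _; rewrite adjdeg_sum; apply: eq_bigr => t _.
    by rewrite adj_sym.
  by move=> w _; rewrite adjdeg_sum.
apply: sum_le_squares_eps => //.
have sq : (\sum_(s in A) adjdeg e s L ^ 2 <= #|V| * #|V| + tri)%N.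
  have -> : (\sum_(s in A) adjdeg e s L ^ 2 = \sum_(w in L) \sum_(z in L) \sum_(s in A) (adj e z s && adj e s w))%N.
    rewrite (eq_bigr (fun s => \sum_(w in L) \sum_(z in L) (adj e z s && adj e s w))%N).
      rewrite exchange_big; apply: eq_bigr => w _; by rewrite exchange_big.
    move=> s _; rewrite adjdeg_sum expnS expn1 big_distrl; apply: eq_bigr => w _ /=.
    rewrite big_distrr; apply: eq_bigr => z _ /=.
    by rewrite mulnb andbC (adj_sym e z).
  have LB w : w \in L -> w \in B by case/setIP.
  apply: (@leq_trans (\sum_(w in L) (#|V| + \sum_(z in B) \sum_(s in A) (adj e w z && adj e z s && adj e s w)))%N).
    apply: leq_sum => w wL; rewrite (bigD1 w) //=; apply: leq_add.
      by rewrite -card_set_sum max_card.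
    rewrite [leqRHS](bigID (fun z => (z \in L) && (z != w))) /=; apply: leq_trans (leq_addr _ _).
    rewrite [leqRHS](eq_bigl (fun z => (z \in L) && (z != w))); last first.
      by move=> z /=; case: (boolP (z \in L)) => [/LB->|_] //=; rewrite andbF.
    apply: leq_sum => z /andP[zL zw]; apply: leq_sum => s _.
    have [[_ wl] [_ zl]] := (setIP wL, setIP zL).
    by rewrite (low_adj (ds_ore ds) wl zl) // eq_sym.
  rewrite big_split /=; apply: leq_add; first by rewrite sum_nat_const leq_mul2r max_card orbT.
  rewrite /triangles [leqRHS](bigID (mem L)) /=; apply: leq_trans (leq_addr _ _).
  rewrite [leqRHS](eq_bigl (mem L)) //.
  by move=> z /=; case: (boolP (z \in L)) => [/LB->|_] //=; rewrite andbF.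
apply: (@le_trans _ _ (#|V| * #|V| + tri)%:R); first by rewrite ler_nat.
rewrite natrD natrM; have n0 := ds_n ds.
have ht := tri_small; have : n * n <= eps ^+ 2 / 2 * n ^+ 3.
  have := ler_wpM2r (ltW (mulr_gt0 n0 n0)) n_large; lra.
lra.
Qed.

(** The conditions use the full cross degrees; the degrees counted in typical edges are smaller, so
    the bounds required by [good_edges] follow without circularity. *)
Definition typical (s w : V) : bool :=
  [&& adj e s w, 2 * (adjdeg e s B)%:R <= (codeg e w B)%:R + Gr,
      2 * (adjdeg e w A)%:R <= (codeg e s A)%:R + Gr, s \notin low e mu & w \notin low e mu].

Lemma typical_lost :
  (\sum_(s in A) adjdeg e s B <= \sum_(s in A) rdeg B typical s + \sum_(w in B) #|bad_left w|
    + \sum_(s in A) #|bad_right s| + \sum_(s in A :&: low e mu) adjdeg e s B +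
    \sum_(w in B :&: low e mu) adjdeg e w A)%N.
Proof.
have e1 : (\sum_(s in A) rdeg B typical s = \sum_(s in A) \sum_(w in B) typical s w)%N.
  by apply: eq_bigr => s _; rewrite /rdeg card_set_sum.
have e2 : (\sum_(w in B) #|bad_left w| = \sum_(s in A) \sum_(w in B)
    (adj e s w && ((codeg e w B)%:R + Gr < 2 * (adjdeg e s B)%:R)%R))%N.
  by rewrite exchange_big; apply: eq_bigr => w _; rewrite /bad_left card_set_sum.
have e3 : (\sum_(s in A) #|bad_right s| = \sum_(s in A) \sum_(w in B)
    (adj e s w && ((codeg e s A)%:R + Gr < 2 * (adjdeg e w A)%:R)%R))%N.
  by apply: eq_bigr => s _; rewrite /bad_right card_set_sum.
have e4 : (\sum_(s in A :&: low e mu) adjdeg e s B = \sum_(s in A) \sum_(w in B) ((s \in low e mu) && adj e s w))%N.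
  rewrite [RHS](bigID (mem (low e mu))) /= [X in (_ + X)%N]big1 ?addn0; last first.
    by move=> s /andP[_ /negbTE->]; rewrite big1.
  apply: eq_big => [s|s /setIP[_ ->]]; first by rewrite in_setI.
  by rewrite adjdeg_sum.
have e5 : (\sum_(w in B :&: low e mu) adjdeg e w A = \sum_(s in A) \sum_(w in B) ((w \in low e mu) && adj e s w))%N.
  rewrite exchange_big [RHS](bigID (mem (low e mu))) /= [X in (_ + X)%N]big1 ?addn0; last first.
    by move=> s /andP[_ /negbTE->]; rewrite big1.
  apply: eq_big => [s|s /setIP[_ ->]]; first by rewrite in_setI.
  by rewrite adjdeg_sum; apply: eq_bigr => t _; rewrite adj_sym.
rewrite e1 e2 e3 e4 e5 -!big_split; apply: leq_sum => s _ /=.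
rewrite -!big_split [leqLHS]adjdeg_sum; apply: leq_sum => w _ /=.
rewrite /typical !leNgt.
move: (adj e s w) ((codeg e w B)%:R + Gr < 2 * (adjdeg e s B)%:R)
  ((codeg e s A)%:R + Gr < 2 * (adjdeg e w A)%:R) (s \in low e mu) (w \in low e mu).
by do 5! case.
Qed.

Lemma typical_contradiction : 80 * eps ^+ 2 / mu + 4 * eps <= (mu * rho) ^+ 2 / 4096 -> False.
Proof.
move=> hbud; have n0 := ds_n ds; have /andP[m0 m1] := ds_mu ds.
have edges s w : s \in A -> w \in B -> typical s w ->
    (rdeg B typical s <= adjdeg e s B)%N /\ (ldeg A typical w <= adjdeg e w A)%N.
  move=> sA wB _; split; apply/subset_leq_card/subsetP => z; rewrite !inE /typical.
    by move=> /and3P[-> ->].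
  by move=> /and3P[-> h _]; rewrite adj_sym h.
apply: (good_edges_contradiction ds (kappa := (mu * rho) ^+ 2 / 4096) (H := typical)).
  by rewrite lexx andbT divr_ge0 ?sqr_ge0.
split.
- move=> s w sA wB sw; have [_] := edges _ _ sA wB sw; rewrite -(ler_nat R) => h.
  by case/and5P: sw => _ _ h2 _ _; lra.
- move=> s w sA wB sw; have [+ _] := edges _ _ sA wB sw; rewrite -(ler_nat R) => h.
  by case/and5P: sw => _ h2 _ _ _; lra.
- move=> s w sA wB sw; have [] := edges _ _ sA wB sw; rewrite -!(ler_nat R) => h1 h2.
  (* As neither end is low, the two star degrees sum to at least [(3/4 + mu) * n]. Each is at most
     the degree inside the own part plus the cross degree plus the rest. By [h3] and [h4] the
     degrees inside fall short of the sizes of the parts by twice the cross degrees, up to [Gr], so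
     the cross degrees sum to at most a quarter of [n]. *)
  case/and5P: sw => _ h3 h4; rewrite !inE -!leNgt => h5 h6.
  have d1 := deg_star_split e s A B; have d2 := deg_star_split e w B A.
  have := leq_trans d1 (leq_add (leq_add (star_in_le e s A) (leqnn _)) (leqnn _)).
  have := leq_trans d2 (leq_add (leq_add (star_in_le e w B) (leqnn _)) (leqnn _)).
  rewrite -!(ler_nat R) !natrD [B :|: A]setUC => d2' d1'.
  have a1 : (adjdeg e s A)%:R + (codeg e s A)%:R = #|A|%:R :> R by rewrite -natrD adjdeg_codeg.
  have a2 : (adjdeg e w B)%:R + (codeg e w B)%:R = #|B|%:R :> R by rewrite -natrD adjdeg_codeg.
  have cardAB : #|A|%:R + #|B|%:R + #|~: (A :|: B)|%:R = n.
    rewrite -!natrD; congr _%:R; rewrite -(cardsC (A :|: B)) cardsU.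
    by have := ds_disj ds; rewrite -setI_eq0 => /eqP->; rewrite cards0 subn0.
  have hr := ds_rest ds.
  have mn : 0 < mu * n by rewrite mulr_gt0.
  lra.
- by move=> s w sA wB /and5P[? _ _ ? ?].
have := typical_lost; rewrite -(ler_nat R) !natrD -!natr_sum => hl.
apply: le_trans hl _; rewrite -!addrA lerD2l.
have b1 := bad_total; have b2 := low_left_total; have b3 := low_right_total.
have : (80 * eps ^+ 2 / mu + 4 * eps) * n ^+ 2 <= (mu * rho) ^+ 2 / 4096 * n ^+ 2.
  by rewrite ler_pM2r ?exprn_gt0.
lra.
Qed.
End Typical.

(** * Coloured copies *)

Section Classes.
Variables (R : realFieldType) (ell : nat) (c : rel 'I_ell) (V : finType) (e : rel V).
Variables (A B : {set V}) (C : finType) (f : V -> C).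
Hypotheses (cyc : cycle_orientation c) (ndir : ~ directed_cycle c) (ori : oriented e).
Hypotheses (l3 : (3 <= ell)%N) (dAB : [disjoint A & B]).
Definition colour_class (X : {set V}) (y : C) : {set V} := [set w in X | f w == y].
Local Notation Y y := (colour_class B y).
Hypothesis no_copies : forall y, ~ (copy1 c e A (Y y) /\ copy2 c e A (Y y)).
Local Notation n := (#|V|%:R : R).

Lemma colour_class_sub X y : colour_class X y \subset X.
Proof. by apply/subsetP => w; rewrite inE => /andP[]. Qed.

Lemma disjoint_class y : [disjoint A & Y y].
Proof. by apply: disjointWr dAB; apply: colour_class_sub. Qed.

Lemma card_colours (Z : {set V}) : Z \subset B -> #|Z| = (\sum_y #|Z :&: Y y|)%N.
Proof.
move=> ZB; rewrite -sum1_card (partition_big f predT) //=; apply: eq_bigr => y _.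
rewrite -sum1_card; apply: eq_bigl => w; rewrite !inE.
by case: (boolP (w \in Z)) => //= /(subsetP ZB)->.
Qed.

Lemma common_nbrs_small : one_source c e -> forall s t, s \in A -> t \in A -> adj e s t ->
  (#|nbrs e s :&: nbrs e t :&: B| <= #|C| * (4 * (thr ell e + ell)))%N.
Proof.
move=> [a [b [ba ab l4 S]]] s t sA tA st; rewrite card_colours; last exact: subsetIr.
rewrite -sum_nat_const; apply: leq_sum => y _; rewrite leqNgt; apply/negP => h.
have ZE : nbrs e s :&: nbrs e t :&: B :&: Y y = [set z in Y y | adj e s z && adj e t z].
  by apply/setP => z; rewrite !inE; case: (adj e s z); case: (adj e t z); case: (z \in B); case: (f z == y).
rewrite ZE in h; apply: (no_copies (y := y)); split; last first.
  exact: (common_nbh_copy2 ori ba ab l4 S (disjoint_class y) sA tA st h).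
have hs : (#|[set z in Y y | adj e s z && adj e t z]| <= #|nbh e true s (Y y)| + #|nbh e false s (Y y)|)%N.
  apply: leq_trans (leq_card_setU _ _); apply/subset_leq_card/subsetP => z; rewrite !inE /adj /dir.
  by move=> /and3P[/andP[-> ->] /orP[->|->] _]; rewrite ?orbT.
have [h1|h1] := ltnP (thr ell e) #|nbh e true s (Y y)|; first exact: copy1_of_nbh sA h1.
have h2 : (thr ell e < #|nbh e false s (Y y)|)%N by move: h hs h1; lia.
exact: copy1_of_nbh sA h2.
Qed.

Lemma cross_sparse (eps : R) : ~ one_source c e -> 0 < eps <= 1 ->
  (thr ell e + ell + 1)%:R <= eps ^+ 2 * n ->
  \sum_(s in A) (adjdeg e s B)%:R <= #|C|%:R * (4 * eps * n ^+ 2).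
Proof.
move=> no /andP[e0 e1] ht.
have -> : #|C|%:R * (4 * eps * n ^+ 2) = \sum_(y : C) (4 * eps * n ^+ 2) by rewrite sumr_const mulr_natl.
apply: (@le_trans _ _ (\sum_(y : C) \sum_(s in A) (#|nbh e true s (Y y)| + #|nbh e false s (Y y)|)%:R)).
  rewrite exchange_big; apply: ler_sum => s sA; rewrite -natr_sum ler_nat /adjdeg card_colours ?subsetIr //.
  apply: leq_sum => y _; apply: leq_trans (leq_card_setU _ _); apply/subset_leq_card/subsetP => z.
  by rewrite !inE /adj /dir => /and3P[/andP[/orP[->|->] _] -> ->]; rewrite ?orbT.
apply: ler_sum => y _.
have hd d := @sparse_pair R ell c V e cyc ndir ori A (Y y) (disjoint_class y) (no_copies (y := y)) d eps l3 no e0 ht e1.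
have h1 := hd true; have h2 := hd false; rewrite natr_sum in h1; rewrite natr_sum in h2.
under eq_bigr => s _ do rewrite natrD.
by rewrite big_split /=; lra.
Qed.
End Classes.

Lemma leq_threshold (k t l x : nat) : (x <= k * (4 * (t + l)) \/ x <= t \/ x = 0)%N ->
  (x + 1 <= (4 * k + 1) * (t + l + 1))%N.
Proof.
have : (t <= t + l)%N by rewrite leq_addr.
move: (t + l)%N => y ty h.
have -> : ((4 * k + 1) * (y + 1) = k * (4 * y) + (4 * k + y + 1))%N by rewrite (mulnCA k 4); lia.
by move: h; rewrite (mulnCA k 4); move: (k * y)%N => z; lia.
Qed.

(** * Constants and the contradiction from missing copies *)

Section Contradiction.
Variables (R : realFieldType) (mu rho : R) (k : nat).
Hypotheses (mu0 : 0 < mu <= 1) (rho0 : 0 < rho <= 1).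

(* [tri_eps] bounds the density of triangles; [copy_eps] the size of vertex
   sets without long oriented paths. *)
Definition tri_eps : R := mu * (mu * rho) ^+ 2 / (1024 * 512).
Definition cross_eps : R := (mu * rho) ^+ 2 / (4 * 4096 * k.+1%:R).
Definition copy_eps : R := Num.min (tri_eps ^+ 2 / (2 * (4 * k + 1)%:R)) (cross_eps ^+ 2).

Lemma murho : 0 < mu * rho <= 1.
Proof.
by case/andP: mu0 => m0 m1; case/andP: rho0 => r0 r1; rewrite mulr_gt0 //= mulr_ile1 // ltW.
Qed.

Lemma murho2 : 0 < (mu * rho) ^+ 2 <= 1.
Proof. by case/andP: murho => m0 m1; rewrite exprn_gt0 //= expr_le1 // ltW. Qed.

Lemma tri_eps_gt0 : 0 < tri_eps.
Proof.
by case/andP: murho2 => m0 m1; case/andP: mu0 => ? ?; rewrite /tri_eps; apply: divr_gt0 => //; apply: mulr_gt0.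
Qed.

Lemma tri_eps_le : tri_eps <= mu.
Proof.
have /andP[m0 m1] := murho2; have /andP[n0 n1] := mu0.
rewrite /tri_eps ler_pdivrMr; last by lra.
apply: (@le_trans _ _ mu); first by rewrite ger_pMr.
by rewrite ler_peMr //; lra.
Qed.

Lemma cross_eps_gt0 : 0 < cross_eps <= 1.
Proof.
have /andP[m0 m1] := murho2; have p : 1 <= (k.+1)%:R :> R by rewrite ler1n.
rewrite /cross_eps; move: (k.+1%:R) p => kk p.
have kp : 0 < 4 * 4096 * kk by lra.
by rewrite divr_gt0 //= ler_pdivrMr //; lra.
Qed.

Lemma copy_eps_gt0 : 0 < copy_eps.
Proof.
have /andP[c0 _] := cross_eps_gt0; have t0 := tri_eps_gt0.
by rewrite lt_min exprn_gt0 ?andbT // divr_gt0 ?exprn_gt0 // mulr_gt0 // ltr0n addn1.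
Qed.

(** Copies are excluded only for each colour class of [B] separately, as the mergers require; this
    costs a factor [#|C|]. The triangle bound stays a hypothesis because its source differs: missing
    copies for a single colour, missing mergers for several. *)
Theorem no_copies_contradiction (ell : nat) (c : rel 'I_ell) (V : finType) (e : rel V)
    (A B : {set V}) (C : finType) (f : V -> C) :
  cycle_orientation c -> ~ directed_cycle c -> (3 <= ell)%N ->
  dense_setting e mu rho A B -> (#|C| <= k)%N ->
  (thr ell e + ell + 1)%:R <= copy_eps * #|V|%:R ->
  (forall y, ~ (copy1 c e A (colour_class f B y) /\ copy2 c e A (colour_class f B y))) ->
  (one_source c e -> (triangles (adj e) (adj e) (adj e) A B)%:R <= tri_eps ^+ 2 / 2 * #|V|%:R ^+ 3) ->
  False.
Proof.
move=> cyc ndir l3 ds Ck hthr NC ht.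
have t0 := tri_eps_gt0; have tm := tri_eps_le; have /andP[c0 c1] := cross_eps_gt0.
have n0 := ds_n ds; have /andP[p0 p1] := murho2; have /andP[m0 m1] := mu0.
have [one|no] := boolp.pselect (one_source c e); last first.
  have h1 : (thr ell e + ell + 1)%:R <= cross_eps ^+ 2 * #|V|%:R.
    by apply: le_trans hthr _; rewrite ler_pM2r // ge_min lexx orbT.
  apply: (sparse_contradiction ds).
  apply: le_trans (cross_sparse cyc ndir (ds_ori ds) l3 (ds_disj ds) NC no _ h1) _.
    by rewrite c0.
  rewrite [leLHS](_ : _ = 4 * cross_eps * #|C|%:R * #|V|%:R ^+ 2); last by ring.
  rewrite ler_pM2r ?exprn_gt0 //.
  apply: (@le_trans _ _ (4 * cross_eps * k.+1%:R)).
    apply: ler_wpM2l; first by lra.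
    by rewrite ler_nat; apply: leq_trans Ck _.
  have : k.+1%:R != 0 :> R by rewrite pnatr_eq0.
  by rewrite /cross_eps; move: (k.+1%:R) => kk kk0; rewrite le_eqVlt; apply/orP; left; apply/eqP; field.
have h1 : (4 * k + 1)%:R * (thr ell e + ell + 1)%:R <= tri_eps ^+ 2 / 2 * #|V|%:R.
  have k41 : 0 < (4 * k + 1)%:R :> R by rewrite ltr0n addn1.
  rewrite mulrC -ler_pdivlMr //; apply: le_trans hthr _.
  apply: (@le_trans _ _ (tri_eps ^+ 2 / (2 * (4 * k + 1)%:R) * #|V|%:R)).
    by rewrite ler_pM2r // ge_min lexx.
  have : (4 * k + 1)%:R != 0 :> R by rewrite pnatr_eq0 addn1.
  by move: ((4 * k + 1)%:R) => kk kk0; rewrite le_eqVlt; apply/orP; left; apply/eqP; field.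
rewrite -natrM in h1.
have hC := common_nbrs_small cyc ndir (ds_ori ds) l3 (ds_disj ds) NC one.
apply: (@typical_contradiction R V e mu rho tri_eps A B (#|C| * (4 * (thr ell e + ell))) ds t0 hC) => //.
- apply: le_trans h1; rewrite ler_nat; apply: leq_threshold; left.
  by rewrite leq_mul2r Ck orbT.
- apply: le_trans h1; rewrite ler_nat; apply: (@leq_trans (thr ell e + 1)).
    rewrite /thr mulnA -addnA; apply: (@leq_trans (ell * ell.*2.+1 * alpha e)); last exact: leq_addr.
    by apply: leq_pmull; rewrite muln_gt0 andbT; apply: leq_trans l3.
  by apply: leq_threshold; right; left.
- exact: ht.
- apply: le_trans h1; rewrite -[leLHS]/(1%:R) ler_nat -[X in (X <= _)%N]add0n.
  by apply: leq_threshold; right; right.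
(* This turns the requirement into a bound on [84 * tri_eps], and 84 is less than
   [1024 * 512 / 4096 = 128]. *)
have h2 : 80 * tri_eps ^+ 2 / mu <= 80 * tri_eps.
  rewrite ler_pdivrMr // -mulrA ler_pM2l // expr2 ler_pM2l //.
have h3 : tri_eps <= (mu * rho) ^+ 2 / (1024 * 512).
  have : mu * (mu * rho) ^+ 2 <= (mu * rho) ^+ 2 by rewrite ger_pMl.
  by rewrite /tri_eps; move: ((mu * rho) ^+ 2) => X; lra.
lra.
Qed.
End Contradiction.

(** * The robust vector *)

Section TriangleBound.
Variables (R : realFieldType) (ell : nat) (c : rel 'I_ell) (V : finType) (e : rel V).
Variables (A B : {set V}).
Hypotheses (cyc : cycle_orientation c) (ndir : ~ directed_cycle c) (ori : oriented e).
Hypotheses (dAB : [disjoint A & B]) (no2 : ~ copy2 c e A B).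
Local Notation n := (#|V|%:R : R).

(** Directed paths from [B] through [A] to [B]. A triangle that is cyclic, or transitive with its
    middle vertex in [A], contains one. *)
Definition through : nat := \sum_(w in B) \sum_(s in nbh e true w A) #|nbh e true s B|.

Lemma triangles_middle_through :
  (triangles (dir e true) (dir e false) (dir e false) A B <= through)%N.
Proof.
apply: leq_sum => w wB; rewrite exchange_big /= [leqLHS](bigID (mem (nbh e true w A))) /=.
rewrite [X in (_ + X)%N]big1 ?addn0; last first.
  move=> s /andP[sA]; rewrite inE sA /= => /negbTE ws; rewrite big1 // => z _.
  by rewrite ws andbF.
rewrite (eq_bigl (mem (nbh e true w A))); last first.
  by move=> s /=; rewrite inE; case: (s \in A).
apply: leq_sum => s /setIdP[sA ws]; rewrite -card_set_sum.
by apply/subset_leq_card/subsetP => z; rewrite !inE /= => /and3P[-> /andP[_ ->] _].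
Qed.

Lemma triangles_cyclic_through :
  (triangles (dir e true) (dir e true) (dir e true) A B <= through)%N.
Proof.
rewrite /triangles exchange_big; apply: leq_sum => w wB.
rewrite exchange_big /= [leqLHS](bigID (mem (nbh e true w A))) /=.
rewrite [X in (_ + X)%N]big1 ?addn0; last first.
  move=> s /andP[sA]; rewrite inE sA /= => /negbTE ws; rewrite big1 // => z _.
  by rewrite ws andbF.
rewrite (eq_bigl (mem (nbh e true w A))); last first.
  by move=> s /=; rewrite inE; case: (s \in A).
apply: leq_sum => s /setIdP[sA ws]; rewrite -card_set_sum.
by apply/subset_leq_card/subsetP => z; rewrite !inE /= => /and3P[-> /andP[_ _] ->].
Qed.

Lemma through_small a b (eps : R) : (0 < b <= a)%N -> (a + b = ell)%N ->
  spells c e (nseq a true ++ nseq b false) -> (1 < b)%N -> 0 < eps ->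
  (thr ell e + 1)%:R <= eps ^+ 2 * n -> through%:R <= 2 * eps * n ^+ 3.
Proof.
move=> ba ab S b1 e0 ht; rewrite /through natr_sum.
apply: (@le_trans _ _ (\sum_(w in B) (2 * eps * n ^+ 2))).
  apply: ler_sum => w wB.
  have E s : nbh e true s B = [set y | e s y] :&: B by apply/setP => y; rewrite !inE andbC.
  under eq_bigr => s _ do rewrite E.
  apply: (pigeonhole (K := thr ell e)) => // x y.
  rewrite !inE => /andP[xA wx] /andP[yA wy] xy.
  have l4 : (4 <= ell)%N by lia.
  have := @through_paths _ c _ e ori a b ba ab l4 S A B dAB no2 w x y b1 wB xA yA xy wx wy.
  by rewrite !E setIACA setIid.
rewrite sumr_const -[leLHS]mulr_natr.
have -> : 2 * eps * n ^+ 3 = 2 * eps * n ^+ 2 * n by ring.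
apply: ler_wpM2l; last exact: card_le_n.
by apply: mulr_ge0; [apply: mulr_ge0 => //; apply: ltW | apply: exprn_ge0].
Qed.

(** Triangles with the vertex of [A] as source or sink are bounded by [triangles_center] in every
    case. The other two kinds are bounded in the same way for [b = 1], and through directed paths
    for [b > 1]. *)
Lemma triangles_small (eps : R) : one_source c e -> 0 < eps ->
  (thr ell e + 1)%:R <= eps ^+ 2 * n ->
  (triangles (adj e) (adj e) (adj e) A B)%:R <= 16 * (thr ell e)%:R * n ^+ 2 + 8 * eps * n ^+ 3.
Proof.
move=> [a [b [ba ab l4 S]]] e0 ht.
have T := triangles_adj e A B; rewrite -(ler_nat R) in T; apply: le_trans T _.
have -> : forall i j k l, (2 * (i + j + k + l))%:R = 2 * (i%:R + j%:R + k%:R + l%:R) :> R.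
  by move=> i j k l; rewrite natrM !natrD.
have n0 : 0 <= n by [].
have t0 : 0 <= (thr ell e)%:R * n ^+ 2 :> R by apply: mulr_ge0 => //; apply: exprn_ge0.
have en : 0 <= eps * n ^+ 3 by apply: mulr_ge0; [apply: ltW | apply: exprn_ge0].
have T1 := triangles_source ori ba ab l4 S dAB no2.
have T2 := triangles_sink ori ba ab l4 S dAB no2.
move: T1 T2; rewrite -!(ler_nat R) !natrM => T1 T2.
have [b1|b2] := leqP b 1.
  have bE : b = 1%N by lia.
  have T3 := triangles_middle ori ba ab l4 S dAB no2 bE.
  have T4 := triangles_cyclic ori ba ab l4 S dAB no2 bE.
  move: T3 T4; rewrite -!(ler_nat R) !natrM => T3 T4.
  lra.
have F := through_small ba ab S b2 e0 ht.
have T3 := triangles_middle_through; have T4 := triangles_cyclic_through.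
move: T3 T4; rewrite -!(ler_nat R) => T3 T4.
lra.
Qed.
End TriangleBound.

Section Copy2.
Variables (R : realFieldType) (mu rho : R).
Hypotheses (mu0 : 0 < mu <= 1) (rho0 : 0 < rho <= 1).

(** With the factors 64 and 32, each of the two terms in [triangles_small] is at most
    [tri_eps ^+ 2 / 4] times the cube of the order. *)
Definition copy2_eps : R :=
  Num.min (copy_eps mu rho 1) (Num.min (tri_eps mu rho ^+ 2 / 64) ((tri_eps mu rho ^+ 2 / 32) ^+ 2)).

Lemma copy2_eps_gt0 : 0 < copy2_eps.
Proof.
have t0 := tri_eps_gt0 mu0 rho0; have c0 := copy_eps_gt0 1 mu0 rho0.
by rewrite /copy2_eps lt_min c0 /= lt_min; apply/andP; split; rewrite ?exprn_gt0 ?divr_gt0 ?exprn_gt0.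
Qed.

Theorem copy2_exists (ell : nat) (c : rel 'I_ell) (V : finType) (e : rel V) (A B : {set V}) :
  cycle_orientation c -> ~ directed_cycle c -> (3 <= ell)%N -> dense_setting e mu rho A B ->
  (thr ell e + ell + 1)%:R <= copy2_eps * #|V|%:R -> copy2 c e A B.
Proof.
move=> cyc ndir l3 ds ht; apply: boolp.contrapT => no2.
have n0 := ds_n ds; have t0 := tri_eps_gt0 mu0 rho0.
have le1 (x : R) : copy2_eps <= x -> (thr ell e + ell + 1)%:R <= x * #|V|%:R.
  by move=> h; apply: le_trans ht _; rewrite ler_pM2r.
have h1 : (thr ell e + ell + 1)%:R <= copy_eps mu rho 1 * #|V|%:R.
  by apply: le1; rewrite /copy2_eps ge_min lexx.
have h2 : (thr ell e + ell + 1)%:R <= tri_eps mu rho ^+ 2 / 64 * #|V|%:R.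
  by apply: le1; rewrite /copy2_eps ge_min [X in _ || X]ge_min lexx orbT.
have h3 : (thr ell e + ell + 1)%:R <= (tri_eps mu rho ^+ 2 / 32) ^+ 2 * #|V|%:R.
  by apply: le1; rewrite /copy2_eps ge_min [X in _ || X]ge_min lexx !orbT.
have BE : colour_class (fun _ : V => tt) B tt = B by apply/setP => x; rewrite inE eqxx andbT.
apply: (@no_copies_contradiction R mu rho 1 mu0 rho0 ell c V e A B unit (fun _ => tt)) => //.
- by rewrite card_unit.
- by case; rewrite BE => -[].
move=> one.
have e0 : 0 < tri_eps mu rho ^+ 2 / 32 by rewrite divr_gt0 // exprn_gt0.
have h3' : (thr ell e + 1)%:R <= (tri_eps mu rho ^+ 2 / 32) ^+ 2 * #|V|%:R.
  by apply: le_trans h3; rewrite ler_nat leq_add2r leq_addr.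
apply: le_trans (triangles_small (ds_ori ds) (ds_disj ds) no2 one e0 h3') _.
have h2' : (thr ell e)%:R <= tri_eps mu rho ^+ 2 / 64 * #|V|%:R.
  by apply: le_trans h2; rewrite ler_nat -addnA leq_addr.
have n2 : 0 < (#|V|%:R : R) ^+ 2 by rewrite exprn_gt0.
have := ler_wpM2r (ltW n2) h2'; lra.
Qed.
End Copy2.

Section Robust.
Variables (R : realType) (mu : R).

Lemma sigma_ore_condition (V : finType) (e : rel V) :
  (((3 / 4 + mu) * #|V|%:R)%:E <= sigma_ore R e)%E -> ore_condition e mu.
Proof.
move=> h x y xy nxy; rewrite -lee_fin; apply: le_trans h _.
have := @Order.TotalTheory.bigmin_le_cond _ _ (V * V)%type +oo%E (x, y)
  (fun p : V * V => [&& p.1 != p.2, ~~ e p.1 p.2 & ~~ e p.2 p.1])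
  (fun p => ((deg_star e p.1 + deg_star e p.2)%:R : R)%:E).
rewrite /= natrD; apply; by rewrite xy -negb_or.
Qed.

Lemma copy_card (ell : nat) (c : rel 'I_ell) (V : finType) (e : rel V) S :
  is_copy c e S -> #|S| = ell.
Proof. by case=> g [gi _ ->]; rewrite card_imset // card_ord. Qed.

(** Deleting [W] leaves at least [rho] times the order in each part, by the factor 2 in
    [non_negligible]. The vertices then missing lie outside [V1] or in [W], so [dense_setting] holds
    for what remains. *)
Theorem robust_vector (rho eta : R) (ell : nat) (c : rel 'I_ell) (V : finType) (e : rel V)
    (V1 A B : {set V}) :
  cycle_orientation c -> ~ directed_cycle c -> (3 <= ell)%N -> oriented e ->
  0 < mu <= 1 -> 0 < rho <= 1 -> (0 < #|V|)%N -> ore_condition e mu ->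
  #|~: V1|%:R <= eta * #|V|%:R -> eta + rho <= mu / 16 ->
  (thr ell e + ell + 1)%:R <= copy2_eps mu rho * #|V|%:R ->
  bipartition V1 A B -> non_negligible rho A -> non_negligible rho B ->
  robust c e V1 rho 2 (ell - 2) A B.
Proof.
move=> cyc ndir l3 ori mu0 rho0 V0 ore heta hbud hthr [ABE dAB] nA nB W WV hW.
have dis : [disjoint A :\: W & B :\: W].
  by apply: disjointWl (subsetDl _ _) (disjointWr (subsetDl _ _) dAB).
have big (X : {set V}) : non_negligible rho X -> rho * #|V|%:R <= #|X :\: W|%:R.
  rewrite /non_negligible => h; have := cardsID W X => /(congr1 (fun k => k%:R : R)); rewrite natrD.
  have : #|X :&: W|%:R <= #|W|%:R :> R by rewrite ler_nat subset_leq_card // subsetIr.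
  lra.
have [|s [t [l [[sA tA] lB us cp]]]] := @copy2_exists R mu rho mu0 rho0 ell c V e (A :\: W) (B :\: W) cyc ndir l3 _ hthr.
  split=> //; [exact: big | exact: big | by rewrite ltr0n |].
  apply: (@le_trans _ _ (#|~: V1|%:R + #|W|%:R)).
    rewrite -natrD ler_nat; apply: leq_trans (leq_card_setU _ _); apply/subset_leq_card.
    by rewrite -setDUl ABE setCD.
  apply: (@le_trans _ _ ((eta + rho) * #|V|%:R)); first by rewrite mulrDl lerD.
  by rewrite ler_pM2r // ltr0n.
exists [set z in [:: s, t & l]]; have cS := copy_card cp.
have sl : size l = (ell - 2)%N.
  by move: cS; rewrite cardsE (card_uniqP us) /= => cE; rewrite -cE subn2.
have /setDP[sA' sW] := sA; have /setDP[tA' tW] := tA.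
have lB' z : z \in l -> z \in B /\ z \notin W by move=> /lB /setDP[].
have nAB z : z \in B -> z \notin A by move=> zB; rewrite (disjointFl dAB).
have ul : uniq l by case/and3P: us.
have st : s != t by move: us; rewrite /= inE negb_or => /andP[/andP[]].
split=> //.
- apply/subsetP => z; rewrite in_setD -ABE in_setU !inE => /or3P[/eqP->|/eqP->|/lB'[zB zW]].
  + by rewrite sW sA'.
  + by rewrite tW tA'.
  + by rewrite zW zB orbT.
- rewrite (_ : _ :&: A = [set s; t]) ?cards2 ?st //; apply/setP => z; rewrite !inE.
  apply/idP/idP => [/andP[/or3P[->|->|zl] zA]|/orP[/eqP->|/eqP->]]; rewrite ?orbT //.
  + by have [/nAB] := lB' _ zl; rewrite zA.
  + by rewrite eqxx sA'.
  + by rewrite eqxx orbT tA'.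
rewrite (_ : _ :&: B = [set z in l]); first by rewrite cardsE (card_uniqP ul).
apply/setP => z; rewrite !inE; apply/idP/idP => [/andP[/or3P[/eqP zE|/eqP zE|//] zB]|zl].
- by move: (nAB _ zB); rewrite zE sA'.
- by move: (nAB _ zB); rewrite zE tA'.
by rewrite zl !orbT; have [] := lB' _ zl.
Qed.
End Robust.

(** * Exchanging vertices between copies *)

Section Factors.
Variables (ell : nat) (c : rel 'I_ell) (V : finType) (e : rel V).

Lemma is_copy_factor S : is_copy c e S -> has_factor c e S.
Proof.
move=> cS; exists [set S]; rewrite cover1; split=> //; split; first exact: trivIset1.
by move=> S' /set1P->.
Qed.

Lemma has_factorU (A B : {set V}) : [disjoint A & B] -> has_factor c e A -> has_factor c e B ->
  has_factor c e (A :|: B).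
Proof.
move=> dAB [F [[tF cF] FA]] [G [[tG cG] GB]]; exists (F :|: G); split; last first.
  by rewrite /cover bigcup_setU -/(cover F) -/(cover G) FA GB.
split; last by move=> S /setUP[/cF|/cG].
by rewrite trivIsetU // FA GB.
Qed.

Lemma has_factor0 : has_factor c e set0.
Proof.
exists set0; split; last by rewrite /cover big_set0.
by split; [apply/trivIsetP => A B; rewrite inE|move=> S; rewrite inE].
Qed.

Variables (R : realType) (V1 : {set V}) (q : R) (t : nat).
Local Notation reach := (reachable c e V1 q t).

(** The pairs are exchanged one after the other, each time avoiding [W], the other pairs and the
    sets already chosen. One exchange uses up at most [t * ell + 2] vertices of the allowance
    [q]. *)
Lemma exchange_chain (ps : seq (V * V)) (W : {set V}) :
  uniq (unzip1 ps ++ unzip2 ps) -> {subset unzip1 ps ++ unzip2 ps <= V1} ->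
  (forall p, p \in ps -> reach p.1 p.2) ->
  (#|W| + size ps * (t * ell + 2))%:R <= q ->
  exists Q : {set V}, [/\ Q \subset V1, [disjoint Q & W :|: [set z in unzip1 ps ++ unzip2 ps]],
    (#|Q| <= size ps * (t * ell))%N,
    has_factor c e ([set z in unzip1 ps] :|: Q) & has_factor c e ([set z in unzip2 ps] :|: Q)].
Proof.
elim: ps W => [|[x y] ps IH] W ups sps rps szq.
  exists set0; rewrite sub0set disjoints_subset sub0set cards0 setU0 set_nil.
  by split=> //; apply: has_factor0.
have pu : perm_eq (unzip1 ((x, y) :: ps) ++ unzip2 ((x, y) :: ps)) [:: x, y & unzip1 ps ++ unzip2 ps].
  by rewrite /= perm_cons; apply/permEl/(perm_catCA (unzip1 ps) [:: y]).
have := ups; rewrite (perm_uniq pu) /= in_cons negb_or => /and3P[/andP[xy xps] yps ups'].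
have sps' z : z \in [:: x, y & unzip1 ps ++ unzip2 ps] -> z \in V1.
  by rewrite -(perm_mem pu) => /sps.
(* [reachable] only admits sets inside [V1] that miss [x] and [y]. *)
set W' := (W :|: [set z in unzip1 ps ++ unzip2 ps]) :&: V1 :\: [set x; y].
have szL : (#|[set z in unzip1 ps ++ unzip2 ps]| <= 2 * size ps)%N.
  by apply: leq_trans (card_set_seq _) _; rewrite size_cat !size_map; lia.
have W'q : #|W'|%:R <= q.
  apply: le_trans szq; rewrite ler_nat; apply: (@leq_trans #|W :|: [set z in unzip1 ps ++ unzip2 ps]|).
    by apply/subset_leq_card/subsetP => z; rewrite !inE => /and3P[].
  apply: leq_trans (leq_card_setU _ _) _; rewrite leq_add2l; apply: leq_trans szL _.
  by rewrite mulnC leq_mul //= addnC.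
have [|Q []] := rps (x, y) (mem_head _ _) W' _ W'q.
  by rewrite /=; apply/subsetP => z; rewrite !inE => /and3P[-> _ ->].
move=> QV Qt Qx Qy.
have Qd z : z \in Q -> [/\ z \in V1, z \notin W, z != x, z != y & z \notin unzip1 ps ++ unzip2 ps].
  move=> /(subsetP QV) /setDP[zV]; rewrite in_setU in_set2 /= !negb_or => /and3P[h zx zy].
  by move: h; rewrite in_setD in_set2 negb_or zx zy in_setI zV andbT in_setU in_set /= andbT negb_or => /andP[-> ->].
have [|//||Q2 [Q2V Q2d Q2t Q2x Q2y]] := IH (W :|: [set x; y] :|: Q) ups'.
- by move=> z zL; apply: sps'; rewrite !in_cons zL !orbT.
- by move=> p pp; apply: rps; rewrite in_cons pp orbT.
- apply: le_trans szq; rewrite ler_nat.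
  have h1 := (leq_card_setU (W :|: [set x; y]) Q).1; have h2 := (leq_card_setU W [set x; y]).1.
  have h3 : (#|[set x; y]| <= 2)%N by rewrite cards2; case: eqP.
  by rewrite /= mulSn; lia.
have Q2d' z : z \in Q2 -> [/\ z \notin W, z != x, z != y, z \notin Q & z \notin unzip1 ps ++ unzip2 ps].
  by move=> /(disjointFr Q2d); rewrite !inE => /negbT; rewrite !negb_or -!andbA => /and5P[-> -> -> -> ->].
exists (Q :|: Q2); split.
- by rewrite subUset Q2V andbT; apply/subsetP => z /Qd[].
- rewrite disjoints_subset; apply/subsetP => z; rewrite in_setU => zQ; rewrite in_setC in_setU in_set (perm_mem pu) !in_cons.
  case/orP: zQ; first by case/Qd => _ /negbTE-> /negbTE-> /negbTE-> /negbTE->.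
  by case/Q2d' => /negbTE-> /negbTE-> /negbTE-> _ /negbTE->.
- by apply: leq_trans (leq_card_setU _ _) _; rewrite /= mulSn leq_add // ltnW.
- rewrite [unzip1 _]/= set_cons (_ : _ :|: _ = (x |: Q) :|: ([set z in unzip1 ps] :|: Q2)); last first.
    by apply/setP => z; rewrite !inE -!orbA; do !bool_congr; rewrite orbCA.
  apply: has_factorU => //; rewrite disjoints_subset; apply/subsetP => z /setU1P[->|zQ]; rewrite !inE negb_or.
    by move: xps; rewrite mem_cat negb_or => /andP[-> _]; apply/negP => /Q2d'[_]; rewrite eqxx.
  have [_ _ _ _] := Qd _ zQ; rewrite mem_cat negb_or => /andP[-> _].
  by apply/negP => /Q2d'[_ _ _]; rewrite zQ.
- rewrite [unzip2 _]/= set_cons (_ : _ :|: _ = (y |: Q) :|: ([set z in unzip2 ps] :|: Q2)); last first.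
    by apply/setP => z; rewrite !inE -!orbA; do !bool_congr; rewrite orbCA.
  apply: has_factorU => //; rewrite disjoints_subset; apply/subsetP => z /setU1P[->|zQ]; rewrite !inE negb_or.
    by move: yps; rewrite mem_cat negb_or => /andP[_ ->]; apply/negP => /Q2d'[_ _]; rewrite eqxx.
  have [_ _ _ _] := Qd _ zQ; rewrite mem_cat negb_or => /andP[_ ->].
  by apply/negP => /Q2d'[_ _ _]; rewrite zQ.
Qed.

(* Swapping [x] for [y]: the copy [S1] is completed by exchanging [x :: S2]
   for [y :: S1] vertex by vertex. *)
Lemma merge_reachable (ps : seq (V * V)) (S1 S2 : seq V) x y (W : {set V}) :
  is_copy c e [set z in S1] -> is_copy c e [set z in S2] ->
  perm_eq (unzip1 ps) (x :: S2) -> perm_eq (unzip2 ps) (y :: S1) ->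
  uniq ([:: x, y & S1] ++ S2) -> {subset [:: x, y & S1] ++ S2 <= V1} ->
  (forall p, p \in ps -> reach p.1 p.2) ->
  (forall z, z \in S1 ++ S2 -> z \notin W) ->
  (#|W| + size ps * (t * ell + 2))%:R <= q ->
  exists Q : {set V}, [/\ Q \subset V1 :\: (W :|: [set x; y]),
    (#|Q| <= size S1 + size S2 + size ps * (t * ell))%N,
    has_factor c e (x |: Q) & has_factor c e (y |: Q)].
Proof.
move=> c1 c2 p1 p2 uS sS rps wS szq.
have pS : perm_eq (unzip1 ps ++ unzip2 ps) ([:: x, y & S1] ++ S2).
  apply: (@perm_trans _ ((x :: S2) ++ (y :: S1))); first exact: perm_cat.
  by rewrite /= perm_cons perm_catC.
have [| |//|//|Q [QV Qd Qt Qx Qy]] := @exchange_chain ps W.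
- by rewrite (perm_uniq pS).
- by move=> z; rewrite (perm_mem pS) => /sS.
have Qd' z : z \in Q -> [/\ z \notin W, z != x, z != y, z \notin S1 & z \notin S2].
  move=> /(disjointFr Qd); rewrite in_setU in_set (perm_mem pS) mem_cat !in_cons => /negbT.
  by rewrite !negb_or -!andbA => /and5P[-> -> -> -> ->].
move: uS; rewrite cat_uniq => /and3P[/= /andP[]].
rewrite in_cons negb_or => /andP[xy xS1] /andP[yS1 uS1] hS _.
have nS2 z : z \in [:: x, y & S1] -> z \notin S2.
  by move=> zS; apply: contraNN hS => zS2; apply/hasP; exists z.
have xS2 := nS2 x (mem_head _ _); have yS2 : y \notin S2 by apply: nS2; rewrite !in_cons eqxx orbT.
exists ([set z in S1] :|: [set z in S2] :|: Q); split.
- apply/subsetP => z zQ; rewrite in_setD in_setU !inE !negb_or.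
  have [zS|zS] := boolP (z \in S1 ++ S2).
    rewrite (wS _ zS) sS /=; last by rewrite /= !in_cons zS !orbT.
    rewrite andbT; apply/andP; split; apply: contraTneq zS => ->; rewrite mem_cat negb_or ?xS1 ?yS1 //=.
  have zQ' : z \in Q by move: zQ zS; rewrite !inE mem_cat => /orP[->|].
  by have [-> -> -> _ _] := Qd' _ zQ'; rewrite (subsetP QV).
- apply: leq_trans (leq_card_setU _ _) _; apply: leq_add => //.
  apply: leq_trans (leq_card_setU _ _) _; apply: leq_add; exact: card_set_seq.
- rewrite (_ : _ |: _ = [set z in S1] :|: ([set z in unzip1 ps] :|: Q)); last first.
    apply/setP => z; rewrite !in_setU in_set1 !inE (perm_mem p1) !in_cons.
    by case: (z == x); case: (z \in S1); case: (z \in S2).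
  apply: has_factorU => //; last exact: is_copy_factor.
  rewrite disjoints_subset; apply/subsetP => z; rewrite inE => zS; rewrite !inE (perm_mem p1) in_cons !negb_or.
  apply/andP; split; last by apply/negP => /Qd'[_ _ _]; rewrite zS.
  apply/andP; split; first by apply: contraNneq xS1 => <-.
  by apply: nS2; rewrite !in_cons zS !orbT.
- rewrite (_ : _ |: _ = [set z in S2] :|: ([set z in unzip2 ps] :|: Q)); last first.
    apply/setP => z; rewrite !in_setU in_set1 !inE (perm_mem p2) !in_cons.
    by case: (z == y); case: (z \in S1); case: (z \in S2).
  apply: has_factorU => //; last exact: is_copy_factor.
  rewrite disjoints_subset; apply/subsetP => z; rewrite inE => zS; rewrite !inE (perm_mem p2) in_cons !negb_or.
  apply/andP; split; last by apply/negP => /Qd'[_ _ _ _]; rewrite zS.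
  apply/andP; split; first by apply: contraNneq yS2 => <-.
  by apply: contraL zS => zS1; apply: nS2; rewrite !in_cons zS1 !orbT.
Qed.
End Factors.

(** * Merging closed classes *)

Lemma subset_cat_avoid (V : finType) (x y : V) (S1 S2 : seq V) (W : {set V}) :
  x != y -> uniq S1 -> uniq S2 -> (forall z, z \in S1 -> z \notin W :|: [set x; y]) ->
  (forall z, z \in S2 -> z \notin W :|: [set x; y] :|: [set w in S1]) ->
  uniq ([:: x, y & S1] ++ S2) /\ forall z, z \in S1 ++ S2 -> z \notin W.
Proof.
move=> xy u1 u2 h1 h2; split; last first.
  by move=> z; rewrite mem_cat => /orP[/h1|/h2]; rewrite !in_setU !negb_or; [case/andP|case/andP => /andP[]].
rewrite cat_uniq u2 andbT /= in_cons negb_or xy u1 andbT /=.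
have n1 z : z \in [set x; y] -> z \notin S1.
  by move=> zxy; apply/negP => /h1; rewrite in_setU zxy orbT.
rewrite !n1 ?set21 ?set22 //=; apply/hasPn => z /h2.
by rewrite !in_setU !in_set1 in_set !in_cons !negb_or => /andP[/and3P[_ -> ->] ->].
Qed.

Section Merging.
Variables (R : realType) (ell : nat) (c : rel 'I_ell) (V : finType) (e : rel V) (V1 : {set V}).
Variables (K : finType) (f : V -> K).
Hypothesis (l3 : (3 <= ell)%N).
Local Notation U y := (colour_class f V1 y).

Definition coloured_closed (q : R) (t : nat) : Prop := forall x y,
  x \in V1 -> y \in V1 -> x != y -> f x = f y -> reachable c e V1 q t x y.

Definition linked1 (q : R) (x y : K) : Prop :=
  forall W : {set V}, #|W|%:R <= q -> copy1 c e (U x :\: W) (U y :\: W).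

Definition linked2 (q : R) (x y : K) : Prop :=
  forall W : {set V}, #|W|%:R <= q -> copy2 c e (U x :\: W) (U y :\: W).

(* In both cases two copies have index vectors that differ by moving one vertex
   from the class of [x] to the class of [y]. *)
Definition mergeable (q : R) (x y : K) : Prop :=
  (exists z, linked1 q x z /\ linked1 q y z) \/ (linked1 q x y /\ linked2 q x y).

(** The exchanging set consists of two copies and the sets of [ell + 1] exchanges; the summand 3
    instead of 2 makes the size bound strict. The cost in [merge_cost] counts [x], [y], the two
    copies and the allowance of these exchanges. *)
Definition merge_step (t : nat) : nat := ((ell + 1) * t + 3)%N.
Definition merge_cost (t : nat) : nat := (2 + 2 * ell + (ell + 1) * (t * ell + 2))%N.

Variables (q : R) (t : nat).
Hypotheses (Cq : coloured_closed q t) (tq : (merge_cost t)%:R <= q / 2).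

Lemma copy_size (S : seq V) : uniq S -> is_copy c e [set z in S] -> size S = ell.
Proof. by move=> uS /copy_card; rewrite cardsE => <-; apply/esym/card_uniqP. Qed.

Lemma merge_pairs (ps : seq (V * V)) (S1 S2 : seq V) x y (W : {set V}) :
  is_copy c e [set z in S1] -> is_copy c e [set z in S2] ->
  perm_eq (unzip1 ps) (x :: S2) -> perm_eq (unzip2 ps) (y :: S1) ->
  x != y -> x \in V1 -> y \in V1 -> uniq S1 -> uniq S2 -> {subset S1 ++ S2 <= V1} ->
  (forall z, z \in S1 -> z \notin W :|: [set x; y]) ->
  (forall z, z \in S2 -> z \notin W :|: [set x; y] :|: [set w in S1]) ->
  all (fun p => f p.1 == f p.2) ps -> #|W|%:R <= q / 2 ->
  exists Q : {set V}, [/\ Q \subset V1 :\: (W :|: [set x; y]), (#|Q| < merge_step t * ell)%N,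
    has_factor c e (x |: Q) & has_factor c e (y |: Q)].
Proof.
move=> c1 c2 p1 p2 xy xV yV u1 u2 sV a1 a2 fps Wq.
have [uS aS] := subset_cat_avoid xy u1 u2 a1 a2.
have sS z : z \in [:: x, y & S1] ++ S2 -> z \in V1.
  by rewrite /= !in_cons => /or3P[/eqP->|/eqP->|/sV].
have szp : size ps = (ell + 1)%N.
  by have := perm_size p1; rewrite size_map /= (copy_size u2 c2) addn1.
have up : uniq (unzip1 ps ++ unzip2 ps).
  rewrite (perm_uniq (_ : perm_eq _ ((x :: S2) ++ (y :: S1)))); last exact: perm_cat.
  rewrite (perm_uniq (_ : perm_eq _ ([:: x, y & S1] ++ S2))) //.
  by rewrite /= perm_cons perm_catC.
have [||Q [QV Qt Qx Qy]] := @merge_reachable ell c V e R V1 q t ps S1 S2 x y W c1 c2 p1 p2 uS sS _ aS.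
- move=> p pp; have h1 : p.1 \in unzip1 ps by apply: map_f.
  have h2 : p.2 \in unzip2 ps by apply: map_f.
  apply: Cq.
  + by apply: sS; move: h1; rewrite (perm_mem p1) mem_cat !in_cons => /orP[->|->]; rewrite ?orbT.
  + apply: sS; move: h2; rewrite (perm_mem p2) mem_cat !in_cons => /orP[->|->]; rewrite ?orbT //.
  + move: up; rewrite cat_uniq => /and3P[_ /hasPn h _].
    by apply: contraTneq (h _ h2) => <-; rewrite h1.
  + by apply/eqP; move/allP: fps; apply.
- rewrite szp natrD; move: tq; rewrite /merge_cost natrD.
  have : 0 <= (2 + 2 * ell)%:R :> R by [].
  by lra.
exists Q; split=> //; apply: leq_ltn_trans Qt _.
rewrite szp (copy_size u1 c1) (copy_size u2 c2) /merge_step mulnA [ltnRHS]mulnDl.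
by move: l3 ((ell + 1) * t * ell)%N; clear; lia.
Qed.

Lemma colour_classDP (k : K) (W : {set V}) z : z \in U k :\: W -> [/\ z \in V1, f z = k & z \notin W].
Proof. by case/setDP => /setIdP[-> /eqP->]. Qed.

Lemma zip_seq_colours (l l' : seq V) (k : K) : (forall z, z \in l -> f z = k) -> (forall z, z \in l' -> f z = k) ->
  all (fun p => f p.1 == f p.2) (zip l l').
Proof.
elim: l l' => [|a l IH] [|b l'] //= h h'; rewrite h ?mem_head // h' ?mem_head // eqxx /=.
by apply: IH => z zl; [apply: h|apply: h']; rewrite in_cons zl orbT.
Qed.

Lemma add_cardU (A B : {set V}) (a : R) : #|A|%:R <= a -> (#|B| <= 2 * ell + 2)%N -> a + (merge_cost t)%:R <= q ->
  #|A :|: B|%:R <= q.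
Proof.
move=> ha hb; apply: le_trans; apply: (@le_trans _ _ (#|A| + #|B|)%:R).
  by rewrite ler_nat; apply: leq_card_setU.
rewrite natrD lerD // ler_nat; apply: leq_trans hb _.
by rewrite /merge_cost addnC leq_addr.
Qed.

(** One half of the allowance is for [W], the other for the copies and the exchanges. The second
    copy is chosen off the first. *)
Lemma mergeable_reachable k1 k2 x y : mergeable q k1 k2 -> x \in V1 -> y \in V1 -> x != y ->
  f x = k1 -> f y = k2 -> reachable c e V1 (q / 2) (merge_step t) x y.
Proof.
move=> mg xV yV xy fx fy W _ Wq.
have bound (S : seq V) : (size S <= ell)%N -> #|W :|: [set x; y] :|: [set w in S]|%:R <= q.
  move=> szS; rewrite -setUA; apply: (add_cardU Wq); last by have h := tq; lra.
  apply: leq_trans (leq_card_setU _ _) _; have h1 := card_set_seq S.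
  have : (#|[set x; y]| <= 2)%N by rewrite cards2; case: eqP.
  by move: h1 szS; clear; lia.
have b0 : #|W :|: [set x; y]|%:R <= q.
  by have := bound [::] isT; rewrite set_nil setU0.
have inV k Z (l : seq V) : {subset l <= U k :\: Z} -> {subset l <= V1}.
  by move=> lU z /lU /colour_classDP[].
have inf k Z (l : seq V) : {subset l <= U k :\: Z} -> forall z, z \in l -> f z = k.
  by move=> lU z /lU /colour_classDP[].
have notZ k Z (l : seq V) : {subset l <= U k :\: Z} -> forall z, z \in l -> z \notin Z.
  by move=> lU z /lU /colour_classDP[].
case: mg => [[z [L1 L2]]|[L1 L2]].
  have [a [l [aU lU ul cl]]] := L1 _ b0.
  have [b [l' [bU l'U ul' cl']]] := L2 _ (bound (a :: l) (eq_leq (copy_size ul cl))).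
  have [aV fa aW] := colour_classDP aU; have [bV fb bW] := colour_classDP bU.
  have sz := copy_size ul cl; have sz' := copy_size ul' cl'.
  have szll : size l = size l' by apply/eqP; rewrite -eqSS -/(size (a :: l)) -/(size (b :: l')) sz sz'.
  (* The copies differ only in one vertex, [a] in the class of [x] against [b] in that of [y]; all
     remaining vertices share a class and are matched in list order. *)
  apply: (@merge_pairs ((x, a) :: (b, y) :: zip l' l) (a :: l) (b :: l') x y W) => //.
  - by rewrite /= /unzip1 -/(unzip1 (zip l' l)) unzip1_zip // szll.
  - rewrite /= /unzip2 -/(unzip2 (zip l' l)) unzip2_zip ?szll //.
    exact/permEl/(perm_catCA [:: a] [:: y]).
  - by move=> w; rewrite mem_cat !in_cons => /orP[] /orP[/eqP->//|]; [apply: (inV _ _ _ lU)|apply: (inV _ _ _ l'U)].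
  - by move=> w; rewrite in_cons => /orP[/eqP->//|]; apply: (notZ _ _ _ lU).
  - by move=> w; rewrite in_cons => /orP[/eqP->//|]; apply: (notZ _ _ _ l'U).
  - by rewrite /= fx fa fb fy !eqxx; apply: (zip_seq_colours (inf _ _ _ l'U) (inf _ _ _ lU)).
have [s [s' [l [[sU s'U] lU ul cl]]]] := L2 _ b0.
have [a [l' [aU l'U ul' cl']]] := L1 _ (bound [:: s, s' & l] (eq_leq (copy_size ul cl))).
have [aV fa aW] := colour_classDP aU; have [sV fs sW] := colour_classDP sU.
have [s'V fs' s'W] := colour_classDP s'U.
have sz := copy_size ul cl; have sz' := copy_size ul' cl'.
case: l' => [|b l'] in l'U ul' cl' sz' *; first by have h3 := l3; exfalso; move: h3; rewrite -sz'.
have [bV fb bW] := colour_classDP (l'U _ (mem_head _ _)).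
have l'U' : {subset l' <= U k2 :\: (W :|: [set x; y] :|: [set w in [:: s, s' & l]])}.
  by move=> w wl; apply: l'U; rewrite in_cons wl orbT.
have szll : size l = size l'.
  by apply/eqP; rewrite -eqSS -eqSS -/(size [:: s, s' & l]) -/(size [:: a, b & l']) sz sz'.
(* The copies have two vertices and one vertex in the class of [x]. Adding [x] to the latter and [y]
   to the former makes the class counts equal. *)
apply: (@merge_pairs [:: (x, s), (a, s'), (b, y) & zip l' l] [:: s, s' & l] [:: a, b & l'] x y W) => //.
- by rewrite /= /unzip1 -/(unzip1 (zip l' l)) unzip1_zip // szll.
- rewrite /= /unzip2 -/(unzip2 (zip l' l)) unzip2_zip ?szll //.
  exact/permEl/(perm_catCA [:: s; s'] [:: y]).
- move=> w; rewrite mem_cat !in_cons -!orbA => /or4P[/eqP->//|/eqP->//|/(inV _ _ _ lU)//|].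
  by move=> /or3P[/eqP->//|/eqP->//|/(inV _ _ _ l'U')].
- by move=> w; rewrite !in_cons => /or3P[/eqP->//|/eqP->//|/(notZ _ _ _ lU)].
- by move=> w; rewrite !in_cons => /or3P[/eqP->//|/eqP->//|/(notZ _ _ _ l'U')].
- by rewrite /= fx fs fa fs' fb fy !eqxx; apply: (zip_seq_colours (inf _ _ _ l'U') (inf _ _ _ lU)).
Qed.
End Merging.

Section Copies.
Variables (ell : nat) (c : rel 'I_ell) (V : finType) (e : rel V).

Lemma copy1S (X X' Y Y' : {set V}) : X \subset X' -> Y \subset Y' -> copy1 c e X Y -> copy1 c e X' Y'.
Proof.
move=> /subsetP XX /subsetP YY [a [l [aX lY ul cl]]]; exists a, l; split=> //; first exact: XX.
by move=> z /lY /YY.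
Qed.

Lemma copy2S (X X' Y Y' : {set V}) : X \subset X' -> Y \subset Y' -> copy2 c e X Y -> copy2 c e X' Y'.
Proof.
move=> /subsetP XX /subsetP YY [s [t [l [[sX tX] lY ul cl]]]]; exists s, t, l; split=> //.
  by split; apply: XX.
by move=> z /lY /YY.
Qed.

Lemma copy1_nonempty X Y : (2 <= ell)%N -> copy1 c e X Y -> exists z, z \in Y.
Proof.
move=> l2 [a [[|b l] [_ lY ul /copy_card]]]; last by exists b; apply/lY/mem_head.
by rewrite cardsE (card_uniqP ul) => lE; move: l2; rewrite -lE.
Qed.

Lemma adj_class_small (X Y : {set V}) s : cycle_orientation c -> ~ directed_cycle c -> oriented e ->
  s \in X -> ~ copy1 c e X Y -> (#|[set w in Y | adj e s w]| <= 2 * thr ell e)%N.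
Proof.
move=> cyc ndir ori sX no.
have h b : (#|nbh e b s Y| <= thr ell e)%N.
  by rewrite leqNgt; apply/negP => /(copy1_of_nbh cyc ndir ori sX).
apply: (@leq_trans (#|nbh e true s Y| + #|nbh e false s Y|)); last first.
  by rewrite mul2n -addnn leq_add.
apply: leq_trans (leq_card_setU _ _); apply/subset_leq_card/subsetP => z.
by rewrite !inE /adj /dir => /andP[-> /orP[->|->]]; rewrite ?orbT.
Qed.
End Copies.

(** Once [s] and [z] are fixed, at most [K] choices of [w] remain. *)
Lemma sum_bool_le (V : finType) (A B Y : {set V}) (P : V -> V -> V -> bool) (r : rel V) K :
  (forall w z s, P w z s -> r s w) -> (forall s, s \in A -> (#|[set w in Y | r s w]| <= K)%N) ->
  (\sum_(w in Y) \sum_(z in B) \sum_(s in A) P w z s <= K * (#|V| * #|V|))%N.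
Proof.
move=> Pr h; rewrite exchange_big /=.
apply: (@leq_trans (\sum_(z in B) \sum_(s in A) K)); last first.
  rewrite !sum_nat_const mulnA mulnC leq_mul2l; apply/orP; right.
  by rewrite leq_mul // max_card.
apply: leq_sum => z _; rewrite exchange_big /=; apply: leq_sum => s sA.
apply: leq_trans (h s sA); rewrite card_set_sum; apply: leq_sum => w _.
by case E : (P w z s) => //; rewrite (Pr _ _ _ E).
Qed.

(** * Several classes always admit a merger *)

Section NonMergeable.
Variables (R : realType) (mu rho eta : R) (k : nat).
Variables (ell : nat) (c : rel 'I_ell) (V : finType) (e : rel V) (V1 : {set V}).
Variables (K : finType) (f : V -> K) (q : R).
Local Notation U y := (colour_class f V1 y).
Local Notation n := (#|V|%:R : R).
Local Notation link1 := (linked1 c e V1 f q).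
Local Notation link2 := (linked2 c e V1 f q).
Hypotheses (cyc : cycle_orientation c) (ndir : ~ directed_cycle c) (l3 : (3 <= ell)%N).
Hypotheses (ori : oriented e) (mu0 : 0 < mu <= 1) (rho0 : 0 < rho <= 1) (n0 : (0 < #|V|)%N).
Hypotheses (ore : ore_condition e mu) (heta : #|~: V1|%:R <= eta * n).
Hypotheses (hbud : eta + rho <= mu / 16) (Kk : (#|K| <= k)%N).
Hypotheses (hthr : (thr ell e + ell + 1)%:R <= copy_eps mu rho k * n).
Hypotheses (q0 : 0 <= q) (hq : 2 * (k ^ 2)%:R * q <= rho * n).
Hypothesis (big : forall x, x \in V1 -> 2 * rho * n <= #|U (f x)|%:R).

(** A single set tests the property: a counterexample if there is one, the empty set otherwise. *)
Lemma failing_set (P : {set V} -> Prop) :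
  {W : {set V} | #|W|%:R <= q /\ (P W -> forall W' : {set V}, #|W'|%:R <= q -> P W')}.
Proof.
apply: boolp.cid; have [L|/boolp.existsPNP[W Wq nP]] := boolp.pselect (forall W : {set V}, #|W|%:R <= q -> P W).
  by exists set0; rewrite cards0.
by exists W.
Qed.

(** The union of the test sets for all ordered pairs of colours and both kinds of copies. A copy
    that avoids the union also avoids the test set of its own pair, so the link is robust. *)
Lemma kill_set : exists W : {set V}, #|W|%:R <= rho * n /\ forall x y,
  (copy1 c e (U x :\: W) (U y :\: W) -> link1 x y) /\
  (copy2 c e (U x :\: W) (U y :\: W) -> link2 x y).
Proof.
pose W1 (p : K * K) := sval (failing_set (fun W => copy1 c e (U p.1 :\: W) (U p.2 :\: W))).
pose W2 (p : K * K) := sval (failing_set (fun W => copy2 c e (U p.1 :\: W) (U p.2 :\: W))).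
have W1P p := svalP (failing_set (fun W => copy1 c e (U p.1 :\: W) (U p.2 :\: W))).
have W2P p := svalP (failing_set (fun W => copy2 c e (U p.1 :\: W) (U p.2 :\: W))).
exists (\bigcup_p (W1 p :|: W2 p)); split.
  apply: (@le_trans _ _ (\sum_(p : K * K) 2 * q)); last first.
    rewrite sumr_const card_prod -[leLHS]mulr_natl; apply: le_trans hq.
    rewrite mulrCA -mulrA ler_pM2l // ler_wpM2r // ler_nat -mulnn.
    by rewrite leq_mul.
  apply: (@le_trans _ _ (\sum_(p : K * K) (#|W1 p|%:R + #|W2 p|%:R))); last first.
    apply: ler_sum => p _; have [h1 _] := W1P p; have [h2 _] := W2P p.
    by rewrite -/(W1 p) in h1; rewrite -/(W2 p) in h2; lra.
  rewrite [leRHS](eq_bigr (fun p => (#|W1 p| + #|W2 p|)%:R)); last by move=> p _; rewrite natrD.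
  rewrite -natr_sum ler_nat; elim/big_rec2: _ => [|p m X _ IH]; first by rewrite cards0.
  apply: leq_trans (leq_card_setU _ _) _; apply: leq_add => //; exact: leq_card_setU.
move=> x y.
have s1 : W1 (x, y) \subset \bigcup_p (W1 p :|: W2 p).
  by apply: subset_trans (subsetUl _ (W2 (x, y))) _; apply: (bigcup_sup (x, y)).
have s2 : W2 (x, y) \subset \bigcup_p (W1 p :|: W2 p).
  by apply: subset_trans (subsetUr (W1 (x, y)) _) _; apply: (bigcup_sup (x, y)).
split=> h.
  by have [_] := W1P (x, y); apply; apply: copy1S h; apply: setDS.
by have [_] := W2P (x, y); apply; apply: copy2S h; apply: setDS.
Qed.

(** The part [A] is one class and [B] the union of the others, both without the test sets. If
    nothing merges, the second form of [mergeable] excludes having both kinds of copies into a class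
    of [B], and the first form gives the triangle bound. *)
Lemma exists_mergeable x0 x1 : x0 \in V1 -> x1 \in V1 -> f x0 != f x1 ->
  exists x y, [/\ x \in V1, y \in V1, f x != f y & mergeable c e V1 f q (f x) (f y)].
Proof.
move=> x0V x1V f01; apply: boolp.contrapT => no.
have {}no x y : x \in V1 -> y \in V1 -> f x != f y -> ~ mergeable c e V1 f q (f x) (f y).
  by move=> xV yV fxy m; apply: no; exists x, y.
have [W [Wn HW]] := kill_set.
pose A := U (f x0) :\: W; pose B := (V1 :\: U (f x0)) :\: W.
have inU x : x \in V1 -> x \in U (f x) by move=> xV; rewrite inE xV eqxx.
have classB y : colour_class f B y \subset U y :\: W.
  by apply/subsetP => z /setIdP[/setDP[/setDP[zV _] zW] fz]; rewrite in_setD zW inE zV.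
have inB z : z \in B -> z \in V1 /\ f z != f x0.
  by case/setDP => /setDP[zV]; rewrite inE zV.
have cut x (X : {set V}) : x \in V1 -> U (f x) \subset X -> rho * n <= #|X :\: W|%:R.
  move=> xV UX; have h1 := big xV.
  have : #|U (f x)|%:R <= #|X :\: W|%:R + #|W|%:R :> R.
    rewrite -natrD ler_nat; apply: leq_trans (subset_leq_card UX) _.
    by rewrite -(cardsID W X) addnC leq_add2l subset_leq_card // subsetIr.
  by move: Wn; lra.
have ds : dense_setting e mu rho A B.
  split=> //; first 1 last.
  - exact: (cut x0).
  - apply: (cut x1) => //; apply/subsetP => z /setIdP[zV /eqP fz].
    by rewrite in_setD zV inE zV /= fz eq_sym f01.
  - by rewrite ltr0n.
  - apply: (@le_trans _ _ (#|~: V1|%:R + #|W|%:R)).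
      rewrite -natrD ler_nat; apply: leq_trans (leq_card_setU _ _); apply/subset_leq_card/subsetP => z.
      rewrite !inE; by case: (z \in W); case: (z \in V1); case: (f z == f x0).
    apply: (@le_trans _ _ ((eta + rho) * n)); first by rewrite mulrDl lerD.
    by rewrite ler_pM2r // ltr0n.
  by rewrite disjoints_subset; apply/subsetP => z /setDP[zU zW]; rewrite !inE zW /=; move: zU; rewrite inE => ->.
apply: (@no_copies_contradiction R mu rho k mu0 rho0 ell c V e A B K f) => //.
  move=> y [C1 C2]; have [|z zy] := copy1_nonempty _ C1; first exact: ltnW.
  have /setIdP[/inB[zV fz] /eqP fzy] := zy; rewrite -fzy in C1 C2.
  have [L1 L2] := HW (f x0) (f z).
  apply: (no _ _ x0V zV); first by rewrite eq_sym.
  by right; split; [apply: L1; apply: copy1S C1|apply: L2; apply: copy2S C2].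
move=> _.
(* If the class of [x0] is linked to [y], no other class is, as the two would merge. So the vertices
   of [A], or all those of [B], have few neighbours in this class, and every triangle with [w] there
   uses an edge of the sparse kind. *)
have small y : (forall s, s \in A -> (#|[set w in colour_class f B y | adj e s w]| <= 2 * thr ell e)%N) \/
               (forall s, s \in B -> (#|[set w in colour_class f B y | adj e s w]| <= 2 * thr ell e)%N).
  have [L|L] := boolp.pselect (link1 (f x0) y); [right|left] => s sA.
    have [sV fs] := inB _ sA.
    apply: (adj_class_small cyc ndir ori (X := U (f s) :\: W)).
      by rewrite in_setD inU // andbT; move: sA => /setDP[].
    move=> C1; apply: (no s x0 sV x0V fs); left; exists y; split=> //.
    by apply: (HW _ _).1; apply: copy1S C1.
  apply: (adj_class_small cyc ndir ori sA) => C1; apply: L; apply: (HW _ _).1.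
  exact: copy1S C1.
have tri : (triangles (adj e) (adj e) (adj e) A B <= k * (2 * thr ell e * (#|V| * #|V|)))%N.
  rewrite /triangles (partition_big f predT) //=.
  apply: (@leq_trans (\sum_(y : K) 2 * thr ell e * (#|V| * #|V|))); last first.
    by rewrite sum_nat_const leq_mul2r Kk orbT.
  apply: leq_sum => y _; rewrite (eq_bigl (mem (colour_class f B y))); last by move=> w; rewrite !inE.
  have [h|h] := small y.
    by apply: (@sum_bool_le V A B _ (fun w z s => adj e w z && adj e z s && adj e s w) (adj e)) h => w z s /andP[].
  rewrite (eq_bigr (fun w => \sum_(s in A) \sum_(z in B) (adj e w z && adj e z s && adj e s w))%N); last first.
    by move=> w _; rewrite exchange_big.
  by apply: (@sum_bool_le V B A _ (fun w s z => adj e w z && adj e z s && adj e s w) (adj e)) h => w s z /andP[/andP[]]; rewrite adj_sym.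
apply: (@le_trans _ _ (k * (2 * thr ell e * (#|V| * #|V|)))%:R); first by rewrite ler_nat.
have n1 : 0 < n by rewrite ltr0n.
rewrite [leLHS](_ : _ = (2 * k * thr ell e)%:R * n ^+ 2); last by rewrite !natrM; ring.
rewrite [n ^+ 3]exprS [leRHS]mulrA ler_pM2r ?exprn_gt0 //.
have h1 : (thr ell e)%:R <= tri_eps mu rho ^+ 2 / (2 * (4 * k + 1)%:R) * n.
  apply: (@le_trans _ _ (thr ell e + ell + 1)%:R); first by rewrite ler_nat -addnA leq_addr.
  apply: le_trans hthr _. by rewrite ler_pM2r // ge_min lexx.
have k41 : 0 < (4 * k + 1)%:R :> R by rewrite ltr0n addn1.
have h2 : (4 * k + 1)%:R * (thr ell e)%:R <= tri_eps mu rho ^+ 2 / 2 * n.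
  have -> : tri_eps mu rho ^+ 2 / 2 * n = (4 * k + 1)%:R * (tri_eps mu rho ^+ 2 / (2 * (4 * k + 1)%:R) * n).
    by move: ((4 * k + 1)%:R) k41 => kk k41; field; lra.
  by rewrite ler_pM2l.
apply: le_trans h2; rewrite -natrM ler_nat leq_mul2r; apply/orP; right.
by apply: leq_trans (leq_addr _ _); rewrite leq_mul2r orbT.
Qed.
End NonMergeable.

(** * Iterated mergers *)

Section Iteration.
Variables (R : realType) (ell : nat) (c : rel 'I_ell) (V : finType) (e : rel V) (V1 : {set V}).

Lemma reachable_weaken (q q' : R) (t t' : nat) x y : q' <= q -> (t <= t')%N ->
  reachable c e V1 q t x y -> reachable c e V1 q' t' x y.
Proof.
move=> qq tt h W WV Wq; have [Q [QV Qt Qx Qy]] := h W WV (le_trans Wq qq).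
by exists Q; split=> //; apply: leq_trans Qt _; rewrite leq_mul2r tt orbT.
Qed.

Lemma reachable_sym (q : R) t x y : reachable c e V1 q t x y -> reachable c e V1 q t y x.
Proof. by move=> h W; rewrite setUC => WV Wq; have [Q [QV Qt Qx Qy]] := h W WV Wq; exists Q. Qed.

Lemma merge_step_ge (N t : nat) : (t <= iter N (merge_step ell) t)%N.
Proof.
elim: N => //= N IH; apply: leq_trans IH _; rewrite /merge_step mulnDl mul1n.
by rewrite addnAC leq_addl.
Qed.

Lemma merge_cost_le (t t' : nat) : (t <= t')%N -> (merge_cost ell t <= merge_cost ell t')%N.
Proof. by move=> tt; rewrite /merge_cost leq_add2l leq_mul2l leq_add2r leq_mul2r tt !orbT. Qed.

Variables (mu rho eta : R) (k : nat) (K : finType).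
Hypotheses (cyc : cycle_orientation c) (ndir : ~ directed_cycle c) (l3 : (3 <= ell)%N).
Hypotheses (ori : oriented e) (mu0 : 0 < mu <= 1) (rho0 : 0 < rho <= 1) (n0 : (0 < #|V|)%N).
Local Notation n := (#|V|%:R : R).
Hypotheses (ore : ore_condition e mu) (heta : #|~: V1|%:R <= eta * n).
Hypotheses (hbud : eta + rho <= mu / 16) (Kk : (#|K| <= k)%N).
Hypotheses (hthr : (thr ell e + ell + 1)%:R <= copy_eps mu rho k * n).

(** Induction on the number of colours in use. A merger halves the allowance, applies [merge_step]
    and drops one colour; classes only grow, so the lower bound on their sizes persists. *)
Lemma closed_by_merging (N : nat) (f : V -> K) (q : R) (t : nat) :
  coloured_closed c e V1 f q t -> (#|f @: V1| <= N.+1)%N ->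
  (forall x, x \in V1 -> 2 * rho * n <= #|colour_class f V1 (f x)|%:R) ->
  0 <= q -> 2 * (k ^ 2)%:R * q <= rho * n ->
  (merge_cost ell (iter N (merge_step ell) t))%:R <= q / 2 ^+ N ->
  is_closed c e V1 (q / 2 ^+ N) (iter N (merge_step ell) t) V1.
Proof.
elim: N f q t => [|N IH] f q t Cf fN big q0 hq hc.
  rewrite /= expr0 divr1; split=> // x y xV yV xy; apply: Cf => //.
  by have /card_le1_eqP := fN; apply; apply: imset_f.
have [same|/boolp.existsNP[x0 /boolp.not_implyP[x0V /boolp.existsNP[x1 /boolp.not_implyP[x1V /eqP f01]]]]] :=
  boolp.pselect (forall x, x \in V1 -> forall y, y \in V1 -> f x = f y).
  split=> // x y xV yV xy; apply: (@reachable_weaken q _ t).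
  - by rewrite ler_pdivrMr ?exprn_gt0 // ler_peMr // exprn_ege1 // ler1n.
  - exact: merge_step_ge.
  - by apply: Cf => //; apply: same.
have [x [y [xV yV fxy mg]]] :=
  exists_mergeable cyc ndir l3 ori mu0 rho0 n0 ore heta hbud Kk hthr q0 hq big x0V x1V f01.
have qs : q / 2 / 2 ^+ N = q / 2 ^+ N.+1 by rewrite exprS invfM mulrA.
have tq : (merge_cost ell t)%:R <= q / 2.
  apply: (@le_trans _ _ (merge_cost ell (iter N.+1 (merge_step ell) t))%:R).
    by rewrite ler_nat merge_cost_le // merge_step_ge.
  apply: le_trans hc _; rewrite -qs ler_pdivrMr ?exprn_gt0 // ler_peMr ?divr_ge0 //.
  by rewrite exprn_ege1 // ler1n.
pose f' z := if f z == f y then f x else f z.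
rewrite iterSr -qs; rewrite iterSr -qs in hc; apply: (IH f') => //.
- move=> a b aV bV ab; rewrite /f'.
  have [fa|fa] := eqVneq (f a) (f y); have [fb|fb] := eqVneq (f b) (f y) => fab.
  + apply: (@reachable_weaken q _ t); [lra | exact: (merge_step_ge 1) |].
    by apply: Cf => //; rewrite fa fb.
  + apply/reachable_sym/(mergeable_reachable l3 Cf tq mg) => //; by rewrite eq_sym.
  + exact: (mergeable_reachable l3 Cf tq mg).
  + apply: (@reachable_weaken q _ t); [lra | exact: (merge_step_ge 1) |].
    by apply: Cf.
- rewrite -ltnS; apply: leq_trans fN; rewrite [ltnRHS](cardsD1 (f y)) imset_f //= ltnS.
  apply/subset_leq_card/subsetP => z /imsetP[w wV ->]; rewrite /f' in_setD1.
  by have [fw|fw] := eqVneq (f w) (f y); rewrite ?fxy ?fw imset_f.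
- move=> z zV; apply: le_trans (big z zV) _; rewrite ler_nat.
  apply/subset_leq_card/subsetP => w; rewrite !inE /f' => /andP[-> /eqP->].
  by rewrite eqxx.
- by rewrite divr_ge0.
- apply: le_trans hq; apply: ler_wpM2l; first by rewrite mulr_ge0.
  by lra.
Qed.
End Iteration.

(** * Clusters are closed *)

Section Regular.
Variables (R : realType) (V : finType).

Lemma card_pairs (r : rel V) (X Y : {set V}) :
  #|[set p in setX X Y | r p.1 p.2]| = (\sum_(z in X) #|[set w in Y | r z w]|)%N.
Proof.
rewrite card_set_sum (eq_bigl (fun p : V * V => (p.1 \in X) && (p.2 \in Y))); last first.
  by case=> a a'; rewrite in_setX.
rewrite -(pair_big (mem X) (mem Y) (fun a b => nat_of_bool (r a b))) /=.
by apply: eq_bigr => z _; rewrite card_set_sum.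
Qed.

Lemma density_conv (r : rel V) (X Y : {set V}) :
  density R (fun x y => r y x) X Y = density R r Y X.
Proof.
rewrite /density [#|X|%:R * _]mulrC (card_pairs (fun x y => r y x)) card_pairs; congr (_%:R / _).
under eq_bigr => z _ do rewrite card_set_sum.
by rewrite exchange_big; apply: eq_bigr => z _; rewrite card_set_sum.
Qed.

Lemma regular_pair_conv (r : rel V) (eps : R) (X Y : {set V}) :
  regular_pair r eps X Y -> regular_pair (fun x y => r y x) eps Y X.
Proof. by move=> h Y' X' YY XX hY hX; rewrite (density_conv r Y' X') (density_conv r Y X); apply: h. Qed.

(** Otherwise the atypical vertices and [Y] would form a subpair whose density is too low for
    regularity. *)
Lemma few_atypical (r : rel V) (eps : R) (X0 Y0 Y : {set V}) :
  regular_pair r eps X0 Y0 -> 0 < eps -> (0 < #|X0|)%N -> (0 < #|Y0|)%N -> Y \subset Y0 ->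
  eps * #|Y0|%:R <= #|Y|%:R ->
  #|[set z in X0 | #|[set w in Y | r z w]|%:R < (density R r X0 Y0 - eps) * #|Y|%:R]|%:R < eps * #|X0|%:R.
Proof.
move=> reg e0 X00 Y00 YY hY; rewrite ltNge; apply/negP; set X := [set z in X0 | _] => hX.
have XX : X \subset X0 by apply/subsetP => z /setIdP[].
have Xp : 0 < #|X|%:R :> R by apply: lt_le_trans hX; rewrite mulr_gt0 // ltr0n.
have Yp : 0 < #|Y|%:R :> R by apply: lt_le_trans hY; rewrite mulr_gt0 // ltr0n.
have := reg _ _ XX YY hX hY; rewrite ltr_distl => /andP[+ _]; apply/negP; rewrite -leNgt.
rewrite /(density R r X Y) card_pairs ler_pdivrMr ?mulr_gt0 // natr_sum.
apply: (@le_trans _ _ (\sum_(z in X) (density R r X0 Y0 - eps) * #|Y|%:R)).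
  by apply: ler_sum => z /setIdP[_ /ltW].
by rewrite sumr_const -[leLHS]mulr_natl mulrCA.
Qed.
End Regular.

Section Clusters.
Variables (R : realType) (ell : nat) (c : rel 'I_ell) (V : finType) (e : rel V).
Hypotheses (cyc : cycle_orientation c) (ndir : ~ directed_cycle c) (l3 : (3 <= ell)%N).
Hypothesis (ori : oriented e).

Lemma fan_copy b u s x p : spells c e (b :: u ++ [:: ~~ b]) -> uniq [:: s, x & p] ->
  opath e u x p -> {in x :: p, forall z, dir e b s z} -> is_copy c e [set z in [:: s, x & p]].
Proof.
move=> [szw S] us wp h; apply: S => //=; rewrite h ?mem_head //= -cats1 opath_cat ?(opath_size wp) //.
by rewrite wp /= dirN andbT h // mem_last.
Qed.

Lemma disjoint_seqs (s1 s2 : seq V) : (forall z, z \in s1 -> z \notin s2) ->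
  [disjoint [set z in s1] & [set z in s2]].
Proof. by move=> h; rewrite disjoints_subset; apply/subsetP => z; rewrite !inE => /h. Qed.

Lemma pair_card (x y : V) : (#|[set x; y]| <= 2)%N.
Proof. by rewrite cards2; case: eqP. Qed.

Lemma cluster_reachable (r : rel V) (b : bool) (Vi Vj V1 : {set V}) (q eps delta d m : R) x y :
  regular_pair r eps Vi Vj -> (forall u v, r u v -> dir e b u v) ->
  #|Vi|%:R = m -> #|Vj|%:R = m -> d <= density R r Vi Vj -> x \in V1 -> y \in V1 -> x != y ->
  (density R r Vi Vj - eps) * m <= #|[set z in Vj | r x z]|%:R ->
  (density R r Vi Vj - eps) * m <= #|[set z in Vj | r y z]|%:R ->
  #|Vi :\: V1|%:R <= delta * m -> #|Vj :\: V1|%:R <= delta * m ->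
  0 < eps -> 2 * eps <= d -> d <= 1 / 2 ->
  delta * m + q + (thr ell e + 4)%:R <= (d - eps) ^+ 2 * m ->
  reachable c e V1 q 2 x y.
Proof.
move=> reg sub Vim Vjm dp xV yV xy hx hy di dj e0 ed d2 num W WV Wq.
have thr0 : 0 <= (thr ell e)%:R :> R by [].
have num' : delta * m + #|W|%:R + (thr ell e)%:R + 4 <= (d - eps) ^+ 2 * m.
  by move: num Wq; rewrite natrD; lra.
have m0 : 0 < m.
  have : 0 <= m by rewrite -Vim.
  rewrite le_eqVlt => /orP[/eqP mE|//]; move: num'; rewrite -mE !mulr0.
  by have : 0 <= #|W|%:R :> R by []; lra.
have de : (d - eps) ^+ 2 * m <= 1 / 4 * m.
  rewrite ler_pM2r // (_ : 1 / 4 = (1 / 2) ^+ 2); last by field.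
  by rewrite lerXn2r ?nnegrE; lra.
set p := density R r Vi Vj in dp hx hy *.
pose X := [set z in Vj | r x z]; pose Y := [set z in Vj | r y z].
have XVj : X \subset Vj by apply/subsetP => z /setIdP[].
have YVj : Y \subset Vj by apply/subsetP => z /setIdP[].
have epm : eps * m <= (p - eps) * m by rewrite ler_pM2r //; lra.
have bX : eps * #|Vj|%:R <= #|X|%:R by rewrite Vjm; apply: le_trans hx.
have bY : eps * #|Vj|%:R <= #|Y|%:R by rewrite Vjm; apply: le_trans hy.
have Vi0 : (0 < #|Vi|)%N by rewrite -(ltr0n R) Vim.
have Vj0 : (0 < #|Vj|)%N by rewrite -(ltr0n R) Vjm.
have fX := few_atypical reg e0 Vi0 Vj0 XVj bX; have fY := few_atypical reg e0 Vi0 Vj0 YVj bY.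
rewrite -/p Vim in fX fY.
set TX := [set z in Vi | _ < _ * #|X|%:R] in fX; set TY := [set z in Vi | _ < _ * #|Y|%:R] in fY.
have [z] : exists z, z \in Vi :\: (TX :|: TY :|: (Vi :\: V1) :|: W :|: [set x; y]).
  apply/set0Pn/eqP => /eqP; rewrite setD_eq0 => /subset_leq_card.
  rewrite -(ler_nat R) Vim => h.
  have : m <= #|TX|%:R + #|TY|%:R + #|Vi :\: V1|%:R + #|W|%:R + 2.
    apply: le_trans h _; rewrite -!natrD ler_nat.
    have c1 := (leq_card_setU (TX :|: TY :|: (Vi :\: V1) :|: W) [set x; y]).1.
    have c2 := (leq_card_setU (TX :|: TY :|: (Vi :\: V1)) W).1.
    have c3 := (leq_card_setU (TX :|: TY) (Vi :\: V1)).1.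
    have c4 := (leq_card_setU TX TY).1.
    by move: c1 c2 c3 c4 (pair_card x y); clear; lia.
  have : 2 * eps * m <= 1 / 2 * m by rewrite ler_pM2r //; lra.
  by move: fX fY di num' de; lra.
rewrite in_setD !in_setU !in_set1 !negb_or -!andbA => /and5P[zX zY zV1 zW /and3P[zx zy zVi]].
have zV : z \in V1 by move: zV1; rewrite in_setD zVi andbT negbK.
have big (A : {set V}) : A \subset Vj -> (d - eps) ^+ 2 * m <= #|A|%:R ->
    (thr ell e < #|(A :&: V1) :\: (W :|: [set x; y] :|: [set z])|)%N.
  move=> AV hA; rewrite -(ltr_nat R).
  have : #|A|%:R <= #|(A :&: V1) :\: (W :|: [set x; y] :|: [set z])|%:R + #|Vj :\: V1|%:R + #|W|%:R + 3 :> R.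
    rewrite -!natrD ler_nat.
    set T := W :|: _ :|: _.
    have : (#|T| <= #|W| + 3)%N.
      have c1 := (leq_card_setU (W :|: [set x; y]) [set z]).1.
      have c2 := (leq_card_setU W [set x; y]).1.
      by move: c1 c2 (pair_card x y); rewrite cards1 -/T; clear; lia.
    have := cardsID V1 A; have := cardsID T (A :&: V1).
    have : (#|(A :&: V1) :&: T| <= #|T|)%N by rewrite subset_leq_card // subsetIr.
    have : (#|A :\: V1| <= #|Vj :\: V1|)%N by rewrite subset_leq_card // setSD.
    by clear; lia.
  by move: hA num' dj; lra.
have typical (A : {set V}) : (p - eps) * m <= #|A|%:R ->
    z \notin [set z in Vi | #|[set w in A | r z w]|%:R < (p - eps) * #|A|%:R] ->
    (d - eps) ^+ 2 * m <= #|[set w in A | r z w]|%:R.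
  move=> hA; rewrite inE zVi -leNgt; apply: le_trans.
  have pe0 : 0 <= d - eps by lra.
  have dpe : d - eps <= p - eps by rewrite lerD2r.
  rewrite expr2 -mulrA; apply: ler_pM => //; first by rewrite mulr_ge0 // ltW.
  by apply: le_trans hA; rewrite ler_pM2r.
have [u szu S] := word_source_dir e cyc ndir b.
have path (A T : {set V}) : A \subset Vj -> (d - eps) ^+ 2 * m <= #|A|%:R -> (#|T| <= ell)%N ->
    exists w l, [/\ uniq (w :: l), opath e u w l, size (w :: l) = ell.-1 & forall v, v \in w :: l ->
      [/\ v \in A, v \in V1, v \notin W :|: [set x; y], v != z & v \notin T]].
  move=> AV hA Tl; have [|w [l [ul lA lT ol]]] := path_avoiding ori (w := u) _ Tl (big A AV hA).
    by rewrite szu -subn2 leq_subr.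
  exists w, l; split=> //; first by rewrite /= -(opath_size ol) szu; case: (ell) l3 => [|[|k]].
  move=> v vl; have /setDP[/setIP[vA vV]] := lA _ vl; rewrite in_setU in_set1 negb_or => /andP[vW vz].
  by split=> //; apply: lT.
have sub' (A : {set V}) : A \subset Vj -> [set w in A | r z w] \subset Vj.
  by move=> AV; apply/subsetP => w /setIdP[/(subsetP AV)].
have [||w1 [l1 [u1 o1 sz1 h1]]] := path [set w in X | r z w] set0 (sub' X XVj).
- exact: typical.
- by rewrite cards0.
have [||w2 [l2 [u2 o2 sz2 h2]]] := path [set w in Y | r z w] [set v in w1 :: l1] (sub' Y YVj).
- exact: typical.
- by apply: leq_trans (card_set_seq _) _; rewrite sz1 leq_pred.
have out1 v : v \in w1 :: l1 -> v \notin w2 :: l2.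
  by move=> v1; apply/negP => /h2[_ _ _ _]; rewrite inE v1.
have copy s w l : uniq (w :: l) -> opath e u w l -> s \notin w :: l ->
    (forall v, v \in w :: l -> r s v) -> is_copy c e [set v in [:: s, w & l]].
  move=> uw ow sw hw; apply: (fan_copy S) => //; first by rewrite cons_uniq sw.
  by move=> v /hw /sub.
have out (s v : V) : s \in [set x; y] -> v \notin W :|: [set x; y] -> v != s.
  by move=> sxy; apply: contraNneq => ->; rewrite in_setU sxy orbT.
have notin s w l : s \in [set x; y] -> (forall v, v \in w :: l -> v \notin W :|: [set x; y]) -> s \notin w :: l.
  by move=> sxy h; apply/negP => /h; rewrite in_setU sxy orbT.
have x2 := set21 x y; have y2 := set22 x y.
have W1 v : v \in w1 :: l1 -> v \notin W :|: [set x; y] by case/h1.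
have W2 v : v \in w2 :: l2 -> v \notin W :|: [set x; y] by case/h2.
have z1 : z \notin w1 :: l1 by apply/negP => /h1[_ _ _]; rewrite eqxx.
have z2 : z \notin w2 :: l2 by apply/negP => /h2[_ _ _]; rewrite eqxx.
exists (z |: ([set v in w1 :: l1] :|: [set v in w2 :: l2])); split.
- apply/subsetP => v; rewrite in_setD => /setU1P[->|/setUP[]].
  + by rewrite in_setU in_set2 !negb_or zW zx zy zV.
  + by rewrite inE => vl; rewrite W1 //; have [] := h1 _ vl.
  + by rewrite inE => vl; rewrite W2 //; have [] := h2 _ vl.
- have c1 := (leq_card_setU [set z] ([set v in w1 :: l1] :|: [set v in w2 :: l2])).1.
  have c2 := (leq_card_setU [set v in w1 :: l1] [set v in w2 :: l2]).1.
  have c3 := card_set_seq (w1 :: l1); have c4 := card_set_seq (w2 :: l2).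
  rewrite sz1 in c3; rewrite sz2 in c4; rewrite cards1 in c1.
  by move: c1 c2 c3 c4 l3; clear; lia.
- rewrite setUA setUACA -!set_cons.
  apply: has_factorU.
  + apply: disjoint_seqs => v; rewrite in_cons => /orP[/eqP->|vl].
      by rewrite in_cons negb_or eq_sym zx notin.
    rewrite in_cons negb_or out1 // andbT; by have [] := h1 _ vl.
  + apply/is_copy_factor/copy => //; first exact: notin.
    by move=> v /h1[]; rewrite !inE => /andP[/andP[_ ->]].
  + apply/is_copy_factor/copy => //.
    by move=> v /h2[]; rewrite !inE => /andP[].
- rewrite [X in z |: X]setUC setUA setUACA -!set_cons.
  apply: has_factorU.
  + apply: disjoint_seqs => v; rewrite in_cons => /orP[/eqP->|vl].
      by rewrite in_cons negb_or eq_sym zy notin.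
    rewrite in_cons negb_or; have [_ _ _ -> _] := h2 _ vl.
    by apply: contraL vl => /out1.
  + apply/is_copy_factor/copy => //; first exact: notin.
    by move=> v /h2[]; rewrite !inE => /andP[/andP[_ ->]].
  + apply/is_copy_factor/copy => //.
    by move=> v /h1[]; rewrite !inE => /andP[].
Qed.
End Clusters.

(** * The clusters of the regularity partition *)

Section ClusterClasses.
Variables (R : realType) (ell : nat) (c : rel 'I_ell) (V : finType) (e e' : rel V).
Variables (eps d : R) (M0 M k m : nat) (V0 : {set V}) (Vc : 'I_k -> {set V}) (f : 'I_k -> 'I_k).
Variable (FE : {set {set V}}).
Hypothesis RP : regularity_partition e eps d M0 M e' V0 Vc m.
Hypothesis PM : partner_map e e' d Vc f.
Hypothesis ET : exceptional_tiling c e eps Vc m (bad_set e e' eps V0 Vc m f) FE.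
Variable i0 : 'I_k.
Local Notation V1 := (~: cover FE).
Local Notation n := (#|V|%:R : R).

(** The default [i0] is reached only on [V0], which the exceptional tiling covers. *)
Definition cluster_index (z : V) : 'I_k := odflt i0 [pick i | z \in Vc i].

Lemma cluster_indexP z : z \in V1 -> z \in Vc (cluster_index z).
Proof.
move=> zV; have : z \in V0 :|: \bigcup_(i < k) Vc i by rewrite (rp_cover RP).
rewrite in_setU => /orP[z0|/bigcupP[i _ zi]].
  move: zV; rewrite inE (subsetP (et_cover ET)) //.
  by rewrite /bad_set in_setU z0.
by rewrite /cluster_index; case: pickP => //= h; rewrite h in zi.
Qed.

Lemma good_vertex z i : z \in V1 -> z \in Vc i -> z \notin bad_in_cluster e e' eps Vc m f i.
Proof.
rewrite inE => zV zi; apply: contra zV => zB; apply: (subsetP (et_cover ET)).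
by rewrite /bad_set in_setU; apply/orP; right; apply/bigcupP; exists i.
Qed.

Lemma covered_in_cluster i : #|Vc i :\: V1|%:R <= 3 * Num.sqrt eps * m%:R.
Proof. by apply: le_trans (et_cluster ET i); rewrite setDE setCK setIC. Qed.

Lemma card_uncovered : #|~: V1|%:R <= Num.sqrt eps * n.
Proof. by rewrite setCK (et_card ET); apply: le_trans (et_small ET) (et_sqrt ET). Qed.

Hypothesis (eps1 : eps <= 1 / 2) (M1 : (0 < M)%N).

Lemma cluster_size_ge : n <= 2 * M%:R * m%:R.
Proof.
have := rp_exceptional RP; have /andP[_ kM] := rp_number RP.
have h : n <= #|V0|%:R + M%:R * m%:R.
  rewrite -natrM -natrD ler_nat -cardsT -(rp_cover RP).
  apply: leq_trans (leq_card_setU _ _) _; rewrite leq_add2l.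
  apply: (@leq_trans (\sum_(i < k) m)); last by rewrite sum_nat_const card_ord leq_mul2r kM orbT.
  elim/big_rec2: _ => [|i a X _ IH]; first by rewrite cards0.
  by apply: leq_trans (leq_card_setU _ _) _; rewrite (rp_size RP) leq_add2l.
have : eps * n <= 1 / 2 * n by rewrite ler_wpM2r.
by rewrite -mulrA; lra.
Qed.

Hypothesis (eps2 : 3 * Num.sqrt eps <= 1 / 2).

Lemma class_size_ge x : x \in V1 -> n / (4 * M%:R) <= #|colour_class cluster_index V1 (cluster_index x)|%:R.
Proof.
move=> xV; set i := cluster_index x.
have h : m%:R <= #|Vc i :&: V1|%:R + 3 * Num.sqrt eps * m%:R.
  rewrite -{1}(rp_size RP i) -(cardsID V1) natrD lerD2l; exact: covered_in_cluster.
have h2 : #|Vc i :&: V1|%:R <= #|colour_class cluster_index V1 i|%:R :> R.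
  rewrite ler_nat; apply/subset_leq_card/subsetP => z /setIP[zi zV]; apply/setIdP; split=> //.
  have zj := cluster_indexP zV; apply: contraTT zj => zi'.
  by rewrite (disjointFr (rp_disjoint RP (i := i) (j := cluster_index z) _) zi) // eq_sym.
have h3 : 3 * Num.sqrt eps * m%:R <= 1 / 2 * m%:R by rewrite ler_wpM2r.
have M0' : 0 < 4 * M%:R :> R by rewrite mulr_gt0 // ltr0n.
rewrite ler_pdivrMr //; apply: (le_trans cluster_size_ge).
apply: (@le_trans _ _ (1 / 2 * m%:R * (4 * M%:R))); last first.
  rewrite ler_pM2r //; lra.
by rewrite le_eqVlt; apply/orP; left; apply/eqP; field.
Qed.

Hypotheses (cyc : cycle_orientation c) (ndir : ~ directed_cycle c) (l3 : (3 <= ell)%N).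
Hypotheses (ori : oriented e) (e0 : 0 < eps) (d2 : 2 * eps <= d <= 1 / 2).
Variable q : R.
Hypothesis num : 3 * Num.sqrt eps * m%:R + q + (thr ell e + 4)%:R <= (d - eps) ^+ 2 * m%:R.

Lemma clusters_closed : coloured_closed c e V1 cluster_index q 2.
Proof.
move=> x y xV yV xy fxy; have xi := cluster_indexP xV; have yi := cluster_indexP yV.
rewrite -fxy in yi; set i := cluster_index x in xi yi.
have [fi dP dM] := PM i; have /andP[d3 d4] := d2; have pure := rp_pure RP.
have gx := good_vertex xV xi; have gy := good_vertex yV yi.
have si : #|Vc i|%:R = m%:R :> R by rewrite (rp_size RP).
have sj : #|Vc (f i)|%:R = m%:R :> R by rewrite (rp_size RP).
case: (rp_refine RP i) => iP.
  apply: (@cluster_reachable R ell c V e cyc ndir l3 ori e' true (Vc i) (Vc (f i)) V1 q eps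
            (3 * Num.sqrt eps) d m%:R) => //; try exact: covered_in_cluster.
  - by apply: (rp_regular RP); rewrite eq_sym.
  - exact: dP.
  - by move: gx; rewrite inE xi iP /= negb_or -leNgt => /andP[].
  - by move: gy; rewrite inE yi iP /= negb_or -leNgt => /andP[].
(* For a cluster in [Pminus] the pure digraph is reversed, and [b = false] places the cluster
   vertices as sinks of the copies. *)
apply: (@cluster_reachable R ell c V e cyc ndir l3 ori (fun a b => e' b a) false (Vc i) (Vc (f i)) V1 q eps
          (3 * Num.sqrt eps) d m%:R) => //; try exact: covered_in_cluster.
- by apply/regular_pair_conv/(rp_regular RP).
- by move=> a b /pure.
- by rewrite density_conv; apply: dM.
- by rewrite density_conv; move: gx; rewrite inE xi iP /= negb_or => /andP[_]; rewrite -leNgt.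
- by rewrite density_conv; move: gy; rewrite inE yi iP /= negb_or => /andP[_]; rewrite -leNgt.
Qed.
End ClusterClasses.

(** * Choice of the constants *)

Lemma bound_le (R : realType) (x : R) (n : nat) : 0 <= x -> (Num.bound x <= n)%N -> x <= n%:R.
Proof.
by move=> x0 xn; apply: ltW; apply: lt_le_trans (archi_boundP x0) _; rewrite ler_nat.
Qed.

Lemma thr_small (R : realType) (ell : nat) (V : finType) (e : rel V) (theta gamma : R) :
  (0 < ell)%N -> 0 < theta -> (alpha e)%:R <= gamma * #|V|%:R ->
  gamma <= theta / (2 * ell%:R * (2 * ell%:R + 1)) ->
  2 * (2 * ell%:R + 1) / theta <= #|V|%:R ->
  (thr ell e + ell + 1)%:R <= theta * #|V|%:R.
Proof.
move=> l0 t0 ha hg hn; have lp : 0 < ell%:R :> R by rewrite ltr0n.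
have hn' : 2 * ell%:R + 1 <= theta / 2 * #|V|%:R.
  by move: hn; rewrite ler_pdivrMr //; lra.
have ha' : ell%:R * (2 * ell%:R + 1) * (alpha e)%:R <= theta / 2 * #|V|%:R.
  have lq : 0 < ell%:R * (2 * ell%:R + 1) :> R by rewrite mulr_gt0 //; lra.
  apply: (@le_trans _ _ (ell%:R * (2 * ell%:R + 1) * (theta / (2 * ell%:R * (2 * ell%:R + 1)) * #|V|%:R))).
    by rewrite ler_pM2l //; apply: le_trans ha _; rewrite ler_wpM2r.
  by rewrite le_eqVlt; apply/orP; left; apply/eqP; field; lra.
have -> : (thr ell e + ell + 1)%:R = ell%:R * (2 * ell%:R + 1) * (alpha e)%:R + (2 * ell%:R + 1) :> R.
  rewrite /thr -addnn -addn1; move: (alpha e) => a.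
  rewrite (_ : (_ + _ + _ = ell * (2 * ell + 1) * a + (2 * ell + 1))%N); last by lia.
  by rewrite natrD natrM natrM natrD natrM.
lra.
Qed.

Lemma sqrt_small (R : realType) (x eps : R) : 0 < eps < x ^+ 2 -> 0 < x -> Num.sqrt eps < x.
Proof.
by move=> /andP[e0 ex] x0; rewrite -[ltRHS](ger0_norm (ltW x0)) -sqrtr_sqr ltr_sqrt // exprn_gt0.
Qed.

Section Constants.
Variables (R : realType) (mu d : R) (M : nat).

(* All relative to the order of the digraph: half the size of a class, the
   number of vertices avoided before the first merger, and a bound for [thr]. *)
Definition class_size : R := Num.min (1 / (8 * M%:R)) (mu / 32).
Definition reach_size : R := Num.min (class_size / (2 * M%:R ^+ 2)) (d ^+ 2 / (32 * M%:R)).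
Definition path_size (rho : R) : R :=
  Num.min (copy_eps mu class_size M) (Num.min (copy2_eps mu rho) (d ^+ 2 / (32 * M%:R))).
Definition merge_rounds (ell : nat) : nat := iter M (merge_step ell) 2.

Hypotheses (M0 : (0 < M)%N) (mu0 : 0 < mu <= 1) (d0 : 0 < d).

Lemma class_size_gt0 : 0 < class_size <= 1.
Proof.
have Mp : 0 < M%:R :> R by rewrite ltr0n.
have /andP[m0 m1] := mu0; apply/andP; split.
  by rewrite lt_min !divr_gt0 ?mulr_gt0.
by rewrite ge_min; apply/orP; right; lra.
Qed.

Lemma reach_size_gt0 : 0 < reach_size.
Proof.
have Mp : 0 < M%:R :> R by rewrite ltr0n.
have /andP[c0 _] := class_size_gt0.
by rewrite lt_min !divr_gt0 ?mulr_gt0 ?exprn_gt0.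
Qed.

Lemma path_size_gt0 rho : 0 < rho <= 1 -> 0 < path_size rho.
Proof.
move=> rho0; have Mp : 0 < M%:R :> R by rewrite ltr0n.
rewrite /path_size lt_min copy_eps_gt0 //=; last exact: class_size_gt0.
by rewrite lt_min copy2_eps_gt0 // divr_gt0 ?mulr_gt0 ?exprn_gt0.
Qed.

Lemma path_size_le rho : [/\ path_size rho <= copy_eps mu class_size M,
  path_size rho <= copy2_eps mu rho & path_size rho <= d ^+ 2 / (32 * M%:R)].
Proof.
have lel (x y : R) : Num.min x y <= x by rewrite ge_min lexx.
have ler (x y : R) : Num.min x y <= y by rewrite ge_min lexx orbT.
split; [exact: lel | exact: (le_trans (ler _ _) (lel _ _)) | exact: (le_trans (ler _ _) (ler _ _))].
Qed.

Section Closed.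
Variables (ell : nat) (c : rel 'I_ell) (V : finType) (e e' : rel V).
Variables (eps : R) (N0 k m : nat) (V0 : {set V}) (Vc : 'I_k -> {set V}) (f : 'I_k -> 'I_k).
Variable (FE : {set {set V}}).
Hypothesis RP : regularity_partition e eps d N0 M e' V0 Vc m.
Hypothesis PM : partner_map e e' d Vc f.
Hypothesis ET : exceptional_tiling c e eps Vc m (bad_set e e' eps V0 Vc m f) FE.
Hypotheses (cyc : cycle_orientation c) (ndir : ~ directed_cycle c) (l3 : (3 <= ell)%N).
Hypotheses (ori : oriented e) (n0 : (0 < #|V|)%N) (N00 : (0 < N0)%N).
Local Notation n := (#|V|%:R : R).
Hypotheses (ore : ore_condition e mu) (d1 : d <= 1 / 2) (e0 : 0 < eps).
Hypotheses (s1 : Num.sqrt eps <= d ^+ 2 / 24) (s2 : Num.sqrt eps <= mu / 32).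
Hypotheses (hthr1 : (thr ell e + ell + 1)%:R <= copy_eps mu class_size M * n).
Hypotheses (hthr2 : (thr ell e + ell + 1)%:R <= d ^+ 2 / (32 * M%:R) * n).
Hypothesis (hcost : (merge_cost ell (merge_rounds ell))%:R <= reach_size / 2 ^+ M * n).

Lemma eps_le_sqrt : eps <= Num.sqrt eps.
Proof.
have sp : 0 <= Num.sqrt eps by apply: sqrtr_ge0.
have m1 : mu <= 1 by case/andP: mu0.
have se : Num.sqrt eps <= 1 by have h := s2; lra.
by rewrite -{1}(sqr_sqrtr (ltW e0)) expr2 ler_piMl.
Qed.

(** The clusters supply at most [M] initial classes. The number of rounds is [M] rather than one
    depending on [k], so that the final [T] depends on [ell] and [M] alone. *)
Lemma remainder_closed : is_closed c e (~: cover FE) (reach_size / 2 ^+ M * n) (merge_rounds ell) (~: cover FE).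
Proof.
have Mp : 0 < M%:R :> R by rewrite ltr0n.
have kM : (N0 <= k <= M)%N := rp_number RP.
have k0 : (0 < k)%N by case/andP: kM => h _; apply: leq_trans h.
pose i0 := Ordinal k0.
have m1 : mu <= 1 by case/andP: mu0.
have dd : d ^+ 2 <= d by rewrite expr2 ger_pMl //; have h := d1; lra.
have es := eps_le_sqrt; have h1 := s1; have h2 := s2; have hd1 := d1; have hd0 := d0; have he0 := e0.
have ed : 2 * eps <= d by lra.
have eh : eps <= 1 / 2 by lra.
have s3 : 3 * Num.sqrt eps <= 1 / 2 by lra.
have mn := cluster_size_ge RP eh.
have m0 : 0 <= m%:R :> R by [].
have q0 : 0 <= reach_size * n by rewrite mulr_ge0 // ltW // reach_size_gt0.
have qd : reach_size * n <= d ^+ 2 / (32 * M%:R) * n.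
  by rewrite ler_wpM2r // ge_min lexx orbT.
have dm : d ^+ 2 / (32 * M%:R) * n <= d ^+ 2 / 16 * m%:R.
  apply: (@le_trans _ _ (d ^+ 2 / (32 * M%:R) * (2 * M%:R * m%:R))).
    by apply: ler_wpM2l => //; rewrite divr_ge0 ?sqr_ge0 ?mulr_ge0.
  by rewrite le_eqVlt; apply/orP; left; apply/eqP; field; lra.
have num : 3 * Num.sqrt eps * m%:R + reach_size * n + (thr ell e + 4)%:R <= (d - eps) ^+ 2 * m%:R.
  have a1 : (thr ell e + 4)%:R <= d ^+ 2 / (32 * M%:R) * n.
    by apply: le_trans hthr2; rewrite ler_nat -addnA leq_add2l addn1 ltnS.
  have a2 : 3 * Num.sqrt eps * m%:R <= d ^+ 2 / 8 * m%:R by rewrite ler_wpM2r //; lra.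
  have a3 : d ^+ 2 / 4 * m%:R <= (d - eps) ^+ 2 * m%:R.
    rewrite ler_wpM2r // (_ : _ / 4 = (d / 2) ^+ 2); last by field.
    by rewrite lerXn2r ?nnegrE; lra.
  by lra.
have cc := clusters_closed (i0 := i0) RP PM ET cyc ndir l3 ori e0 _ num.
have hq : 2 * (M ^ 2)%:R * (reach_size * n) <= class_size * n.
  rewrite mulrA ler_wpM2r //.
  apply: (@le_trans _ _ (2 * (M ^ 2)%:R * (class_size / (2 * M%:R ^+ 2)))).
    by apply: ler_wpM2l; rewrite ?mulr_ge0 // ge_min lexx.
  by rewrite natrX le_eqVlt; apply/orP; left; apply/eqP; field; lra.
rewrite [_ / _ * n]mulrAC; apply: (@closed_by_merging R ell c V e _ mu class_size (Num.sqrt eps) M 'I_k) => //.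
- exact: class_size_gt0.
- exact: (card_uncovered ET).
- have : class_size <= mu / 32 by rewrite ge_min lexx orbT.
  lra.
- by rewrite card_ord; case/andP: kM.
- by apply: cc; rewrite ed.
- apply: leq_trans (max_card _) _; rewrite card_ord; apply: leqW; by case/andP: kM.
- move=> x xV; apply: le_trans (class_size_ge RP ET i0 eh M0 s3 xV).
  apply: (@le_trans _ _ (2 * (1 / (8 * M%:R)) * n)).
    by rewrite ler_wpM2r // ler_pM2l // ge_min lexx.
  by rewrite le_eqVlt; apply/orP; left; apply/eqP; field; lra.
- by move: hcost; rewrite mulrAC.
Qed.
End Closed.
End Constants.

Lemma closed_weaken (R : realType) (ell : nat) (c : rel 'I_ell) (V : finType) (e : rel V)
    (V1 U : {set V}) (q q' : R) t :
  q' <= q -> is_closed c e V1 q t U -> is_closed c e V1 q' t U.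
Proof.
move=> qq [UV h]; split=> // x y xU yU xy.
exact: reachable_weaken qq (leqnn t) (h x y xU yU xy).
Qed.

Theorem lemma3p3 (R : realType) :
  exists T : nat -> nat -> nat,
  exists mu0 : R, 0 < mu0 /\ forall mu : R, 0 < mu < mu0 ->
  exists d0 : R, 0 < d0 /\ forall d : R, 0 < d < d0 ->
  forall ell : nat, (3 <= ell)%N ->
  exists eps0 : R, 0 < eps0 /\ forall eps : R, 0 < eps < eps0 ->
  forall M : nat,
  exists rho0 : R, 0 < rho0 /\ forall rho : R, 0 < rho < rho0 ->
  forall M0 : nat, (3 < M0)%N -> (M0 <= M)%N ->
  exists beta0 : R, 0 < beta0 /\ forall beta : R, 0 < beta < beta0 ->
  let tau : R := beta / 4 ^+ (M + 2) in
  exists gamma0 : R, 0 < gamma0 /\ forall gamma : R, 0 < gamma < gamma0 ->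
  exists n0 : nat,
  forall (c : rel 'I_ell), cycle_orientation c -> ~ directed_cycle c ->
  forall (V : finType) (e : rel V),
    oriented e ->
    (n0 <= #|V|)%N ->
    (((3 / 4 + mu) * #|V|%:R)%:E <= sigma_ore R e)%E ->
    (alpha e)%:R <= gamma * #|V|%:R ->
  forall (e' : rel V) (V0 : {set V}) (k : nat) (Vc : 'I_k -> {set V}) (m : nat),
    regularity_partition e eps d M0 M e' V0 Vc m ->
  forall f : 'I_k -> 'I_k, partner_map e e' d Vc f ->
  forall FE : {set {set V}},
    exceptional_tiling c e eps Vc m (bad_set e e' eps V0 Vc m f) FE ->
  let V1 : {set V} := ~: cover FE in
  (is_closed c e V1 (tau * #|V|%:R) (T ell M) V1 \/
   exists A B : {set V},
     [/\ bipartition V1 A B,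
         is_closed c e V1 (4 * tau * #|V|%:R) (T ell M) A,
         is_closed c e V1 (4 * tau * #|V|%:R) (T ell M) B &
         robust c e V1 rho 2 (ell - 2) A B]) /\
  (forall A B : {set V},
     bipartition V1 A B ->
     is_closed c e V1 (4 * tau * #|V|%:R) (T ell M) A ->
     is_closed c e V1 (4 * tau * #|V|%:R) (T ell M) B ->
     non_negligible rho A -> non_negligible rho B ->
     robust c e V1 rho 2 (ell - 2) A B).
Proof.
exists (fun ell M => merge_rounds M ell), 1; split=> // mu /andP[m0 m1].
have mu1 : 0 < mu <= 1 by rewrite m0 ltW.
exists (1 / 2); split=> [|d /andP[d0 d1] ell l3]; first by rewrite divr_gt0.
(* These bound [Num.sqrt eps]: the first keeps the covered part of a cluster below [d ^+ 2 / 8] of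
   it, the second is half of the share [mu / 16] allowed for vertices outside the two parts. The
   other half is for the deleted set of at most [rho n] vertices. *)
pose s0 := Num.min (d ^+ 2 / 24) (mu / 32).
have s0p : 0 < s0 by rewrite lt_min !divr_gt0 ?exprn_gt0.
exists (s0 ^+ 2); split=> [|eps eps0 M]; first by rewrite exprn_gt0.
have := sqrt_small eps0 s0p; rewrite lt_min => /andP[/ltW s1 /ltW s2].
exists (mu / 32); split=> [|rho /andP[r0 r1] M0 M03 M0M]; first by rewrite divr_gt0.
have Mp : (0 < M)%N by apply: leq_trans M0M; apply: leq_trans M03.
have rho1 : 0 < rho <= 1 by rewrite r0; lra.
have k0 : 0 < reach_size mu d M by apply: reach_size_gt0.
exists (reach_size mu d M); split=> // beta /andP[b0 b1] /=.
pose theta := path_size mu d M rho.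
have t0 : 0 < theta by apply: path_size_gt0.
have lp : 0 < ell%:R :> R by rewrite ltr0n; apply: leq_trans l3.
have lq : 0 < 2 * ell%:R * (2 * ell%:R + 1) :> R by rewrite !mulr_gt0 //; lra.
exists (theta / (2 * ell%:R * (2 * ell%:R + 1))); split=> [|gamma /andP[g0 /ltW g1]]; first by rewrite divr_gt0.
pose cost := merge_cost ell (merge_rounds M ell).
exists (maxn (Num.bound (2 * (2 * ell%:R + 1) / theta))
             (Num.bound (cost%:R / (reach_size mu d M / 2 ^+ M)))).
move=> c cyc ndir V e ori; rewrite geq_max => /andP[n1 n2] hore halpha e' V0 k Vc m RP f PM FE ET.
set V1 := ~: cover FE.
have {}n1 : 2 * (2 * ell%:R + 1) / theta <= #|V|%:R.
  by apply: bound_le n1; rewrite divr_ge0 ?mulr_ge0 //; lra.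
have {}n2 : cost%:R / (reach_size mu d M / 2 ^+ M) <= #|V|%:R.
  by apply: bound_le n2; rewrite divr_ge0 // divr_ge0 ?exprn_ge0 // ltW.
have Vp : (0 < #|V|)%N.
  by rewrite -(ltr0n R); apply: lt_le_trans n1; rewrite divr_gt0 ?mulr_gt0 //; lra.
have ore := sigma_ore_condition hore.
have hthr := thr_small (leq_trans _ l3) t0 halpha g1 n1.
have [p1 p2 p3] := path_size_le mu d M rho.
have thr_le x : theta <= x -> (thr ell e + ell + 1)%:R <= x * #|V|%:R.
  by move=> tx; apply: le_trans (hthr isT) _; rewrite ler_wpM2r.
have h1 := thr_le _ p1; have h2 := thr_le _ p2; have h3 := thr_le _ p3.
split; last first.
  move=> A B bip _ _; apply: (@robust_vector R mu rho (Num.sqrt eps) ell c V e V1 A B) => //.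
    exact: (card_uncovered ET).
  lra.
left; have e0 : 0 < eps by case/andP: eps0.
apply: (@closed_weaken R ell c V e V1 V1 (reach_size mu d M / 2 ^+ M * #|V|%:R)).
  rewrite ler_wpM2r //; apply: ler_pM; [exact: ltW | by rewrite invr_ge0 exprn_ge0 | exact: ltW |].
  rewrite ler_pV2 ?inE ?unitfE ?lt0r_neq0 ?exprn_gt0 //.
  apply: (@le_trans _ _ (4 ^+ M)); first by rewrite lerXn2r // ?nnegrE // ler_nat.
  by rewrite ler_weXn2l ?leq_addr // ler1n.
apply: (remainder_closed _ _ _ RP PM ET) => //; first exact: leq_trans M03.
  exact: ltW.
by rewrite [leRHS]mulrC -ler_pdivrMr // divr_gt0 ?exprn_gt0.
Qed.
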